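(* For all positive integers $m,n,d$, the identity $$\pm|MS^d| = |MP|^{(d+1)d/2}\,\operatorname{Res}_{m,n}(x_1,x_2,x_3)^{(d+1)d(d-1)/6}$$ holds in $\mathbb{K}$ (i.e. the two sides agree for one choice of the sign).
   Context: Let $m,n\ge 1$ and let $x_i(s,u;t,v)=\sum_{j=0}^m\sum_{k=0}^n c^i_{jk}s^ju^{m-j}t^kv^{n-k}$, $i=1,\dots,4$, be four generic bihomogeneous polynomials of bi-degree $(m,n)$, i.e. the $c^i_{jk}$ are independent indeterminates. Let $\mathbb{K}=\mathbb{Q}(c^i_{jk})$, and let $S_{k,l}$ be the $\mathbb{K}$-vector space of bihomogeneous polynomials of bi-degree $(k,l)$ in $(s,u;t,v)$. All spaces have monomial bases, each with a fixed order, and matrices are taken in these bases. $|A|$ denotes the determinant of a square matrix $A$. $MP$ is the (square, size $4mn$) matrix of $\phi:S_{m-1,n-1}^4\to S_{2m-1,2n-1}$, $(p_1,p_2,p_3,p_4)\mapsto\sum_{i=1}^4p_ix_i$. Let $\Gamma_0=\{\gamma\in\mathbb{Z}_{\ge0}^4:|\gamma|=d,\ \gamma_4\le1\}$, a set of cardinality $(d+1)^2$, and write $x^\gamma=x_1^{\gamma_1}x_2^{\gamma_2}x_3^{\gamma_3}x_4^{\gamma_4}$. $MS^d$ is the (square, size $(d+1)^2mn$) matrix of $\psi^d:S_{m-1,n-1}^{\Gamma_0}\to S_{(d+1)m-1,(d+1)n-1}$, $(p_\gamma)_{\gamma\in\Gamma_0}\mapsto\sum_{\gamma\in\Gamma_0}p_\gamma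 x^\gamma$. $\operatorname{Res}_{m,n}(f_1,f_2,f_3)$ is the bihomogeneous resultant of three generic polynomials of bi-degree $(m,n)$: the irreducible polynomial with integer coefficients (unique up to sign) in the coefficients of the $f_i$ which vanishes, after specializing the coefficients in a field $k$, if and only if the system $f_1=f_2=f_3=0$ has a solution in $\mathbb{P}^1_{\overline k}\times\mathbb{P}^1_{\overline k}$. *)

(* Defs.v *)
From HB Require Import structures.
From mathcomp Require Import all_boot all_order all_algebra.
From mathcomp.multinomials Require Export mpoly.

Set Implicit Arguments.
Unset Strict Implicit.
Unset Printing Implicit Defensive.

Import GRing.Theory.
Local Open Scope ring_scope.

(* Polynomials in (s,u;t,v) live in {mpoly R[4]}, with variables 0, 1, 2, 3
   standing for s, u, t, v.  The exponents of s^a u^(k-a) t^b v^(l-b), for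
   (a, b) in 'I_k.+1 * 'I_l.+1, index the monomial basis of S_{k,l}. *)
Definition bimon (k l : nat) (ab : 'I_k.+1 * 'I_l.+1) : 'X_{1..4} :=
  [multinom [tuple (ab.1 : nat); (k - ab.1)%N; (ab.2 : nat); (l - ab.2)%N]].

Definition bipoly (R : comNzRingType) (m n : nat)
    (a : 'I_m.+1 -> 'I_n.+1 -> R) : {mpoly R[4]} :=
  \sum_(j < m.+1) \sum_(k < n.+1) a j k *: 'X_[bimon (j, k)].

Definition sutv (R : Type) (s u t v : R) : 'I_4 -> R := tnth [tuple s; u; t; v].

(* Index type of the coefficients of r polynomials of bi-degree (m,n). *)
Definition coefIdx (r m n : nat) : finType := ('I_r * 'I_m.+1 * 'I_n.+1)%type.

Definition coefField (m n : nat) : fieldType :=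
  {fraction {mpoly rat[#|coefIdx 4 m n|]}}.

Definition genCoef (m n : nat) (i : 'I_4) (j : 'I_m.+1) (k : 'I_n.+1) :
    coefField m n :=
  tofrac ('X_(enum_rank ((i, j, k) : coefIdx 4 m n))
            : {mpoly rat[#|coefIdx 4 m n|]}).

Definition genPoly (m n : nat) (i : 'I_4) : {mpoly (coefField m n)[4]} :=
  bipoly (@genCoef m n i).

(* The linear map (p_g)_{g in I} |-> \sum_g p_g y_g. *)
Definition combMap (R : comNzRingType) (I : finType) (y : I -> {mpoly R[4]})
    (p : I -> {mpoly R[4]}) : {mpoly R[4]} :=
  \sum_(g : I) p g * y g.

Definition familyBasis (R : comNzRingType) (I : finType) (k l : nat)
    (e : I * ('I_k.+1 * 'I_l.+1)) : I -> {mpoly R[4]} :=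
  fun g => if g == e.1 then 'X_[bimon e.2] else 0.

(* Matrix of a map F : S_{k,l}^I -> S_{k',l'} in the monomial bases, whose
   orders are given by the enumerations e (source) and f (target). *)
Definition monomialMatrix (R : comNzRingType) (I : finType)
    (k l k' l' N : nat)
    (e : 'I_N -> I * ('I_k.+1 * 'I_l.+1)) (f : 'I_N -> 'I_k'.+1 * 'I_l'.+1)
    (F : (I -> {mpoly R[4]}) -> {mpoly R[4]}) : 'M[R]_N :=
  \matrix_(r < N, c < N) (F (familyBasis R (e c)))@_(bimon (f r)).

Definition phi (m n : nat) :
    ('I_4 -> {mpoly (coefField m n)[4]}) -> {mpoly (coefField m n)[4]} :=
  combMap (@genPoly m n).

Definition MP (m n : nat)
    (e : 'I_(4 * m * n) -> 'I_4 * ('I_m.-1.+1 * 'I_n.-1.+1))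
    (f : 'I_(4 * m * n) -> 'I_(2 * m).-1.+1 * 'I_(2 * n).-1.+1) :
    'M[coefField m n]_(4 * m * n) :=
  monomialMatrix e f (@phi m n).

Definition Gamma0 (d : nat) : finType :=
  {g : 'X_{1..4 < d.+1} |
    (mdeg (bmnm g) == d) && (bmnm g (ord_max : 'I_4) <= 1)%N}.

Definition genPolyPow (m n d : nat) (g : Gamma0 d) :
    {mpoly (coefField m n)[4]} :=
  \prod_(i < 4) genPoly m n i ^+ bmnm (val g) i.

Definition psi (m n d : nat) :
    (Gamma0 d -> {mpoly (coefField m n)[4]}) -> {mpoly (coefField m n)[4]} :=
  combMap (@genPolyPow m n d).

Definition MS (m n d : nat)
    (e : 'I_(d.+1 ^ 2 * m * n) -> Gamma0 d * ('I_m.-1.+1 * 'I_n.-1.+1))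
    (f : 'I_(d.+1 ^ 2 * m * n) ->
         'I_(d.+1 * m).-1.+1 * 'I_(d.+1 * n).-1.+1) :
    'M[coefField m n]_(d.+1 ^ 2 * m * n) :=
  monomialMatrix e f (@psi m n d).

Definition irreducibleElt (R : unitRingType) (p : R) : Prop :=
  [/\ p != 0, p \isn't a GRing.unit &
      forall a b : R, p = a * b ->
        a \is a GRing.unit \/ b \is a GRing.unit].

Definition evalCoef (r m n : nat) (R : comNzRingType)
    (P : {mpoly int[#|coefIdx r m n|]})
    (a : 'I_r -> 'I_m.+1 -> 'I_n.+1 -> R) : R :=
  mmap intr (fun x => let: (i, j, k) := enum_val x in a i j k) P.

(* L, with its embedding iota, is an algebraic closure of k. *)
Definition isAlgClosure (k : fieldType) (L : closedFieldType)
    (iota : {rmorphism k -> L}) : Prop :=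
  forall z : L, algebraicOver iota z.

(* (s : u) and (t : v) are homogeneous coordinates on P^1 x P^1. *)
Definition hasCommonZero (L : fieldType) (r m n : nat)
    (a : 'I_r -> 'I_m.+1 -> 'I_n.+1 -> L) : Prop :=
  exists s u t v : L,
    [/\ (s, u) != (0, 0), (t, v) != (0, 0) &
        forall i : 'I_r, (bipoly (a i)).@[sutv s u t v] = 0].

(* Determines P up to sign. *)
Definition isBihomResultant (m n : nat)
    (P : {mpoly int[#|coefIdx 3 m n|]}) : Prop :=
  irreducibleElt P /\
  forall (k : fieldType) (L : closedFieldType) (iota : {rmorphism k -> L}),
    isAlgClosure iota ->
    forall a : 'I_3 -> 'I_m.+1 -> 'I_n.+1 -> k,
      evalCoef P a = 0 <->
      hasCommonZero (fun i j l => iota (a i j l)).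

Definition genCoef123 (m n : nat) (i : 'I_3) :
    'I_m.+1 -> 'I_n.+1 -> coefField m n :=
  @genCoef m n (widen_ord (leqnSn 3) i).

(* Main.v *)
(** Replace the forms [x_4 * S_{m-1,n-1}] occurring in [MP] and [MS^d] by an arbitrary
    family [b] of [mn] forms of bidegree [(2m-1, 2n-1)], and let [P(b)], [S(b)] be the
    resulting determinants.  Expressing [b'] through [x_1, x_2, x_3] and [b] changes
    both families by block triangular matrices, so
      [S(b') P(b)^a = S(b) P(b')^a],
    where [a = d(d+1)/2] is the number of exponents with [gamma_4 = 1].  Hence
    [S(b) / P(b)^a] depends on [x_1, x_2, x_3] only, and [b] may be taken to be the
    monomials of [S_{m-1,n-1}].

    Let [D] be the determinant of [S_{2m-1,n-1}^3 -> S_{3m-1,2n-1}], [p |-> sum p_i x_i].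
    Without a common zero of the [x_i] this map has no kernel, so every prime factor of
    [D] divides [Res]; a pencil along which [Res] has [2mn] simple roots gives
    [D = +- Res].  At a prime of the coefficient ring other than [Res], [D] stays
    nonzero in the residue field; then the [p_i x_i] fill all high bidegrees and some
    family [b] of monomials completes them in bidegree [(2m-1, 2n-1)], whence
    [P(b)] and [S(b)] are both nonzero there.  So [S / P^a] is, up to sign, a power of
    [Res], and its exponent is found by scaling [x_1, x_2, x_3] by 2. *)

Require Import Defs.
From HB Require Import structures.
From mathcomp Require Import all_boot all_order all_fingroup all_algebra all_field ring zify.
From Stdlib Require Import Classical ClassicalEpsilon.
Set Implicit Arguments.
Unset Strict Implicit.
Unset Printing Implicit Defensive.
Import GRing.Theory Num.Theory.
Local Open Scope ring_scope.

(** * Unique factorization *)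

(** The ring is that of integer polynomials in the coefficients of [x_1, x_2, x_3]: its units are
    signs, which gives the sign of the theorem. The price is that integer primes have to be treated
    like the others, through residue fields of positive characteristic; this is possible because
    [Res] is characterized by common zeros over every field.

    For a fixed [b] the determinant [P(b)] has prime factors of its own, unrelated to [Res]. This is
    why [b] has to vary with the prime at which valuations are compared.

    The injectivity behind [D] is usually a cohomology vanishing. Here a syzygy is written, by
    Bezout over [L(s)], as a cross product of the [f_i] with polynomial parts of the [f_i]
    multiplied by negative powers of [t]. Such products have degree below [n] in [t], and degree at
    least [2m] in [s] if nonzero, which explains the asymmetric bidegree [(2m-1, n-1)].

    The equality [D = +- Res] serves a second time at the end: it supplies the degree of [Res],
    about which a characterization by zeros says nothing. *)

Definition dvdr (A : comNzRingType) (x y : A) : Prop := exists z, y = z * x.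

Definition prime_elt (A : idomainType) (p : A) : Prop :=
  [/\ p != 0, p \isn't a GRing.unit &
      forall a b, dvdr p (a * b) -> dvdr p a \/ dvdr p b].

Definition prime_factors (A : idomainType) (x : A) (u : A) (s : seq A) : Prop :=
  [/\ u \is a GRing.unit, (forall p, p \in s -> prime_elt p) &
      x = u * \prod_(p <- s) p].

Definition factorial_ring (A : idomainType) : Prop :=
  forall x : A, x != 0 -> exists u s, prime_factors x u s.

Section Divisibility.
Variable A : idomainType.
Implicit Types x y z p q u : A.

Lemma dvdr_mull x y z : dvdr x y -> dvdr x (z * y).
Proof. by move=> [a ->]; exists (z * a); rewrite mulrA. Qed.

Lemma dvdr_mulr x y z : dvdr x y -> dvdr x (y * z).
Proof. by rewrite mulrC; apply: dvdr_mull. Qed.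

Lemma dvdr_sub x y z : dvdr x y -> dvdr x z -> dvdr x (y - z).
Proof. by move=> [a ->] [b ->]; exists (a - b); rewrite mulrBl. Qed.

Lemma prime_elt_not_dvd_unit p u :
  prime_elt p -> u \is a GRing.unit -> ~ dvdr p u.
Proof.
move=> [_ /negP np _] Uu [z zE]; apply: np.
by move: Uu; rewrite zE unitrM => /andP[].
Qed.

Lemma prime_elt_dvd_prod p (s : seq A) :
  prime_elt p -> dvdr p (\prod_(q <- s) q) -> exists2 q, q \in s & dvdr p q.
Proof.
move=> pp; elim: s => [|q s IHs].
  by rewrite big_nil => /(prime_elt_not_dvd_unit pp (unitr1 A)).
rewrite big_cons => /(let: And3 _ _ h := pp in h) [pq|/IHs[r rs pr]].
  by exists q; rewrite ?mem_head.
by exists r; rewrite ?inE ?rs ?orbT.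
Qed.

Lemma prime_elt_dvd_exp p x k : prime_elt p -> dvdr p (x ^+ k) -> dvdr p x.
Proof.
move=> pp; elim: k => [|k IHk].
  by rewrite expr0 => /(prime_elt_not_dvd_unit pp (unitr1 A)).
by rewrite exprS => /(let: And3 _ _ h := pp in h) [].
Qed.

Lemma prime_elt_dvd_prime p q : prime_elt p -> prime_elt q -> dvdr p q ->
  exists2 u, u \is a GRing.unit & q = u * p.
Proof.
move=> [p0 /negP np _] [q0 _ qP] [z zE]; exists z => //.
have [] := qP z p; first by rewrite -zE; exists 1; rewrite mul1r.
  case=> w wE; case: np; apply/unitrPr; exists w.
  by apply: (mulfI q0); rewrite mulr1 {2}zE wE mulrA mulrC -!mulrA (mulrC q).
case=> w wE; apply/unitrPr; exists w.
by apply: (mulfI q0); rewrite mulr1 {2}zE wE mulrC mulrA.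
Qed.

Lemma prime_factors_dvd x u s p : prime_factors x u s -> prime_elt p ->
  dvdr p x -> exists2 q, q \in s & dvdr p q.
Proof.
move=> [Uu _ ->] pp /(let: And3 _ _ h := pp in h) [|/(prime_elt_dvd_prod pp)//].
by move/(prime_elt_not_dvd_unit pp Uu).
Qed.

(** Dividing by a prime shortens a factorization by exactly one, the measure on which
    [irreducible_content] and [same_valuations] recurse. *)
Lemma prime_factors_cancel x u s p y : prime_factors x u s -> prime_elt p ->
  x = y * p -> exists u' s', prime_factors y u' s' /\ size s = (size s').+1.
Proof.
move=> fx pp xE.
have [q qs pq] : exists2 q, q \in s & dvdr p q.
  by apply: prime_factors_dvd fx pp _; exists y.
case: fx => Uu sP xE'.
have [v Uv qE] := prime_elt_dvd_prime pp (sP _ qs) pq.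
exists (u * v), (rem q s); split; last by rewrite size_rem // prednK // -has_predT; apply/hasP; exists q.
split; first by rewrite unitrM Uu.
  by move=> r /mem_rem; apply: sP.
have p0 : p != 0 by case: pp.
by apply: (mulIf p0); rewrite -xE xE' (big_rem _ qs) /= {1}qE -!mulrA (mulrC p) mulrA.
Qed.

Lemma prime_factorsM x y u v s t : prime_factors x u s -> prime_factors y v t ->
  prime_factors (x * y) (u * v) (s ++ t).
Proof.
move=> [Uu sP ->] [Uv tP ->]; split; first by rewrite unitrM Uu.
  by move=> p; rewrite mem_cat => /orP[/sP|/tP].
by rewrite big_cat /= mulrACA.
Qed.

End Divisibility.

(** In a prime factorization of an irreducible element the cofactor of the first prime is a unit, so
    the element is an associate of that prime. *)
Lemma irreducible_prime (A : idomainType) (p : A) :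
  factorial_ring A -> irreducibleElt p -> prime_elt p.
Proof.
move=> fA [p0 np pI]; have [u [s [Uu sP pE]]] := fA _ p0.
case: s sP pE => [|q s] sP pE.
  by move: np; rewrite pE big_nil mulr1 Uu.
have [q0 nq qP] := sP q (mem_head _ _).
rewrite big_cons mulrCA in pE.
have [Uq|Uw] := pI _ _ pE; first by rewrite Uq in nq.
split=> // a b [z]; rewrite pE => zE.
case: (qP a b); first by exists (z * (u * \prod_(j <- s) j)); rewrite zE (mulrC q) mulrA.
  case=> c ->; left; exists (c * (u * \prod_(j <- s) j)^-1).
  by rewrite (mulrC q) mulrA mulrVK.
case=> c ->; right; exists (c * (u * \prod_(j <- s) j)^-1).
by rewrite (mulrC q) mulrA mulrVK.
Qed.

(** * Gauss's theorem: polynomials over a factorial domain *)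

Section PolyFactorial.
Variable A : idomainType.
Hypothesis fA : factorial_ring A.
Implicit Types (f g h : {poly A}) (p c : A).

Lemma dvdr_polyC p c : dvdr p c -> dvdr p%:P c%:P.
Proof. by move=> [z ->]; exists z%:P; rewrite polyCM. Qed.

Lemma dvdr_polyCP p f : (forall i, dvdr p f`_i) -> dvdr p%:P f.
Proof.
elim/poly_ind: f => [|f c IHf] pf; first by exists 0; rewrite mul0r.
have [i|g gE] := IHf; first by have := pf i.+1; rewrite coefD coefMX coefC addr0.
have [z zE] := pf 0; rewrite coefD coefMX coefC add0r in zE.
by exists (g * 'X + z%:P); rewrite mulrDl zE gE polyCM mulrAC.
Qed.

Lemma dvdr_polyC_coef p f i : dvdr p%:P f -> dvdr p f`_i.
Proof. by case=> g ->; exists g`_i; rewrite coefMC. Qed.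

(** Induction on the total size: [p] divides one of the two constant terms; subtracting that term
    and cancelling ['X] leaves a smaller product still divisible by [p]. *)
Lemma prime_polyC p : prime_elt p -> prime_elt p%:P.
Proof.
move=> pp; have [p0 np pP] := pp; split; first by rewrite polyC_eq0.
  rewrite poly_unitE; apply/negP => /andP[_]; rewrite coefC /=.
  exact/negP.
move=> f g; have [k] := ubnP (size f + size g).
elim: k f g => // k IHk f g; rewrite ltnS => szk pfg.
case: (eqVneq f 0) => [->|f0]; first by left; exists 0; rewrite mul0r.
case: (eqVneq g 0) => [->|g0]; first by right; exists 0; rewrite mul0r.
have dX h c : dvdr p c -> dvdr p%:P (h * 'X) -> dvdr p%:P h /\ dvdr p%:P (h * 'X + c%:P).
  move=> pc ph; split.
    by apply/dvdr_polyCP=> i; move: (dvdr_polyC_coef i.+1 ph); rewrite coefMX.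
  apply/dvdr_polyCP => -[|i]; rewrite coefD coefMX coefC /=; first by rewrite add0r.
  by rewrite addr0; move: (dvdr_polyC_coef i.+1 ph); rewrite coefMX.
have main f1 c h : f1 * 'X + c%:P != 0 -> (size (f1 * 'X + c%:P)%R + size h <= k)%N ->
   dvdr p%:P ((f1 * 'X + c%:P) * h) -> dvdr p c ->
   dvdr p%:P (f1 * 'X + c%:P) \/ dvdr p%:P h.
  move=> nz sz ph pc.
  have pf1 : dvdr p%:P (f1 * h).
    apply: (proj1 (dX _ 0 _ _)); first by exists 0; rewrite mul0r.
    rewrite mulrAC -[X in dvdr _ X](addrK (c%:P * h)) -mulrDl.
    by apply: dvdr_sub => //; apply/dvdr_mulr/dvdr_polyC.
  case: (IHk f1 h) => //.
    apply: leq_trans sz; rewrite ltn_add2r.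
    case: (eqVneq f1 0) nz => [->|f10 _]; last by rewrite size_MXaddC (negPf f10).
    by rewrite mul0r add0r polyC_eq0 size_poly0 => c0; rewrite size_polyC c0.
    by case=> g1 ->; left; case: (dX (g1 * p%:P) c pc) => //; exists (g1 * 'X); rewrite mulrAC.
  by right.
have /pP : dvdr p (f`_0 * g`_0).
  by move: (dvdr_polyC_coef 0 pfg); rewrite coef0M.
case.
  elim/poly_ind: f f0 szk pfg => [|f1 c _]; first by rewrite eqxx.
  by move=> nz sz pfg pc; apply: main => //; move: pc; rewrite coefD coefMX coefC add0r.
elim/poly_ind: g g0 szk pfg => [|f1 c _]; first by rewrite eqxx.
move=> nz sz pfg pc; apply/or_comm; apply: main => //; first by rewrite addnC.
  by rewrite mulrC.
by move: pc; rewrite coefD coefMX coefC add0r.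
Qed.

(* By Gauss's lemma each prime factor of [a] divides [g] or [h]. *)
Lemma poly_cancel_const a f g h : a != 0 -> a *: f = g * h ->
  exists g' h', [/\ f = g' * h', size g' = size g & size h' = size h].
Proof.
move=> a0; have [u [s]] := fA a0.
elim: s a a0 g h => [|p s IHs] a a0 g h [Uu sP aE] fE.
  exists (u^-1 *: g), h; rewrite -scalerAl -fE aE big_nil mulr1 scalerA mulVr // scale1r.
  by rewrite size_scale // invr_eq0; apply: contraTneq Uu => ->; rewrite unitr0.
have pp := sP p (mem_head _ _).
rewrite big_cons mulrCA in aE.
have b0 : u * \prod_(j <- s) j != 0 by apply: contraNneq a0 => b0; rewrite aE b0 mulr0.
have p0 : p != 0 by case: pp.
have P0 : p%:P != 0 by rewrite polyC_eq0.
have fac : prime_factors (u * \prod_(j <- s) j) u s.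
  by split=> // q qs; apply: sP; rewrite inE qs orbT.
have : dvdr p%:P (g * h).
  by exists ((u * \prod_(j <- s) j) *: f); rewrite -fE aE [RHS]mulrC mul_polyC scalerA.
case/(let: And3 _ _ h := prime_polyC pp in h) => -[k kE].
  have [|g' [h' [-> sg sh]]] := IHs _ b0 k h fac.
    apply: (mulfI P0); rewrite mul_polyC scalerA -aE fE kE mulrA; congr (_ * _).
    by rewrite mulrC.
  by exists g', h'; rewrite sg sh kE [k * _]mulrC mul_polyC size_scale.
have [|g' [h' [-> sg sh]]] := IHs _ b0 g k fac.
  by apply: (mulfI P0); rewrite mul_polyC scalerA -aE fE kE mulrA mulrC.
by exists g', h'; rewrite sg sh kE [k * _]mulrC mul_polyC size_scale.
Qed.

(** Since [%|] is pseudo-divisibility, [irreducible_poly] means irreducible over the fraction field.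
    If [c *: g = r * f], the primes of [c] stay prime in [{poly A}] and do not divide [f], so they
    cancel from [r]: pseudo-divisibility by [f] is divisibility. *)
Lemma prime_primitive_irreducible f : irreducible_poly f ->
  (forall p, prime_elt p -> ~ dvdr p%:P f) -> prime_elt f.
Proof.
move=> fI fP; have [sf fI2] := fI.
have f0 : f != 0 by rewrite -size_poly_gt0 ltnW.
have dvd g : f %| g -> dvdr f g.
  case/Pdiv.WeakIdomain.dvdpP => -[c r] /= c0; have [u [s]] := fA c0.
  elim: s c c0 r => [|p s IHs] c c0 r [Uu sP cE] gE.
    exists (u^-1 *: r); rewrite -scalerAl -gE cE big_nil mulr1 scalerA mulVr //.
    by rewrite scale1r.
  have pp := sP p (mem_head _ _).
  rewrite big_cons mulrCA in cE.
  have b0 : u * \prod_(j <- s) j != 0 by apply: contraNneq c0 => b0; rewrite cE b0 mulr0.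
  have : dvdr p%:P (r * f).
    by exists ((u * \prod_(j <- s) j) *: g); rewrite -gE cE [RHS]mulrC mul_polyC scalerA.
  case/(let: And3 _ _ h := prime_polyC pp in h) => [[k kE]|/fP]; last by [].
  apply: (IHs _ b0 k); first by split=> // q qs; apply: sP; rewrite inE qs orbT.
  have P0 : p%:P != 0 by rewrite polyC_eq0; case: pp.
  by apply: (mulfI P0); rewrite mul_polyC scalerA -cE gE kE mulrA [k * _]mulrC.
split=> //; first by rewrite poly_unitE eqn_leq leqNgt sf.
move=> g h [z zE]; have fgh : f %| g * h by rewrite zE dvdp_mull.
have [co|nco] := boolP (coprimep f g).
  by right; apply: dvd; move: fgh; rewrite Gauss_dvdpr.
left; apply: dvd; rewrite -(eqp_dvdl _ (fI2 _ nco (dvdp_gcdl _ _))).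
exact: dvdp_gcdr.
Qed.

(** A constant prime dividing [f] divides its leading coefficient, whose number of prime factors
    bounds how many can be extracted. *)
Lemma irreducible_content f : irreducible_poly f -> exists c f0,
  [/\ c != 0, f = c *: f0 & forall p, prime_elt p -> ~ dvdr p%:P f0].
Proof.
move=> fI; have f0 : f != 0 by rewrite -size_poly_gt0 ltnW // fI.1.
have [u [s]] := fA (etrans (congr1 negb (lead_coef_eq0 f)) f0).
have [k] := ubnP (size s); elim: k f f0 u s {fI} => // k IHk f f0 u s szs fac.
have [[p [pp [g gE]]]|nex] := classic (exists p, prime_elt p /\ dvdr p%:P f); last first.
  exists 1, f; rewrite oner_eq0 scale1r; split=> // p pp pf.
  by apply: nex; exists p.
have p0 : p != 0 by case: pp.
have lE : lead_coef f = lead_coef g * p by rewrite gE lead_coefM lead_coefC.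
have [u' [s' [fac' szE]]] := prime_factors_cancel fac pp lE.
have g0 : g != 0 by apply: contraNneq f0 => g0; rewrite gE g0 mul0r.
have [|c [h [c0 hE hP]]] := IHk g g0 u' s' _ fac'; first by move: szs; rewrite szE.
exists (p * c), h; split=> //; first by rewrite mulf_neq0.
by rewrite gE hE mulrC mul_polyC scalerA.
Qed.

Lemma factorial_poly : factorial_ring {poly A}.
Proof.
have cst c : c != 0 -> exists u s, prime_factors c%:P u s.
  move=> c0; have [u [s [Uu sP cE]]] := fA c0.
  exists u%:P, [seq p%:P | p <- s]; split.
    rewrite poly_unitE size_polyC coefC /= Uu (contraTneq _ Uu) // => ->.
    by rewrite unitr0.
    by move=> _ /mapP[p ps ->]; apply/prime_polyC/sP.
  by rewrite big_map cE polyCM rmorph_prod.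
move=> f; have [k] := ubnP (size f); elim: k f => // k IHk f; rewrite ltnS => szf f0.
have [sz1|sz1] := leqP (size f) 1.
  by rewrite [f]size1_polyC // in f0 *; apply: cst; rewrite polyC_eq0 in f0.
(* Such a [q] is a proper factor over the fraction field; once constants are cleared, both cofactors
   are shorter than [f]. *)
have [[q [q1 [qf nqf]]]|nex] := classic (exists q : {poly A}, size q != 1%N /\ q %| f /\ ~ (q %= f)).
  case/Pdiv.WeakIdomain.dvdpP: (qf) => -[c r] /= c0 fE.
  have [g [h [gE sg sh]]] := poly_cancel_const c0 fE.
  have sq : (size q < size f)%N.
    rewrite ltn_neqAle dvdp_leq // andbT; apply/negP => /eqP sE.
    by apply: nqf; rewrite -dvdp_size_eqp // sE.
  have g0 : g != 0 by apply: contraNneq f0 => g0; rewrite gE g0 mul0r.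
  have h0 : h != 0 by apply: contraNneq f0 => e0; rewrite gE e0 mulr0.
  have sz := size_mul g0 h0; rewrite -gE in sz.
  have sh1 : (1 < size h)%N.
    by rewrite ltn_neqAle size_poly_gt0 h0 andbT eq_sym sh.
  have sg1 : (size g < size f)%N.
    rewrite sz; case: (size h) sh1 => [|[|j]] // _; rewrite !addnS /= ltnS.
    exact: leq_addr.
  have [|u [s fu]] := IHk g _ g0; first exact: leq_trans szf.
  have [|v [t fv]] := IHk h _ h0; first by rewrite sh; apply: leq_trans szf.
  by exists (u * v), (s ++ t); rewrite gE; apply: prime_factorsM.
have fI : irreducible_poly f.
  split=> // q q1 qf; apply/negPn/negP => nqf; apply: nex; exists q; split=> //.
  by split=> //; apply/negP.
have [c [g [c0 fE gP]]] := irreducible_content fI.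
have [u [s fu]] := cst _ c0.
have g0 : g != 0 by apply: contraNneq f0 => g0; rewrite fE g0 scaler0.
have gI : irreducible_poly g.
  split=> [|q q1 qg]; first by move: sz1; rewrite fE size_scale.
  have fg : g %= f by rewrite fE eqp_sym eqp_scale.
  by rewrite (eqp_rtrans fg) fI.2 // -(eqp_dvdr _ fg).
have pg := prime_primitive_irreducible gI gP.
exists (u * 1), (s ++ [:: g]); rewrite fE -mul_polyC; apply: prime_factorsM fu _.
split; rewrite ?unitr1 ?big_seq1 ?mul1r // => p; rewrite inE => /eqP-> //.
Qed.

End PolyFactorial.

Lemma factorial_iso (A B : idomainType) (f : {rmorphism A -> B})
    (g : {rmorphism B -> A}) :
  cancel f g -> cancel g f -> factorial_ring A -> factorial_ring B.
Proof.
move=> fK gK fA x x0; have gx0 : g x != 0.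
  by rewrite -(inj_eq (can_inj fK)) gK rmorph0.
have [u [s [Uu sP gE]]] := fA _ gx0.
exists (f u), (map f s); split; first exact: rmorph_unit.
  move=> _ /mapP[p /sP[p0 np pP] ->]; split.
  - by rewrite -(inj_eq (can_inj gK)) fK rmorph0.
  - by apply: contra np => /(rmorph_unit g); rewrite fK.
  move=> a b [z zE]; case: (pP (g a) (g b)).
    by exists (g z); rewrite -rmorphM zE rmorphM fK.
    by case=> y yE; left; exists (f y); rewrite -rmorphM -yE gK.
  by case=> y yE; right; exists (f y); rewrite -rmorphM -yE gK.
by rewrite big_map -rmorph_prod -rmorphM -gE gK.
Qed.

Lemma factorial_int : factorial_ring int.
Proof.
move=> x; have [k] := ubnP `|x|%N; elim: k x => // k IHk x; rewrite ltnS => xk x0.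
have [x1|x1] := leqP `|x| 1.
  exists x, [::]; split; rewrite ?big_nil ?mulr1 //.
  have : `|x|%N == 1%N by rewrite eqn_leq x1 absz_gt0.
  by case: x {xk x0 x1} => [[|[|]]|[|]].
have pr := pdiv_prime x1; set p := pdiv `|x| in pr *.
have px : (p%:Z %| x)%Z by rewrite dvdzE /= pdiv_dvd.
case/dvdzP: px => y xE.
have p0 : p%:Z != 0 by rewrite eqz_nat -lt0n prime_gt0.
have y0 : y != 0 by apply: contraNneq x0 => y0; rewrite xE y0 mul0r.
have [|u [s fy]] := IHk y _ y0.
  apply: leq_trans xk; rewrite xE abszM /= -{1}[`|y|%N]muln1 ltn_pmul2l ?absz_gt0 //.
  exact: prime_gt1.
exists (u * 1), (s ++ [:: p%:Z]); rewrite xE; apply: prime_factorsM fy _.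
split; rewrite ?unitr1 ?big_seq1 ?mul1r // => q; rewrite inE => /eqP->.
split=> //.
  apply/negP; rewrite qualifE /= => /orP[]; rewrite ?eqz_nat //; first by move/eqP=> p1; rewrite p1 in pr.
have dvdP (a : int) : dvdr p%:Z a <-> (p%:Z %| a)%Z.
  by split=> [[z ->]|/dvdzP[z ->]]; [exact: dvdz_mull | exists z].
by move=> a b; rewrite !dvdP !dvdzE abszM /= Euclid_dvdM // => /orP[] ab; [left|right].
Qed.

(** * Polynomials in several variables over a factorial domain *)

Section MpolyFactorial.
Variable R : idomainType.

(** The inverse of [muni], which makes the last variable the outer one; this isomorphism carries
    [factorial_poly] from [n] to [n.+1] variables. *)
Definition multi_of_uni (n : nat) (p : {poly {mpoly R[n]}}) : {mpoly R[n.+1]} :=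
  (map_poly (@mwiden n R) p).['X_ord_max].

Lemma multi_of_uni_zmod n : zmod_morphism (@multi_of_uni n).
Proof. by move=> p q; rewrite /multi_of_uni rmorphB hornerD hornerN. Qed.

Lemma multi_of_uni_monoid n : monoid_morphism (@multi_of_uni n).
Proof.
by split=> [|p q]; rewrite /multi_of_uni ?rmorph1 ?hornerC // rmorphM hornerM.
Qed.

HB.instance Definition _ n := GRing.isZmodMorphism.Build
  {poly {mpoly R[n]}} {mpoly R[n.+1]} (@multi_of_uni n) (@multi_of_uni_zmod n).
HB.instance Definition _ n := GRing.isMonoidMorphism.Build
  {poly {mpoly R[n]}} {mpoly R[n.+1]} (@multi_of_uni n) (@multi_of_uni_monoid n).

Lemma muniX_max n : muni ('X_ord_max : {mpoly R[n.+1]}) = 'X.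
Proof.
rewrite muniE msuppX big_seq1 mcoeffX eqxx scale1r mnm1E eqxx.
rewrite (_ : [multinom _ | i < n] = 0%MM) ?mpolyX0 ?scale1r //.
by apply/mnmP=> i; rewrite mnmE mnm1E mnm0E -val_eqE /= gtn_eqF.
Qed.

Lemma muniX_widen n (i : 'I_n) :
  muni ('X_(widen_ord (leqnSn n) i) : {mpoly R[n.+1]}) = ('X_i)%:P.
Proof.
rewrite muniE msuppX big_seq1 mcoeffX eqxx scale1r mnm1E.
rewrite -val_eqE /= ltn_eqF // expr0 alg_polyC.
congr (polyC 'X_[_]); apply/mnmP=> j.
by rewrite mnmE !mnm1E -val_eqE.
Qed.

Lemma muni_mwiden n (p : {mpoly R[n]}) : muni (mwiden p) = p%:P.
Proof.
elim/mpolyind: p => [|c m p _ _ IHp]; first by rewrite !rmorph0.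
rewrite mwidenD muniD IHp polyCD mwidenZ muniZ; congr (_ + _).
rewrite -mul_polyC -mul_mpolyC polyCM; congr (_ * _).
rewrite !mpolyXE_id !rmorph_prod; apply: eq_bigr => i _.
rewrite !rmorphXn /=; congr (_ ^+ _).
by rewrite /mwiden mmapX mmap1U muniX_widen.
Qed.

Lemma multi_of_uniK n : cancel (@multi_of_uni n) (@muni n R).
Proof.
elim/poly_ind => [|p c IHp]; first by rewrite !rmorph0.
rewrite !rmorphD !rmorphM /= IHp; congr (_ * _ + _).
  by rewrite /multi_of_uni map_polyX hornerX muniX_max.
by rewrite /multi_of_uni map_polyC hornerC muni_mwiden.
Qed.

Lemma muniK n : cancel (@muni n R) (@multi_of_uni n).
Proof.
have mD p q : multi_of_uni (p + q) = multi_of_uni p + multi_of_uni q :> {mpoly R[n.+1]}.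
  exact: rmorphD.
have mM p q : multi_of_uni (p * q) = multi_of_uni p * multi_of_uni q :> {mpoly R[n.+1]}.
  exact: rmorphM.
elim/mpolyind => [|c m p _ _ IHp]; first by rewrite !rmorph0.
rewrite muniD mD; congr (_ + _); last exact: IHp.
rewrite -mul_mpolyC muniM mM; congr (_ * _).
  by rewrite muniC /multi_of_uni map_polyC hornerC /= mwidenC.
rewrite mpolyXE_id !rmorph_prod; apply: eq_bigr => i _.
rewrite !rmorphXn /=; congr (_ ^+ _).
have [ilt|] := ltnP i n; last first.
  rewrite -ltnS => igt; have -> : i = ord_max.
    by apply/val_inj/eqP; rewrite eqn_leq -ltnS ltn_ord.
  by rewrite muniX_max /multi_of_uni map_polyX hornerX.
have -> : i = widen_ord (leqnSn n) (Ordinal ilt) by apply: val_inj.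
by rewrite muniX_widen /multi_of_uni map_polyC hornerC /= /mwiden mmapX mmap1U.
Qed.

End MpolyFactorial.

Lemma factorial_mpoly (R : idomainType) (n : nat) :
  factorial_ring R -> factorial_ring {mpoly R[n]}.
Proof.
move=> fR; elim: n => [|n IHn].
  apply: (factorial_iso (f := @mpolyC 0 R) (g := mcoeff 0%MM)) fR => [x|p].
    by rewrite /= mcoeffC eqxx mulr1.
  apply/mpolyP=> m; rewrite mcoeffC (_ : m = 0%MM) ?eqxx ?mulr1 //.
  by apply/mnmP=> -[].
exact: factorial_iso (@multi_of_uniK R n) (@muniK R n) (factorial_poly IHn).
Qed.

Lemma mpoly_int_unit n (u : {mpoly int[n]}) :
  u \is a GRing.unit -> u = 1 \/ u = -1.
Proof.
case/andP; move: (u@_0) => c /eqP ->; rewrite qualifE /= => /orP[] /eqP ->; [left|right].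
  by rewrite mpolyC1.
by rewrite mpolyCN mpolyC1.
Qed.

Lemma prod_divisors_of_prime (A : idomainType) (rho : A) (t : seq A) :
  prime_elt rho -> (forall p, p \in t -> prime_elt p /\ dvdr p rho) ->
  exists j v, v \is a GRing.unit /\ \prod_(q <- t) q = v * rho ^+ j.
Proof.
move=> prho; elim: t => [|q t IHt] tP; first by exists 0, 1; rewrite big_nil unitr1 mulr1.
have [|j [v [Uv vE]]] := IHt; first by move=> p pt; apply: tP; rewrite inE pt orbT.
have [pq qr] := tP q (mem_head _ _).
have [w Uw rE] := prime_elt_dvd_prime pq prho qr.
exists j.+1, (v * w^-1); rewrite unitrM unitrV Uv Uw; split=> //.
rewrite big_cons vE exprS {2}rE mulrCA [X in _ = _ * X]mulrAC -!mulrA mulKr //.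
by rewrite (mulrC q).
Qed.

(** The hypothesis says that [x] and [y] have the same valuation at every prime not associated with
    [rho]. A prime of [x] of this kind divides [y * w], hence [y], and is cancelled from both. When
    none is left, the same relation shows that [y] too is a unit times a power of [rho]. Powers
    stand on both sides because the quotient may have either sign of valuation at [rho]. *)
Lemma same_valuations (A : idomainType) (rho x y : A) :
  factorial_ring A -> prime_elt rho -> x != 0 -> y != 0 ->
  (forall p, prime_elt p -> ~ dvdr p rho ->
     exists z w, [/\ ~ dvdr p z, ~ dvdr p w & x * z = y * w]) ->
  exists i j u, u \is a GRing.unit /\ rho ^+ i * x = u * rho ^+ j * y.
Proof.
move=> fA prho x0 y0; have [u [s]] := fA x x0.
have [k] := ubnP (size s); elim: k x x0 y y0 u s => // k IHk x x0 y y0 u s szs fx H.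
have red p : prime_elt p -> p \in s -> dvdr p y ->
   exists i j u, u \is a GRing.unit /\ rho ^+ i * x = u * rho ^+ j * y.
  move=> pp ps [y' yE]; have p0 : p != 0 by case: pp.
  have [x' xE] : dvdr p x.
    case: fx => _ _ ->; rewrite (big_rem _ ps) /=.
    by exists (u * \prod_(q <- rem p s) q); rewrite mulrCA mulrC.
  have x'0 : x' != 0 by apply: contraNneq x0 => e; rewrite xE e mul0r.
  have y'0 : y' != 0 by apply: contraNneq y0 => e; rewrite yE e mul0r.
  have [u' [s' [fx' sE]]] := prime_factors_cancel fx pp xE.
  have [||i [j [v [Uv E]]]] := IHk x' x'0 y' y'0 u' s' _ fx'.
  - by move: szs; rewrite sE.
  - move=> q pq nq; have [z [w [nz nw E]]] := H q pq nq.
    exists z, w; split=> //; apply: (mulIf p0).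
    by rewrite mulrAC -xE E yE mulrAC.
  by exists i, j, v; split=> //; rewrite xE yE !mulrA E.
have [[p [ps np]]|nex] := classic (exists p, p \in s /\ ~ dvdr p rho).
  have pp : prime_elt p by case: fx => _ sP _; apply: sP.
  have [z [w [nz nw E]]] := H p pp np.
  apply: (red p pp ps); case: (pp) => _ _ pP.
  have /pP[|//] : dvdr p (y * w); last by [].
  rewrite -E; apply: dvdr_mulr; case: fx => _ _ ->; rewrite (big_rem _ ps) /=.
  by exists (u * \prod_(q <- rem p s) q); rewrite mulrCA mulrC.
have [Uu sP xE] := fx.
have [|i [v [Uv sE]]] := @prod_divisors_of_prime _ rho s prho.
  by move=> p ps; split; [apply: sP | apply: NNPP => np; apply: nex; exists p].
have [u' [t [Uu' tP yE]]] := fA y y0.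
have [|j [w [Uw tE]]] := @prod_divisors_of_prime _ rho t prho.
  move=> p pt; split; [exact: tP | apply: NNPP => np].
  have pp := tP _ pt; have [z [w [nz nw E]]] := H p pp np.
  have : dvdr p (x * z).
    rewrite E; apply: dvdr_mulr; rewrite yE (big_rem _ pt) /=.
    by exists (u' * \prod_(q <- rem p t) q); rewrite mulrCA mulrC.
  case/(let: And3 _ _ h := pp in h) => //; rewrite xE sE.
  have pE := let: And3 _ _ h := pp in h.
  move/pE => [/(prime_elt_not_dvd_unit pp Uu)//|/pE[/(prime_elt_not_dvd_unit pp Uv)//|]].
  by move/(prime_elt_dvd_exp pp).
exists j, i, (u * v * (u' * w)^-1); rewrite !unitrM unitrV unitrM Uu Uv Uu' Uw; split=> //.
rewrite xE sE yE tE.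
have U : u' * w \is a GRing.unit by rewrite unitrM Uu'.
have := mulVr U; move: (u' * w)^-1 => c cE.
transitivity (c * (u' * w) * (u * v * rho ^+ i * rho ^+ j)); last by ring.
by rewrite cE; ring.
Qed.

(** * Residue fields at prime elements *)

Section ResidueRing.
Local Open Scope quotient_scope.
Variables (A : idomainType) (p : A).

(** Ideals are boolean predicates, so excluded middle decides divisibility. The argument [pp]
    carries the primality on which the ideal structures of this predicate rest. *)
Definition multiple_of (pp : prime_elt p) (x : A) : bool :=
  if excluded_middle_informative (dvdr p x) then true else false.

Variable pp : prime_elt p.

Lemma multiple_ofP x : reflect (dvdr p x) (multiple_of pp x).
Proof. by rewrite /multiple_of; case: excluded_middle_informative; constructor. Qed.

Lemma multiple_of_idealr : idealr_closed (multiple_of pp).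
Proof.
split; first by apply/multiple_ofP; exists 0; rewrite mul0r.
  by apply/negP => /multiple_ofP /(prime_elt_not_dvd_unit pp (unitr1 A)).
move=> a u v /multiple_ofP[x ->] /multiple_ofP[y ->]; apply/multiple_ofP.
by exists (a * x + y); rewrite mulrDl mulrA.
Qed.

Lemma multiple_of_prime : prime_idealr_closed (multiple_of pp).
Proof.
move=> u v /multiple_ofP; have [_ _ h] := pp => /h [] uv; apply/orP; [left|right];
  exact/multiple_ofP.
Qed.

HB.instance Definition _ := isIdealr.Build A (multiple_of pp) multiple_of_idealr.
HB.instance Definition _ :=
  isPrimeIdealrClosed.Build A (multiple_of pp) multiple_of_prime.

Definition residue_ideal : prime_idealr A := multiple_of pp.

Definition residue_ring : Type := {ideal_quot residue_ideal}.
HB.instance Definition _ := GRing.ComNzRing.on residue_ring.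

Definition residue_unit (x : residue_ring) : bool :=
  if excluded_middle_informative (exists y, y * x = 1) then true else false.

Definition residue_inv (x : residue_ring) : residue_ring :=
  if excluded_middle_informative (exists y, y * x = 1) is left h
  then projT1 (constructive_indefinite_description _ h) else x.

Lemma residue_mulVx : {in residue_unit, left_inverse 1 residue_inv *%R}.
Proof.
move=> x; rewrite /residue_unit /residue_inv unfold_in /=.
by case: excluded_middle_informative => // h _; case: constructive_indefinite_description.
Qed.

Lemma residue_unitPl (x y : residue_ring) : y * x = 1 -> x \in residue_unit.
Proof.
move=> yx; rewrite /residue_unit unfold_in /=.
by case: excluded_middle_informative => // -[]; exists y.
Qed.

Lemma residue_inv_out : {in [predC residue_unit], residue_inv =1 id}.
Proof.
move=> x nx; rewrite /residue_inv; case: excluded_middle_informative => // -[y yx].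
by move: nx; rewrite inE /= (residue_unitPl yx).
Qed.

HB.instance Definition _ := GRing.ComNzRing_hasMulInverse.Build residue_ring
  residue_mulVx residue_unitPl residue_inv_out.

HB.instance Definition _ := GRing.ComUnitRing_isIntegral.Build residue_ring
  (@Quotient.rquot_IdomainAxiom A residue_ideal).

Definition to_residue (x : A) : residue_ring := \pi_({ideal_quot residue_ideal})%qT x.

Lemma to_residue_zmod : zmod_morphism to_residue.
Proof. by move=> x y; rewrite /to_residue rmorphB. Qed.
Lemma to_residue_monoid : monoid_morphism to_residue.
Proof. by split=> [|x y]; rewrite /to_residue ?rmorph1 ?rmorphM. Qed.

HB.instance Definition _ := GRing.isZmodMorphism.Build A residue_ring to_residue to_residue_zmod.
HB.instance Definition _ := GRing.isMonoidMorphism.Build A residue_ring to_residue to_residue_monoid.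

Lemma to_residue_eq0 x : to_residue x = 0 <-> dvdr p x.
Proof.
rewrite -(rmorph0 to_residue) /to_residue; split=> [/eqP|px].
  by rewrite piE /= Quotient.equivE subr0 => /multiple_ofP.
by apply/eqP; rewrite piE /= Quotient.equivE subr0; apply/multiple_ofP.
Qed.

End ResidueRing.

(** The field is the fraction field of [A / p]. It must be countable, since the algebraic closure in
    which the resultant is tested comes from [countable_algebraic_closure]; a code for [A] passes to
    it by choosing representatives of numerators and denominators. *)
Lemma residue_field (A : idomainType) (code : A -> nat) (p : A) :
  injective code -> prime_elt p ->
  exists (k : countFieldType) (phi : {rmorphism A -> k}),
    forall x, phi x = 0 <-> dvdr p x.
Proof.
move=> code_inj pp; pose Q : idomainType := residue_ring pp.
pose qrep (x : Q) : A := generic_quotient.repr (x : {ideal_quot (residue_ideal pp)}).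
have qrep_inj : injective qrep.
  by move=> x y; apply: (can_inj (@reprK _ _)).
pose c (x : {fraction Q}) : nat * nat :=
  let r := frac (generic_quotient.repr x) in (code (qrep r.1), code (qrep r.2)).
have c_inj : injective c.
  move=> x y; rewrite /c => -[/code_inj/qrep_inj e1 /code_inj/qrep_inj e2].
  apply: (can_inj (@reprK _ _)); apply: val_inj => /=.
  by move: e1 e2; case: (frac _) (frac _) => [? ?] [? ?] /= -> ->.
pose c' (y : nat * nat) : option {fraction Q} :=
  if excluded_middle_informative (exists x, c x = y) is left h
  then Some (projT1 (constructive_indefinite_description _ h)) else None.
have cK : pcancel c c'.
  move=> x; rewrite /c'; case: excluded_middle_informative => [h|[]]; last by exists x.
  by case: constructive_indefinite_description => y /= /c_inj ->.
pose k : countFieldType := HB.pack {fraction Q} (PCanIsCountable cK).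
pose phi : A -> k := fun x => tofrac (to_residue pp x : Q).
have phiZ : zmod_morphism phi by move=> x y; rewrite /phi !rmorphB.
have phiM : monoid_morphism phi.
  by split=> [|x y]; rewrite /phi ?rmorph1 ?rmorphM.
pose phiZm := GRing.isZmodMorphism.Build _ _ phi phiZ.
pose phiMm := GRing.isMonoidMorphism.Build _ _ phi phiM.
exists k, (HB.pack phi phiZm phiMm : {rmorphism A -> k}) => x /=.
rewrite -(to_residue_eq0 pp) /phi; split=> [/eqP|->]; last exact: rmorph0.
by rewrite tofrac_eq0 => /eqP.
Qed.

Lemma mpoly_int_code n : exists code : {mpoly int[n]} -> nat, injective code.
Proof.
exists (fun p => pickle [seq (m : 'X_{1..n}, p@_m) | m <- msupp p]).
move=> p q /(pcan_inj pickleK) E.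
have S : msupp p = msupp q.
  have h (r : {mpoly int[n]}) s : map fst [seq (m, r@_m) | m <- s] = s.
    by elim: s => //= a s ->.
  by move/(congr1 (map fst)): E; rewrite !h.
apply/mpolyP=> m; have [mp|mp] := boolP (m \in msupp p); last first.
  by rewrite !memN_msupp_eq0 // -S.
rewrite S in E; have /eq_in_map/(_ m) : [seq (m, p@_m) | m <- msupp q] = [seq (m, q@_m) | m <- msupp q] by [].
by rewrite -S => /(_ mp) [].
Qed.

(** * Syzygies of three bihomogeneous forms *)

Lemma coefM_top (R : nzRingType) (p q : {poly R}) j k :
  (size p <= j.+1)%N -> (size q <= k.+1)%N -> (p * q)`_(j + k) = p`_j * q`_k.
Proof.
move=> sp sq; have jlt : (j < (j + k).+1)%N by rewrite ltnS leq_addr.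
rewrite coefM (bigD1 (Ordinal jlt)) //= addKn big1 ?addr0 // => i ij.
have [lt|le] := ltnP j i; first by rewrite nth_default ?mul0r ?(leq_trans sp).
rewrite [q`__]nth_default ?mulr0 // (leq_trans sq) //.
have lt : (i < j)%N by rewrite ltn_neqAle le andbT.
by lia.
Qed.

Section Truncations.
Variables (R : comNzRingType) (n : nat).
Implicit Types (f g h : {poly R}) (q : nat -> R).

(** The polynomial part in [t] of [f * \sum_(a < n) q a * t^(-a-1)]. For three forms [f_i] of degree
    [n], the minors of the rows [dropsum q f_i] and [f_i] give a syzygy of degree below [n] in
    [t]. *)
Definition dropsum q f := \sum_(a < n) q a *: drop_poly a.+1 f.

Lemma size_dropsum q f : (size f <= n.+1)%N -> (size (dropsum q f) <= n)%N.
Proof.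
move=> sf; apply: (leq_trans (size_sum _ _ _)); apply/bigmax_leqP => a _.
by apply: leq_trans (size_scale_leq _ _) _; rewrite size_drop_poly; lia.
Qed.

(** Split both polynomials at degree [a]: the products of two high parts cancel, and a high part of
    size at most [n + 1 - a] times a low part of size at most [a] has size at most [n]. *)
Lemma size_cross_drop f g a : (0 < a)%N -> (size f <= n.+1)%N ->
  (size g <= n.+1)%N ->
  (size (drop_poly a f * g - drop_poly a g * f)%R <= n)%N.
Proof.
move=> a0 sf sg.
rewrite -{1}(poly_take_drop a g) -{2}(poly_take_drop a f).
have -> (x y z w t : {poly R}) : x * (y + z * t) - z * (w + x * t) = x * y - z * w by ring.
have sz (x y : {poly R}) : (size x <= n.+1)%N -> (size (drop_poly a x * take_poly a y)%R <= n)%N.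
  move=> sx; have [an|na] := leqP a n; last first.
    by rewrite drop_poly_eq0 ?mul0r ?size_poly0 // (leq_trans sx).
  apply: leq_trans (size_polyMleq _ _) _; rewrite size_drop_poly.
  by have := size_take_poly a y; lia.
by apply: leq_trans (size_polyD _ _) _; rewrite size_polyN geq_max !sz.
Qed.

End Truncations.

Lemma bezout3 (R : idomainType) (f0 f1 f2 : {poly R}) :
  size (gcdp f0 (gcdp f1 f2)) = 1%N ->
  exists e0 e1 e2 c, c != 0 /\ e0 * f0 + e1 * f1 + e2 * f2 = c%:P.
Proof.
move=> sh; have [[u v] /= /eqpP[[a1 a2] /= /andP[a10 a20] aE]] := Bezoutp f1 f2.
have [[x y] /= /eqpP[[b1 b2] /= /andP[b10 b20] bE]] := Bezoutp f0 (gcdp f1 f2).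
have /eqP := sh; rewrite size_poly_eq1 => /eqpP[[c1 c2] /= /andP[c10 c20] cE].
move: aE bE cE; rewrite -!mul_polyC mulr1; set G := gcdp f1 f2; set h := gcdp f0 G.
move=> aE bE cE.
exists ((a2 * c1 * b1)%:P * x), ((c1 * b1 * a1)%:P * (y * u)), ((c1 * b1 * a1)%:P * (y * v)).
exists (a2 * b2 * c2); split; first by rewrite !mulf_neq0.
rewrite !polyCM -cE.
transitivity (c1%:P * b1%:P * (a2%:P * (x * f0) + y * (a1%:P * (u * f1 + v * f2)))).
  by ring.
rewrite aE; transitivity (a2%:P * c1%:P * (b1%:P * (x * f0 + y * G))); first by ring.
by rewrite bE; ring.
Qed.

Section UnivariateIndependence.
Variables (L : closedFieldType) (n : nat) (g0 g1 g2 : {poly L}).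
Hypotheses (s0 : (size g0 <= n.+1)%N) (s1 : (size g1 <= n.+1)%N).
Hypothesis s2 : (size g2 <= n.+1)%N.
Hypothesis no_root : forall x, [|| g0.[x] != 0, g1.[x] != 0 | g2.[x] != 0].
Hypothesis top : [|| g0`_n != 0, g1`_n != 0 | g2`_n != 0].
Variable q : nat -> L.
Hypothesis q01 : dropsum n q g0 * g1 = dropsum n q g1 * g0.
Hypothesis q02 : dropsum n q g0 * g2 = dropsum n q g2 * g0.
Hypothesis q12 : dropsum n q g1 * g2 = dropsum n q g2 * g1.

(** The vanishing minors make the vector of [dropsum q g_i] proportional to that of the [g_i], with
    polynomial factor [h / c] by Bezout. Some [g_i] has full degree [n], which [dropsum] lowers, so
    [h = 0]; then [dropsum q g_i = 0] is a triangular system in [q]. *)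
Lemma dropsum_independent a : (a < n)%N -> q a = 0.
Proof.
have sh : size (gcdp g0 (gcdp g1 g2)) = 1%N.
  apply/eqP/negPn/negP => /closed_rootP[x xr].
  have h0 : gcdp g0 (gcdp g1 g2) %| g0 by apply: dvdp_gcdl.
  have h1 : gcdp g0 (gcdp g1 g2) %| g1 by apply: dvdp_trans (dvdp_gcdr _ _) (dvdp_gcdl _ _).
  have h2 : gcdp g0 (gcdp g1 g2) %| g2 by apply: dvdp_trans (dvdp_gcdr _ _) (dvdp_gcdr _ _).
  have := no_root x; rewrite -!rootE.
  by rewrite (root_dvdp h0) ?(root_dvdp h1) ?(root_dvdp h2).
have [e0 [e1 [e2 [c [c0 eE]]]]] := bezout3 sh.
pose h := e0 * dropsum n q g0 + e1 * dropsum n q g1 + e2 * dropsum n q g2.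
have main (g : {poly L}) : (size g <= n.+1)%N -> g`_n != 0 -> c%:P * dropsum n q g = h * g ->
    (a < n)%N -> q a = 0.
  move=> sg gn hE; have sz : size g = n.+1.
    apply/eqP; rewrite eqn_leq sg ltnNge; apply: contra gn => le.
    by rewrite nth_default.
  have h0 : h = 0.
    apply/eqP/negPn/negP => h0; have g0' : g != 0 by rewrite -size_poly_gt0 sz.
    have := size_dropsum q sg; rewrite -(size_scale _ c0) -mul_polyC hE size_mul // sz.
    by rewrite addnS /=; move: h0; rewrite -size_poly_gt0; move: (size h); lia.
  have Dg0 : dropsum n q g = 0.
    by apply: (mulfI (x := c%:P)); rewrite ?polyC_eq0 // hE h0 mul0r mulr0.
  have [k] := ubnP a; elim: k a => // k IHk b bk bn.
  (* In degree [n - b - 1] the term [a] contributes [q a] times coefficient [n + a - b] of [g]: zero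
     by size for [a > b], by induction for [a < b]. *)
  have := congr1 (fun p : {poly L} => p`_(n - b.+1)) Dg0.
  rewrite coef0 coef_sum (bigD1 (Ordinal bn)) //= coefZ coef_drop_poly subnK //.
  rewrite big1 ?addr0 => [/eqP|i ib]; first by rewrite mulf_eq0 (negPf gn) orbF => /eqP.
  rewrite coefZ coef_drop_poly.
  have [ltib|ltbi|eib] := ltngtP i b.
  - by rewrite IHk ?mul0r //; lia.
  - by rewrite nth_default ?mulr0 // (leq_trans sg) //; lia.
  - by case/eqP: ib; apply: val_inj.
case/or3P: top => t.
- apply: main t _ => //; rewrite -eE /h.
  transitivity (e0 * (dropsum n q g0 * g0) + e1 * (dropsum n q g0 * g1) + e2 * (dropsum n q g0 * g2)).
    by ring.
  by rewrite q01 q02; ring.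
- apply: main t _ => //; rewrite -eE /h.
  transitivity (e0 * (dropsum n q g1 * g0) + e1 * (dropsum n q g1 * g1) + e2 * (dropsum n q g1 * g2)).
    by ring.
  by rewrite -q01 q12; ring.
apply: main t _ => //; rewrite -eE /h.
transitivity (e0 * (dropsum n q g2 * g0) + e1 * (dropsum n q g2 * g1) + e2 * (dropsum n q g2 * g2)).
  by ring.
by rewrite -q02 -q12; ring.
Qed.

End UnivariateIndependence.

Section Bivariate.
Variable R : comNzRingType.
Implicit Types P Q : {poly {poly R}}.

(* Forms of bidegree (k - 1, l - 1) in (s, u; t, v), dehomogenized at
   u = v = 1; the outer variable of {poly {poly R}} is t, the inner one s. *)
Definition bisize (k l : nat) P : Prop :=
  (size P <= l)%N /\ forall i, (size (P`_i)%R <= k)%N.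

Definition eval_s (x : R) P : {poly R} := map_poly (horner_eval x) P.

(** The restriction to [s] = infinity of a form of degree [k] in [s], the counterpart of [eval_s] at
    finite points. *)
Definition lead_s (k : nat) P : {poly R} := \poly_(i < size P) P`_i`_k.

Lemma coef_eval_s x P i : (eval_s x P)`_i = (P`_i).[x].
Proof. by rewrite /eval_s coef_map /= /horner_eval. Qed.

Lemma coef_lead_s k P i : (lead_s k P)`_i = P`_i`_k.
Proof. by rewrite coef_poly; case: ltnP => // le; rewrite [P`_i]nth_default ?coef0. Qed.

Lemma bisizeD k l P Q : bisize k l P -> bisize k l Q -> bisize k l (P + Q).
Proof.
move=> [p1 p2] [q1 q2]; split.
  by rewrite (leq_trans (size_polyD _ _)) // geq_max p1.
by move=> i; rewrite coefD (leq_trans (size_polyD _ _)) // geq_max p2 q2.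
Qed.

Lemma bisize0 k l : bisize k l 0.
Proof. by split=> [|i]; rewrite ?coef0 size_poly0. Qed.

Lemma bisize_sum k l (I : Type) (r : seq I) (T : pred I) (F : I -> {poly {poly R}}) :
  (forall i, T i -> bisize k l (F i)) -> bisize k l (\sum_(i <- r | T i) F i).
Proof. by move=> h; elim/big_ind: _ => //; [exact: bisize0 | exact: bisizeD]. Qed.

Lemma bisizeM k l k' l' P Q :
  bisize k.+1 l.+1 P -> bisize k' l' Q -> bisize (k + k') (l + l') (P * Q).
Proof.
move=> [p1 p2] [q1 q2]; split.
  by rewrite (leq_trans (size_polyMleq _ _)) //; move: p1 q1; lia.
move=> i; rewrite coefM (leq_trans (size_sum _ _ _)) //; apply/bigmax_leqP => j _.
by rewrite (leq_trans (size_polyMleq _ _)) //; move: (p2 j) (q2 (i - j)%N); lia.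
Qed.

Lemma bisizeZ k l c P : bisize k l P -> bisize k l (c%:P *: P).
Proof.
move=> [p1 p2]; split; first by rewrite (leq_trans (size_scale_leq _ _)).
by move=> i; rewrite coefZ mul_polyC (leq_trans (size_scale_leq _ _)).
Qed.

Lemma bisize_widen k l k' l' P : (k <= k')%N -> (l <= l')%N ->
  bisize k l P -> bisize k' l' P.
Proof.
by move=> kk ll [p1 p2]; split=> [|i]; [apply: leq_trans ll | apply: leq_trans kk].
Qed.

Lemma lead_sM j k l l' P Q : bisize j.+1 l P -> bisize k.+1 l' Q ->
  lead_s (j + k) (P * Q) = lead_s j P * lead_s k Q.
Proof.
move=> [p1 p2] [q1 q2]; apply/polyP => i.
rewrite coef_lead_s !coefM coef_sum; apply: eq_bigr => a _.
by rewrite !coef_lead_s coefM_top.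
Qed.

Lemma eval_s_dropsum n x (q : nat -> {poly R}) P :
  eval_s x (dropsum n q P) = dropsum n (fun a => (q a).[x]) (eval_s x P).
Proof.
apply/polyP => i; rewrite coef_eval_s !coef_sum horner_sum; apply: eq_bigr => a _.
by rewrite !coefZ !coef_drop_poly coef_eval_s hornerM.
Qed.

Lemma lead_s_dropsum n j k l (q : nat -> {poly R}) P :
  (forall a, (a < n)%N -> (size (q a) <= j.+1)%N) -> bisize k.+1 l P ->
  lead_s (j + k) (dropsum n q P) = dropsum n (fun a => (q a)`_j) (lead_s k P).
Proof.
move=> sq [_ sP]; apply/polyP => i; rewrite coef_lead_s !coef_sum; apply: eq_bigr => a _.
by rewrite !coefZ !coef_drop_poly coef_lead_s coefM_top ?sq.
Qed.

Lemma bisize_dropsum n j k (q : nat -> {poly R}) P :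
  (forall a, (a < n)%N -> (size (q a) <= j.+1)%N) -> bisize k.+1 n.+1 P ->
  bisize (j + k).+1 n (dropsum n q P).
Proof.
move=> sq [sP sP2]; split; first exact: size_dropsum.
move=> i; rewrite coef_sum (leq_trans (size_sum _ _ _)) //; apply/bigmax_leqP => a _.
rewrite coefZ coef_drop_poly (leq_trans (size_polyMleq _ _)) //.
by move: (sq a (ltn_ord a)) (sP2 (i + a.+1)%N); lia.
Qed.

End Bivariate.

Section Syzygies.
Variables (L : closedFieldType) (m n : nat) (f0 f1 f2 : {poly {poly L}}).
Hypotheses (m_gt0 : (0 < m)%N) (n_gt0 : (0 < n)%N).
Hypotheses (sz0 : bisize m.+1 n.+1 f0) (sz1 : bisize m.+1 n.+1 f1).
Hypothesis sz2 : bisize m.+1 n.+1 f2.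
(** The four hypotheses exclude common zeros on [P^1 x P^1], cut into the affine part, the line [s]
    = infinity, the line [t] = infinity and their corner. *)
Hypothesis nz_aff : forall x y,
  [|| (eval_s x f0).[y] != 0, (eval_s x f1).[y] != 0 | (eval_s x f2).[y] != 0].
Hypothesis nz_s : forall y,
  [|| (lead_s m f0).[y] != 0, (lead_s m f1).[y] != 0 | (lead_s m f2).[y] != 0].
Hypothesis nz_t : forall x, [|| (f0`_n).[x] != 0, (f1`_n).[x] != 0 | (f2`_n).[x] != 0].
Hypothesis nz_st : [|| f0`_n`_m != 0, f1`_n`_m != 0 | f2`_n`_m != 0].

Let size_eval x (f : {poly {poly L}}) : (size f <= n.+1)%N -> (size (eval_s x f) <= n.+1)%N.
Proof. by apply: leq_trans; apply: size_poly. Qed.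

Let size_lead (f : {poly {poly L}}) : (size f <= n.+1)%N -> (size (lead_s m f) <= n.+1)%N.
Proof. by apply: leq_trans; apply: size_poly. Qed.

(** The forms are coprime in [t] over [L(s)]. A common factor of positive degree in [t] would, at an
    [x] where neither its leading coefficient nor the pseudo-division constants vanish, have a root
    in [t], hence give a common zero. *)
Lemma bezout_generic : exists e0 e1 e2 c, c != 0 /\
  e0 * f0 + e1 * f1 + e2 * f2 = c%:P.
Proof.
apply: bezout3; apply/eqP/negPn/negP => sh.
set h := gcdp f0 (gcdp f1 f2) in sh.
have h0 : h %| f0 by apply: dvdp_gcdl.
have h1 : h %| f1 by apply: dvdp_trans (dvdp_gcdr _ _) (dvdp_gcdl _ _).
have h2 : h %| f2 by apply: dvdp_trans (dvdp_gcdr _ _) (dvdp_gcdr _ _).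
have hn0 : h != 0.
  rewrite !gcdp_eq0; apply/negP => /and3P[/eqP e0 /eqP e1 /eqP e2].
  by have := nz_st; rewrite e0 e1 e2 !coef0 eqxx.
case/Pdiv.WeakIdomain.dvdpP: h0 => -[c0 r0] /= nc0 E0.
case/Pdiv.WeakIdomain.dvdpP: h1 => -[c1 r1] /= nc1 E1.
case/Pdiv.WeakIdomain.dvdpP: h2 => -[c2 r2] /= nc2 E2.
have /closed_nonrootP[x] : c0 * c1 * c2 * lead_coef h != 0.
  by rewrite !mulf_neq0 ?lead_coef_eq0.
rewrite /root !hornerM !mulf_eq0 !negb_or => /andP[/andP[/andP[x0 x1] x2] xl].
have /closed_rootP[y yr] : size (eval_s x h) != 1%N.
  rewrite size_map_poly_id0 //.
have no (c : {poly L}) (r f : {poly {poly L}}) : c *: f = r * h -> c.[x] != 0 -> (eval_s x f).[y] = 0.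
  move=> E nc; have := congr1 (fun p => (eval_s x p).[y]) E.
  rewrite /eval_s /= map_polyZ /= rmorphM hornerZ hornerM (rootP yr) mulr0 => /eqP.
  by rewrite mulf_eq0 /horner_eval (negPf nc) => /eqP.
have := nz_aff x y.
by rewrite (no _ _ _ E0) // (no _ _ _ E1) // (no _ _ _ E2) // eqxx.
Qed.

(* The size conditions on the minors make the vector of top coefficients of the
   [p_i] proportional to that of the [f_i]; subtracting a multiple of the [f_i],
   shifted by a power of [t] or truncated, lowers [N]. *)
Lemma reduce_mod_shifts N (p0 p1 p2 : {poly {poly L}}) :
  (size p0 <= N)%N -> (size p1 <= N)%N -> (size p2 <= N)%N ->
  (size (p0 * f1 - p1 * f0)%R <= n)%N -> (size (p0 * f2 - p2 * f0)%R <= n)%N ->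
  (size (p1 * f2 - p2 * f1)%R <= n)%N ->
  exists d q h, [/\ d != 0, d *: p0 = h * f0 + dropsum n q f0,
    d *: p1 = h * f1 + dropsum n q f1 & d *: p2 = h * f2 + dropsum n q f2].
Proof.
elim: N p0 p1 p2 => [|N IHN] p0 p1 p2.
  rewrite !leqn0 !size_poly_eq0 => /eqP-> /eqP-> /eqP-> _ _ _.
  exists 1, (fun=> 0), 0; rewrite oner_eq0 !mul0r !scaler0 !add0r /dropsum.
  by split=> //; rewrite big1 // => a _; rewrite scale0r.
move=> s0 s1 s2 c01 c02 c12.
(* The polynomial part of [f * t^(N - n)]: its coefficient of degree [N] is the top coefficient of
   [f]. *)
pose T (f : {poly {poly L}}) :=
  if (n <= N)%N then f * 'X^(N - n) else drop_poly (n - N) f.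
have T_cross (f g : {poly {poly L}}) : (size f <= n.+1)%N -> (size g <= n.+1)%N ->
   (size (T f * g - T g * f)%R <= n)%N.
  move=> sf sg; rewrite /T; case: (leqP n N) => [le|lt]; last by apply: size_cross_drop => //; rewrite subn_gt0.
  by rewrite (_ : _ - _ = 0) ?size_poly0 //; ring.
have T_size (f : {poly {poly L}}) : (size f <= n.+1)%N -> (size (T f) <= N.+1)%N.
  move=> sf; rewrite /T; case: (leqP n N) => [le|lt].
    by rewrite (leq_trans (size_polyMleq _ _)) // size_polyXn; move: sf; lia.
  by rewrite size_drop_poly; move: sf; lia.
have T_top (f : {poly {poly L}}) : (T f)`_N = f`_n.
  rewrite /T; case: (leqP n N) => [le|lt]; last by rewrite coef_drop_poly subnKC // ltnW.
  by rewrite coefMXn ltnNge leq_subr /= subKn.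
have top (p p' f f' : {poly {poly L}}) : (size p <= N.+1)%N -> (size p' <= N.+1)%N ->
    (size f <= n.+1)%N -> (size f' <= n.+1)%N -> (size (p * f' - p' * f)%R <= n)%N ->
    p`_N * f'`_n = p'`_N * f`_n.
  move=> sp sp' sf sf' sc; apply/eqP; rewrite -subr_eq0 -!coefM_top // -coefB.
  by rewrite nth_default // (leq_trans sc) // leq_addl.
have [[sf0 _] [sf1 _] [sf2 _]] := And3 sz0 sz1 sz2.
have t01 := top _ _ _ _ s0 s1 sf0 sf1 c01.
have t02 := top _ _ _ _ s0 s2 sf0 sf2 c02.
have t12 := top _ _ _ _ s1 s2 sf1 sf2 c12.
(* [y] is a nonzero top coefficient of one of the [f_i], present since they have no common zero at
   [t] = infinity; scaling by it replaces a division in [{poly L}]. *)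
have [x [y [y0 E0 E1 E2]]] : exists x y, [/\ y != 0, y * p0`_N = x * f0`_n,
     y * p1`_N = x * f1`_n & y * p2`_N = x * f2`_n].
  have : [|| f0`_n != 0, f1`_n != 0 | f2`_n != 0].
    apply: contraTT (nz_t 0); rewrite !negb_or !negbK => /and3P[/eqP-> /eqP-> /eqP->].
    by rewrite !horner0 eqxx.
  case/or3P => nz; [exists p0`_N, f0`_n | exists p1`_N, f1`_n | exists p2`_N, f2`_n];
    by split=> //; rewrite mulrC ?t01 ?t02 ?t12 -?t01 -?t02 -?t12.
pose r (f p : {poly {poly L}}) : {poly {poly L}} := y *: p - x *: T f.
have r_size (f p : {poly {poly L}}) : (size f <= n.+1)%N -> (size p <= N.+1)%N -> y * p`_N = x * f`_n ->
    (size (r f p) <= N)%N.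
  move=> sf sp E; apply/leq_sizeP => j; rewrite leq_eqVlt => /predU1P[<-|lt].
    by rewrite coefB !coefZ T_top E subrr.
  rewrite coefB !coefZ nth_default ?(leq_trans sp) // nth_default ?mulr0 ?subrr //.
  exact: leq_trans (T_size _ sf) lt.
have r_cross (f g p p' : {poly {poly L}}) : (size f <= n.+1)%N -> (size g <= n.+1)%N ->
    (size (p * g - p' * f)%R <= n)%N -> (size (r f p * g - r g p' * f)%R <= n)%N.
  move=> sf sg sc.
  have -> : r f p * g - r g p' * f = y *: (p * g - p' * f) - x *: (T f * g - T g * f).
    by rewrite /r -!mul_polyC; ring.
  rewrite (leq_trans (size_polyD _ _)) // size_polyN geq_max.
  by rewrite !(leq_trans (size_scale_leq _ _)) // T_cross.
have [||||||d [q [h [d0 F0 F1 F2]]]] := IHN (r f0 p0) (r f1 p1) (r f2 p2).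
- exact: r_size.
- exact: r_size.
- exact: r_size.
- exact: r_cross.
- exact: r_cross.
- exact: r_cross.
(* Records the truncation just subtracted; the index is [(n - N).-1] because [dropsum] drops [a.+1]
   coefficients at index [a]. *)
pose b (a : nat) : {poly L} := if (n <= N)%N then 0 else if a == (n - N).-1 then d * x else 0.
exists (d * y), (fun a => q a + b a), (h + if (n <= N)%N then (d * x) *: 'X^(N - n) else 0).
have main (f p : {poly {poly L}}) : (size f <= n.+1)%N -> d *: r f p = h * f + dropsum n q f ->
   (d * y) *: p = (h + if (n <= N)%N then (d * x) *: 'X^(N - n) else 0) * f
     + dropsum n (fun a => q a + b a) f.
  move=> sf F; have -> : (d * y) *: p = d *: r f p + (d * x) *: T f.
    by rewrite /r scalerBr !scalerA subrK.
  have -> : dropsum n (fun a => q a + b a) f = dropsum n q f + dropsum n b f.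
    by rewrite -big_split; apply: eq_bigr => a _; rewrite scalerDl.
  rewrite F /T mulrDl /b; case: (leqP n N) => [le|lt].
    rewrite [dropsum n (fun=> 0) f]big1 ?addr0; last by move=> a _; rewrite scale0r.
    by rewrite -!mul_polyC; ring.
  rewrite mul0r addr0 -addrA; congr (_ + (_ + _)).
  have lt' : ((n - N).-1 < n)%N by lia.
  rewrite /dropsum (bigD1 (Ordinal lt')) //= eqxx big1 ?addr0 => [|i ib].
    by rewrite prednK // subn_gt0.
  by rewrite (_ : (_ == _) = false) ?scale0r //; apply: contraNF ib => /eqP e; apply/eqP/val_inj.
by split; [rewrite mulf_neq0 | exact: main | exact: main | exact: main].
Qed.

Variables p0 p1 p2 : {poly {poly L}}.
Hypotheses (szp0 : bisize (2 * m) n p0) (szp1 : bisize (2 * m) n p1).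
Hypothesis szp2 : bisize (2 * m) n p2.
Hypothesis syz : p0 * f0 + p1 * f1 + p2 * f2 = 0.

Definition syzygy_combination (d : {poly L}) (q : nat -> {poly L}) : Prop :=
  [/\ d *: p0 = dropsum n q f1 * f2 - dropsum n q f2 * f1,
      d *: p1 = dropsum n q f2 * f0 - dropsum n q f0 * f2 &
      d *: p2 = dropsum n q f0 * f1 - dropsum n q f1 * f0].

(** [P] is the cross product of the Bezout vector [e] with [p]. Since [e . f = c] and [p . f = 0],
    the triple product formula gives [P x f = c p]; so the minors of [P] and [f] satisfy the size
    bounds of [reduce_mod_shifts], and the multiple [h f] split off there has zero cross product
    with [f]. *)
Lemma syzygy_combination_exists : exists d q, d != 0 /\ syzygy_combination d q.
Proof.
have [e0 [e1 [e2 [c [c0 E]]]]] := bezout_generic.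
pose P0 := e1 * p2 - e2 * p1; pose P1 := e2 * p0 - e0 * p2; pose P2 := e0 * p1 - e1 * p0.
have C0 : P1 * f2 - P2 * f1 = c *: p0.
  rewrite -mul_polyC -E -[RHS]subr0 -(mulr0 e0) -syz /P1 /P2; ring.
have C1 : P2 * f0 - P0 * f2 = c *: p1.
  rewrite -mul_polyC -E -[RHS]subr0 -(mulr0 e1) -syz /P0 /P2; ring.
have C2 : P0 * f1 - P1 * f0 = c *: p2.
  rewrite -mul_polyC -E -[RHS]subr0 -(mulr0 e2) -syz /P0 /P1; ring.
pose N := (size P0 + size P1 + size P2)%N.
have szc x p : bisize (2 * m) n p -> (size (x *: p) <= n)%N.
  by case=> sp _; rewrite (leq_trans (size_scale_leq _ _)).
have [||||||d [q [h [d0 D0 D1 D2]]]] := @reduce_mod_shifts N P0 P1 P2.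
- by rewrite /N -addnA leq_addr.
- by rewrite /N addnAC leq_addl.
- by rewrite /N leq_addl.
- by rewrite C2 szc.
- by rewrite -opprB C1 size_polyN szc.
- by rewrite C0 szc.
exists (d * c), q; split; first exact: mulf_neq0.
split; rewrite -scalerA -?C0 -?C1 -?C2 scalerBr !scalerAl ?D0 ?D1 ?D2; ring.
Qed.

Let indep_eval x (q : nat -> L) :
  dropsum n q (eval_s x f1) * eval_s x f2 - dropsum n q (eval_s x f2) * eval_s x f1 = 0 ->
  dropsum n q (eval_s x f2) * eval_s x f0 - dropsum n q (eval_s x f0) * eval_s x f2 = 0 ->
  dropsum n q (eval_s x f0) * eval_s x f1 - dropsum n q (eval_s x f1) * eval_s x f0 = 0 ->
  forall a, (a < n)%N -> q a = 0.
Proof.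
move=> /subr0_eq c12 /subr0_eq c20 /subr0_eq c01.
apply: (dropsum_independent (g0 := eval_s x f0) (g1 := eval_s x f1) (g2 := eval_s x f2)) => //.
- by apply: size_eval; case: sz0.
- by apply: size_eval; case: sz1.
- by apply: size_eval; case: sz2.
- by rewrite !coef_eval_s.
Qed.

Let indep_lead (q : nat -> L) :
  dropsum n q (lead_s m f1) * lead_s m f2 - dropsum n q (lead_s m f2) * lead_s m f1 = 0 ->
  dropsum n q (lead_s m f2) * lead_s m f0 - dropsum n q (lead_s m f0) * lead_s m f2 = 0 ->
  dropsum n q (lead_s m f0) * lead_s m f1 - dropsum n q (lead_s m f1) * lead_s m f0 = 0 ->
  forall a, (a < n)%N -> q a = 0.
Proof.
move=> /subr0_eq c12 /subr0_eq c20 /subr0_eq c01.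
apply: (dropsum_independent (g0 := lead_s m f0) (g1 := lead_s m f1) (g2 := lead_s m f2)) => //.
- by apply: size_lead; case: sz0.
- by apply: size_lead; case: sz1.
- by apply: size_lead; case: sz2.
- by rewrite !coef_lead_s.
Qed.

Lemma dropsumZ (x : {poly L}) q f : dropsum n (fun a => x * q a) f = x *: dropsum n q f.
Proof. by rewrite scaler_sumr; apply: eq_bigr => a _; rewrite scalerA. Qed.

Lemma eq_dropsum (q q' : nat -> {poly L}) f :
  (forall a, (a < n)%N -> q a = q' a) -> dropsum n q f = dropsum n q' f.
Proof. by move=> E; apply: eq_bigr => a _; rewrite E. Qed.

(* At a root of [d] the forms have no common zero, so all the [q a] vanish
   there too and the factor cancels. *)
Lemma syzygy_combination_monic d q : d != 0 -> syzygy_combination d q ->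
  exists q', syzygy_combination 1 q'.
Proof.
have [k] := ubnP (size d); elim: k d q => // k IHk d q szd d0 [D0 D1 D2].
have [/size_poly1P[c c0 dE]|/closed_rootP[x xr]] := boolP (size d == 1%N).
  exists (fun a => c^-1%:P * q a); rewrite /syzygy_combination !dropsumZ.
  rewrite -!scalerAl -!scalerBr -D0 -D1 -D2 dE !scalerA.
  by rewrite -polyCM mulVf // polyC1.
have dx p : eval_s x (d *: p) = 0.
  by apply/polyP => i; rewrite coef_eval_s coefZ hornerM (rootP xr) mul0r coef0.
have evB (P Q P' Q' : {poly {poly L}}) : eval_s x (P * Q - P' * Q') =
    eval_s x P * eval_s x Q - eval_s x P' * eval_s x Q'.
  by rewrite /eval_s rmorphB !rmorphM.
have qx a : (a < n)%N -> (q a).[x] = 0.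
  apply: (@indep_eval x (fun a => (q a).[x])); rewrite -!eval_s_dropsum -evB.
  - by rewrite -D0 dx.
  - by rewrite -D1 dx.
  - by rewrite -D2 dx.
have /factor_theorem[d' dE] := xr.
pose q' a := q a %/ ('X - x%:P).
have qE a : (a < n)%N -> q a = ('X - x%:P) * q' a.
  by move=> an; rewrite mulrC divpK // dvdp_XsubCl; apply/rootP/qx.
have X0 : 'X - x%:P != 0 by rewrite polyXsubC_eq0.
have d'0 : d' != 0 by apply: contraNneq d0 => e; rewrite dE e mul0r.
have cancel p P Q P' Q' : d *: p = dropsum n q P * Q - dropsum n q P' * Q' ->
    d' *: p = dropsum n q' P * Q - dropsum n q' P' * Q'.
  rewrite !(eq_dropsum _ qE) !dropsumZ -!scalerAl -scalerBr dE mulrC -scalerA.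
  by move=> E; apply: (mulfI (x := (('X - x%:P)%:P : {poly {poly L}}))); rewrite ?polyC_eq0 // !mul_polyC.
apply: (IHk d' q') => //; last by split; apply: cancel.
move: szd; rewrite dE size_Mmonic ?monicXsubC // size_XsubC addnS /= ltnS.
by rewrite addn1.
Qed.

(** With the denominator gone, [p] is the cross product of the [dropsum q f_i] with the [f_i]. If
    the [q a] have degree at most [M] in [s], its coefficient of degree [M + 2m] is the same
    expression at [s] = infinity. It vanishes because the [p_i] have degree below [2m], so
    [indep_lead] kills the top coefficients of [q], and [M] descends. *)
Lemma syzygy_eq0 : [/\ p0 = 0, p1 = 0 & p2 = 0].
Proof.
have [d [q' [d0 Dq]]] := syzygy_combination_exists.
have [q [D0 D1 D2]] := syzygy_combination_monic d0 Dq.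
rewrite !scale1r in D0 D1 D2.
suff q0 a : (a < n)%N -> q a = 0.
  have dq0 f : dropsum n q f = 0.
    by apply: big1 => a _; rewrite q0 // scale0r.
  by rewrite D0 D1 D2 !dq0 !mul0r subrr.
pose M := (\max_(a < n) size (q a))%N.
have szq b : (b < n)%N -> (size (q b) <= M)%N.
  by move=> bn; apply: (leq_bigmax (Ordinal bn)).
move: a M szq; suff H M : (forall b, (b < n)%N -> (size (q b) <= M)%N) ->
   forall a, (a < n)%N -> q a = 0 by move=> a M /H; apply.
elim: M => [|M IHM] szq; first by move=> a /szq; rewrite leqn0 size_poly_eq0 => /eqP.
have bisD f : bisize m.+1 n.+1 f -> bisize (M + m).+1 n (dropsum n q f).
  exact: bisize_dropsum.
have lead_p p : bisize (2 * m) n p -> lead_s (M + m + m) p = 0.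
  case=> _ sp; apply/polyP => i; rewrite coef_lead_s coef0 nth_default //.
  by apply: leq_trans (sp i) _; lia.
have leadE f g : bisize m.+1 n.+1 f -> bisize m.+1 n.+1 g ->
   lead_s (M + m + m) (dropsum n q f * g) =
   dropsum n (fun a => (q a)`_M) (lead_s m f) * lead_s m g.
  by move=> sf sg; rewrite (lead_sM (bisD _ sf) sg) (lead_s_dropsum szq sf).
have lead_sB (P Q : {poly {poly L}}) k : lead_s k (P - Q) = lead_s k P - lead_s k Q.
  by apply/polyP => i; rewrite coefB !coef_lead_s !coefB.
apply: IHM => b bn; apply/leq_sizeP => j; rewrite leq_eqVlt => /predU1P[<-|lt].
  move: b bn; apply: (@indep_lead (fun a => (q a)`_M)); rewrite -!leadE // -lead_sB -?D0 -?D1 -?D2 lead_p //.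
by rewrite nth_default // (leq_trans (szq b bn)).
Qed.

End Syzygies.

(** * Determinants of families of bivariate polynomials *)

Section Monomials.
Variable R : comNzRingType.
Implicit Types P Q : {poly {poly R}}.

Definition bipow (i j : nat) : {poly {poly R}} := 'X^i *: 'X^j.

Lemma coef_bipow i j a b : (bipow i j)`_b`_a = ((a == i) && (b == j))%:R.
Proof.
rewrite coefZ coefXn mulrC; case: (b == j); last by rewrite mul0r coef0 andbF.
by rewrite mul1r coefXn andbT.
Qed.

Lemma bipowM i j i' j' : bipow i j * bipow i' j' = bipow (i + i') (j + j').
Proof. by rewrite /bipow -scalerAl -scalerAr scalerA -!exprD. Qed.

Lemma bisize_bipow i j k l : (i < k)%N -> (j < l)%N -> bisize k l (bipow i j).
Proof.
move=> ik jl; split.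
  by rewrite (leq_trans (size_scale_leq _ _)) // size_polyXn.
move=> b; rewrite coefZ coefXn; case: (b == j); rewrite ?mulr0 ?size_poly0 //.
by rewrite mulr1 size_polyXn.
Qed.

Lemma bisize_ext k l P Q : bisize k l P -> bisize k l Q ->
  (forall i j, (i < k)%N -> (j < l)%N -> P`_j`_i = Q`_j`_i) -> P = Q.
Proof.
move=> [p1 p2] [q1 q2] E; apply/polyP => j; apply/polyP => i.
have [jl|lj] := ltnP j l; last by rewrite [P`_j]nth_default ?[Q`_j]nth_default //; apply: (leq_trans _ lj).
have [ik|ki] := ltnP i k; first exact: E.
by rewrite (nth_default 0 (leq_trans (p2 j) ki)) (nth_default 0 (leq_trans (q2 j) ki)).
Qed.

Lemma bisize_bipow_sum k l P : bisize k l P ->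
  P = \sum_(i < k) \sum_(j < l) (P`_j`_i)%:P *: bipow i j.
Proof.
move=> sP; apply: (bisize_ext sP).
  apply: bisize_sum => i _; apply: bisize_sum => j _.
  by apply/bisizeZ/bisize_bipow.
move=> i j ik jl; rewrite !coef_sum (bigD1 (Ordinal ik)) //= coef_sum [X in _ + X]big1.
  rewrite ?coef_sum (bigD1 (Ordinal jl)) //= coefZ mul_polyC coefZ coef_bipow !eqxx mulr1.
  rewrite ?coef_sum big1 ?addr0 // => b bj.
  rewrite coefZ mul_polyC coefZ coef_bipow (_ : (j == b) = false) ?andbF ?mulr0 //.
  by apply: contraNF bj => /eqP jb; apply/eqP/val_inj.
move=> a ai; rewrite !coef_sum big1 // => b _.
rewrite coefZ mul_polyC coefZ coef_bipow (_ : (i == a) = false) ?mulr0 //.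
by apply: contraNF ai => /eqP jb; apply/eqP/val_inj.
Qed.

End Monomials.
Arguments bipow {R}.

Lemma map_bipow (R S : comNzRingType) (phi : {rmorphism R -> S}) i j :
  map_poly (map_poly phi) (bipow i j) = bipow i j.
Proof. by rewrite /bipow map_polyZ /= !map_polyXn. Qed.

Section Span.
Variables (R : comNzRingType) (J : finType) (g : J -> {poly {poly R}}).

Definition comb (c : J -> R) : {poly {poly R}} := \sum_j (c j)%:P *: g j.

Definition spanned P := exists c, P = comb c.

Lemma coef_comb c i j : (comb c)`_j`_i = \sum_x c x * (g x)`_j`_i.
Proof. by rewrite !coef_sum; apply: eq_bigr => x _; rewrite coefZ mul_polyC coefZ. Qed.

Lemma bisize_comb k l c : (forall j, bisize k l (g j)) -> bisize k l (comb c).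
Proof. by move=> sg; apply: bisize_sum => j _; apply: bisizeZ. Qed.

Lemma spanned0 : spanned 0.
Proof.
by exists (fun=> 0); rewrite /comb big1 // => j _; rewrite polyC0 scale0r.
Qed.

Lemma spannedD P Q : spanned P -> spanned Q -> spanned (P + Q).
Proof.
move=> [c ->] [d ->]; exists (fun j => c j + d j); rewrite /comb -big_split /=.
by apply: eq_bigr => j _; rewrite polyCD scalerDl.
Qed.

Lemma spannedZ a P : spanned P -> spanned (a%:P *: P).
Proof.
move=> [c ->]; exists (fun j => a * c j); rewrite /comb scaler_sumr.
by apply: eq_bigr => j _; rewrite polyCM scalerA.
Qed.

Lemma spanned_sum (I : Type) (r : seq I) (T : pred I) F :
  (forall i, T i -> spanned (F i)) -> spanned (\sum_(i <- r | T i) F i).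
Proof. by move=> h; elim/big_ind: _ => //; [exact: spanned0 | exact: spannedD]. Qed.

Lemma spanned_gen j : spanned (g j).
Proof.
exists (fun x => (x == j)%:R); rewrite /comb (bigD1 j) //= eqxx scale1r big1 ?addr0 //.
by move=> i /negPf->; rewrite polyC0 scale0r.
Qed.

End Span.

Section Volume.
Variables (J : finType) (N k l : nat).
Variables (e : 'I_N -> J) (f : 'I_N -> 'I_k * 'I_l).

Definition bimatrix (R : comNzRingType) (g : J -> {poly {poly R}}) : 'M[R]_N :=
  \matrix_(r, c) (g (e c))`_((f r).2)`_((f r).1).

Definition volume (R : comNzRingType) (g : J -> {poly {poly R}}) : R :=
  \det (bimatrix g).

Lemma eq_volume (R : comNzRingType) (g g' : J -> {poly {poly R}}) :
  g =1 g' -> volume g = volume g'.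
Proof. by move=> E; congr (\det _); apply/matrixP => r c; rewrite !mxE E. Qed.

Lemma volume_map (R S : comNzRingType) (phi : {rmorphism R -> S}) g :
  phi (volume g) = volume (fun j => map_poly (map_poly phi) (g j)).
Proof.
rewrite -det_map_mx; congr (\det _); apply/matrixP => r c.
by rewrite !mxE !coef_map.
Qed.

Lemma volume_scale (R : comNzRingType) (c : J -> R) g : bijective e ->
  volume (fun j => (c j)%:P *: g j) = (\prod_j c j) * volume g.
Proof.
move=> [e' eK e'K]; rewrite /volume.
have -> : bimatrix (fun j => (c j)%:P *: g j) = bimatrix g *m diag_mx (\row_i c (e i)).
  by apply/matrixP => r i; rewrite mul_mx_diag !mxE coefZ mul_polyC coefZ mulrC.
rewrite det_mulmx det_diag mulrC; congr (_ * _).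
by rewrite [RHS](reindex e) /=; [apply: eq_bigr => i _; rewrite mxE | exists e' => ? _].
Qed.

Hypotheses (e_bij : bijective e) (f_bij : bijective f).

Lemma bimatrix_comb (R : comNzRingType) (g : J -> {poly {poly R}}) c :
  bimatrix g *m (\col_i c (e i)) = \col_r (comb g c)`_((f r).2)`_((f r).1).
Proof.
apply/matrixP => r z; rewrite !mxE coef_comb (reindex e) /=; last exact: onW_bij.
by apply: eq_bigr => i _; rewrite !mxE mulrC.
Qed.

Lemma volume_unit_spanned (R : comUnitRingType) (g : J -> {poly {poly R}}) P :
  (forall j, bisize k l (g j)) -> volume g \is a GRing.unit -> bisize k l P ->
  spanned g P.
Proof.
move=> sg Ug sP; have [e' eK e'K] := e_bij; have [f' fK f'K] := f_bij.
pose v : 'cV_N := invmx (bimatrix g) *m \col_r P`_((f r).2)`_((f r).1).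
exists (fun j => v (e' j) 0); apply: (bisize_ext sP); first exact: bisize_comb.
move=> i j ik jl; have := bimatrix_comb g (fun j => v (e' j) 0).
rewrite (_ : \col_i _ = v); last by apply/matrixP => a b; rewrite !mxE eK ord1.
rewrite mulKVmx // => /matrixP/(_ (f' (Ordinal ik, Ordinal jl)) 0).
by rewrite !mxE f'K.
Qed.

Lemma spanned_volume_unit (R : comUnitRingType) (g : J -> {poly {poly R}}) :
  (forall i j, (i < k)%N -> (j < l)%N -> spanned g (bipow i j)) ->
  volume g \is a GRing.unit.
Proof.
move=> sp; have /fin_all_exists[C CE] (r : 'I_N) : exists c, bipow (f r).1 (f r).2 = comb g c.
  exact: sp.
have AC : bimatrix g *m (\matrix_(i, r) C r (e i)) = 1%:M.
  apply/matrixP => r r'; rewrite mxE.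
  have /matrixP/(_ r 0) := bimatrix_comb g (C r').
  rewrite !mxE -CE coef_bipow => E; transitivity (\sum_j bimatrix g r j * (\col_i C r' (e i)) j 0).
    by apply: eq_bigr => i _; rewrite !mxE.
  rewrite E -(bij_eq f_bij); congr (nat_of_bool _)%:R.
by have := unitmx1 R N; rewrite -AC unitmx_mul => /andP[].
Qed.

Lemma volume_neq0_indep (R : idomainType) (g : J -> {poly {poly R}}) c :
  volume g != 0 -> comb g c = 0 -> forall j, c j = 0.
Proof.
move=> nz c0 j; have [e' eK e'K] := e_bij.
have := bimatrix_comb g c; rewrite c0 => E.
have /matrixP/(_ (e' j) 0) : \adj (bimatrix g) *m (bimatrix g *m \col_i c (e i)) = 0.
  by rewrite E; apply/matrixP=> a b; rewrite !mxE big1 // => i _; rewrite !mxE !coef0 mulr0.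
rewrite mulmxA mul_adj_mx mul_scalar_mx !mxE e'K => /eqP.
by rewrite mulf_eq0 (negPf nz) => /eqP.
Qed.

Lemma indep_volume_neq0 (F : fieldType) (g : J -> {poly {poly F}}) :
  (forall j, bisize k l (g j)) ->
  (forall c, comb g c = 0 -> forall j, c j = 0) -> volume g != 0.
Proof.
move=> sg ind; apply/negP; rewrite /volume -det_tr => /det0P[v v0 vE].
have [e' eK e'K] := e_bij; have [f' fK f'K] := f_bij.
case/negP: v0; apply/eqP/rowP => i; rewrite mxE -(eK i).
apply: (ind (fun j => v 0 (e' j))); apply: (@bisize_ext _ k l).
- exact: bisize_comb.
- exact: bisize0.
move=> a b ak bl; rewrite !coef0.
have := bimatrix_comb g (fun j => v 0 (e' j)).
rewrite (_ : \col_i _ = v^T); last by apply/matrixP => x y; rewrite !mxE eK ord1.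
rewrite -[bimatrix g]trmxK -trmx_mul vE => /matrixP/(_ (f' (Ordinal ak, Ordinal bl)) 0).
by rewrite !mxE f'K.
Qed.

Lemma volume_change (R : comNzRingType) (g g' : J -> {poly {poly R}}) (T : J -> J -> R) :
  (forall j, g' j = comb g (T^~ j)) ->
  volume g' = volume g * \det (\matrix_(a, b < N) T (e a) (e b)).
Proof.
move=> E; rewrite -det_mulmx; congr (\det _); apply/matrixP => r c.
have /matrixP/(_ r 0) := bimatrix_comb g (T^~ (e c)).
by rewrite !mxE -E => <-; apply: eq_bigr => i _; rewrite !mxE.
Qed.

End Volume.

Lemma det_reindex (R : comNzRingType) (J : finType) (N N' : nat)
    (e : 'I_N -> J) (e' : 'I_N' -> J) (T : J -> J -> R) :
  bijective e -> bijective e' ->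
  \det (\matrix_(a, b < N) T (e a) (e b)) = \det (\matrix_(a, b < N') T (e' a) (e' b)).
Proof.
move=> be be'; have NN : N = N'.
  by rewrite -[N]card_ord -[N']card_ord (bij_eq_card be) (bij_eq_card be').
subst N'; have [h hK h'K] := be'.
have s_inj : injective (fun a => h (e a)).
  by move=> a b /(can_inj h'K)/(bij_inj be).
pose s := perm s_inj.
have -> : \matrix_(a, b < N) T (e a) (e b) =
    row_perm s (col_perm s (\matrix_(a, b < N) T (e' a) (e' b))).
  by apply/matrixP => a b; rewrite !mxE !permE !h'K.
rewrite row_permE col_permE !det_mulmx !det_perm mulrA mulrAC.
by rewrite -signr_addb odd_permV addbb mul1r.
Qed.

(** * Determinants of square arrays indexed by a finite type *)

Section FinDet.
Variable R : comNzRingType.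

(** The choice of enumeration is immaterial, as rows and columns are permuted alike; index types can
    thus be rearranged without tracking signs. *)
Definition findet (J : finType) (T : J -> J -> R) : R :=
  \det (\matrix_(a, b < #|J|) T (enum_val a) (enum_val b)).

Lemma findetE (J : finType) N (e : 'I_N -> J) T : bijective e ->
  \det (\matrix_(a, b < N) T (e a) (e b)) = findet T.
Proof. by move=> be; apply: det_reindex be (enum_val_bij J). Qed.

Lemma eq_findet (J : finType) (T T' : J -> J -> R) : T =2 T' -> findet T = findet T'.
Proof. by move=> E; congr (\det _); apply/matrixP => a b; rewrite !mxE E. Qed.

Lemma findet_bij (J J' : finType) (h : J -> J') (T : J' -> J' -> R) :
  bijective h -> findet T = findet (fun x y => T (h x) (h y)).
Proof.
move=> bh; rewrite -(@findetE J' #|J| (fun a => h (enum_val a))) //.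
exact: bij_comp bh (enum_val_bij J).
Qed.

Lemma findet_sum (J K : finType) (T : J + K -> J + K -> R) :
  (forall j k, T (inr k) (inl j) = 0) ->
  findet T = findet (fun x y => T (inl x) (inl y)) * findet (fun x y => T (inr x) (inr y)).
Proof.
move=> T0.
pose e (a : 'I_(#|J| + #|K|)) : J + K :=
  match split a with inl i => inl (enum_val i) | inr i => inr (enum_val i) end.
have be : bijective e.
  exists (fun x => unsplit (match x with inl j => inl (enum_rank j) | inr k => inr (enum_rank k) end)).
    by move=> a; rewrite /e; case: (split a) (splitK a) => i; rewrite enum_valK.
  by case=> x; rewrite /e unsplitK enum_rankK.
rewrite -(findetE T be); set M := \matrix_(_, _) _.
have el a : e (lshift _ a) = inl (enum_val a) by rewrite /e (unsplitK (inl a)).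
have er a : e (rshift _ a) = inr (enum_val a) by rewrite /e (unsplitK (inr a)).
have M0 : dlsubmx M = 0 by apply/matrixP => a b; rewrite !mxE el er.
rewrite -[M]submxK M0 det_ublock; congr (_ * _); congr (\det _).
  by apply/matrixP => a b; rewrite !mxE !el.
by apply/matrixP => a b; rewrite !mxE !er.
Qed.

Lemma findet_prod_id (I W : finType) (B : W -> W -> R) :
  findet (fun x y : I * W => (x.1 == y.1)%:R * B x.2 y.2) = findet B ^+ #|I|.
Proof.
rewrite (@findet_bij ('I_#|I| * W)%type _ (fun x => (enum_val x.1, x.2))); last first.
  by exists (fun x => (enum_rank x.1, x.2)) => -[i w] /=; rewrite ?enum_valK ?enum_rankK.
under eq_findet => x y do rewrite /= (inj_eq enum_val_inj).
elim: #|I| => [|a IHa].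
  rewrite expr0 /findet; set M := \matrix_(_, _) _; move: M.
  by rewrite card_prod card_ord mul0n => M; rewrite det_mx00.
pose h (x : W + 'I_a * W) : 'I_a.+1 * W :=
  match x with inl w => (ord0, w) | inr (i, w) => (lift ord0 i, w) end.
have bh : bijective h.
  exists (fun x => match unlift ord0 x.1 with None => inl x.2 | Some i => inr (i, x.2) end).
    by case=> [w|[i w]] /=; rewrite ?unlift_none ?liftK.
  by case=> i w /=; case: unliftP => [j|] ->.
rewrite (findet_bij _ bh) findet_sum /=; last by move=> w [i w'] /=; rewrite mul0r.
rewrite exprS; congr (_ * _).
  by apply: eq_findet => x y; rewrite mul1r.
by rewrite -IHa; apply: eq_findet => -[i w] [i' w'] /=; rewrite (inj_eq lift_inj).
Qed.

(** Sorting indices by [A] makes [T] block triangular: columns outside [A] are unit vectors, and the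
    block on [A] consists of [#|A|] diagonal copies of [B]. Rows outside [A] are free in the columns
    of [A]. *)
Lemma findet_marked (I W : finType) (A : pred I) (B : W -> W -> R) T :
  (forall x y : I * W, ~~ A y.1 -> T x y = (x == y)%:R) ->
  (forall x y : I * W, A x.1 -> A y.1 -> T x y = (x.1 == y.1)%:R * B x.2 y.2) ->
  findet T = findet B ^+ #|A|.
Proof.
move=> TN TA.
pose h (x : {i | ~~ A i} * W + {i | A i} * W) : I * W :=
  match x with inl y => (val y.1, y.2) | inr y => (val y.1, y.2) end.
have bh : bijective h.
  apply: inj_card_bij.
    move=> [[[i iA] w]|[[i iA] w]] [[[j jA] v]|[[j jA] v]] /= [ij wv].
    - by rewrite wv; congr (inl (_, _)); apply: val_inj.
    - by case/negP: (iA); rewrite ij.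
    - by case/negP: (jA); rewrite -ij.
    - by rewrite wv; congr (inr (_, _)); apply: val_inj.
  rewrite card_sum !card_prod !card_sig -mulnDl leq_mul2r.
  by rewrite addnC cardC leqnn orbT.
rewrite (findet_bij _ bh) findet_sum /=; last first.
  move=> [[i iA] w] [[j jA] v] /=; rewrite TN //= xpair_eqE.
  by case: eqP => // ji; rewrite ji (negPf iA) in jA.
rewrite [X in X * _](_ : _ = 1) ?mul1r; last first.
  rewrite -(det1 R #|{: {i | ~~ A i} * W}|); congr (\det _); apply/matrixP => a b.
  rewrite !mxE TN; last exact: (valP (enum_val b).1).
  rewrite xpair_eqE (inj_eq val_inj) -xpair_eqE -!surjective_pairing.
  by rewrite (inj_eq enum_val_inj).
rewrite -card_sig -findet_prod_id; apply: eq_findet => -[[i iA] w] [[j jA] v] /=.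
by rewrite TA.
Qed.

End FinDet.

(** * The three families of forms *)

Lemma Gamma0_of d (mu : 'X_{1..4}) : mdeg mu = d -> (mu ord_max <= 1)%N ->
  exists g : Gamma0 d, bmnm (val g) = mu.
Proof.
move=> dE mu1; have lt : (mdeg mu < d.+1)%N by rewrite dE.
have h : (mdeg (bmnm (BMultinom lt)) == d) && (bmnm (BMultinom lt) ord_max <= 1)%N.
  by rewrite /= dE eqxx.
by exists (exist _ (BMultinom lt) h).
Qed.

Lemma mnm1_widen_last (i : 'I_3) :
  (U_(widen_ord (leqnSn 3) i) : 'X_{1..4})%MM ord_max = 0%N.
Proof. by rewrite mnm1E -val_eqE /= ltn_eqF //; apply: ltn_ord. Qed.

Section Families.
Variables (m n : nat).

Definition biw (R : comNzRingType) (w : 'I_m * 'I_n) : {poly {poly R}} := bipow w.1 w.2.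

Section Definitions.
Variables (R : comNzRingType) (x : nat -> {poly {poly R}}).

Definition famD (j : 'I_3 * ('I_(2 * m) * 'I_n)) := x j.1 * bipow j.2.1 j.2.2.

(* Dehomogenized Koszul-type families in which the last form times S_{m-1,n-1}
   is replaced by an arbitrary family [b] of forms of bidegree (2m-1, 2n-1). *)
Definition famP (b : 'I_m * 'I_n -> {poly {poly R}}) (j : 'I_4 * ('I_m * 'I_n)) :=
  if (j.1 < 3)%N then x j.1 * biw R j.2 else b j.2.

Definition xpow (mu : 'X_{1..4}) := \prod_(i < 3) x i ^+ mu (widen_ord (leqnSn 3) i).

Definition marked d (g : Gamma0 d) := bmnm (val g) ord_max != 0%N.

Definition famS d (b : 'I_m * 'I_n -> {poly {poly R}}) (j : Gamma0 d * ('I_m * 'I_n)) :=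
  xpow (bmnm (val j.1)) * (if marked j.1 then b j.2 else biw R j.2).

End Definitions.

Section Theory.
Variables (R : comNzRingType) (x : nat -> {poly {poly R}}).
Variable (b : 'I_m * 'I_n -> {poly {poly R}}).
Hypothesis x_size : forall i, bisize m.+1 n.+1 (x i).
Hypothesis b_size : forall w, bisize (2 * m) (2 * n) (b w).

Lemma bisize_biw w : bisize m n (biw R w).
Proof. exact: bisize_bipow. Qed.

Lemma famD_size j : bisize (3 * m) (2 * n) (famD x j).
Proof.
have := bisizeM (x_size j.1) (bisize_bipow R (ltn_ord j.2.1) (ltn_ord j.2.2)).
by apply: bisize_widen; rewrite ?mulSn ?mul1n // ?mul0n ?addn0.
Qed.

Lemma famP_size j : bisize (2 * m) (2 * n) (famP x b j).
Proof.
rewrite /famP; case: ifP => _ //.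
have := bisizeM (x_size j.1) (bisize_biw j.2).
by apply: bisize_widen; rewrite ?mulSn ?mul1n // ?mul0n ?addn0.
Qed.

Lemma mdeg_Gamma0 d (g : Gamma0 d) : mdeg (bmnm (val g)) = d.
Proof. by case: g => mu /= /andP[/eqP]. Qed.

Lemma last_Gamma0 d (g : Gamma0 d) : bmnm (val g) ord_max = marked g :> nat.
Proof. by rewrite /marked; case: g => mu /= /andP[_]; case: (bmnm mu ord_max) => [|[]]. Qed.

Lemma xpow_add mu (i : 'I_3) :
  xpow x (mu + U_(widen_ord (leqnSn 3) i)) = x i * xpow x mu.
Proof.
rewrite /xpow (bigD1 i) //= [in RHS](bigD1 i) //= mulrA; congr (_ * _).
  by rewrite mnmDE mnm1E eqxx addn1 exprS.
apply: eq_bigr => j ji; rewrite mnmDE mnm1E -val_eqE /= eq_sym (inj_eq val_inj).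
by rewrite (negPf ji) addn0.
Qed.

(** Multiplying by one of the first three forms leaves the fourth exponent alone, so the constraint
    defining [Gamma0] survives. *)
Lemma spanned_famS_mul d (i : 'I_3) P :
  spanned (famS (d := d) x b) P -> spanned (famS (d := d.+1) x b) (x i * P).
Proof.
move=> [c ->]; rewrite /comb mulr_sumr; apply: spanned_sum => -[g w] _.
rewrite -scalerAr; apply: spannedZ.
have [||h hE] := @Gamma0_of d.+1 (bmnm (val g) + U_(widen_ord (leqnSn 3) i))%MM.
- by rewrite mdegD mdeg1 mdeg_Gamma0 addn1.
- by rewrite mnmDE mnm1_widen_last addn0 last_Gamma0; case: marked.
have -> : x i * famS x b (g, w) = famS x b (h, w).
  have mE : marked h = marked g by rewrite /marked hE mnmDE mnm1_widen_last addn0.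
  by rewrite /famS /= mE hE xpow_add mulrA.
exact: spanned_gen.
Qed.

Lemma spanned_famS_famP j : spanned (famS (d := 1) x b) (famP x b j).
Proof.
case: j => i w; rewrite /famP /=; case: ifP => i3.
  have -> : x i = x (Ordinal i3) by [].
  move: (Ordinal i3) => {i i3} i.
  have [||h hE] := @Gamma0_of 1 U_(widen_ord (leqnSn 3) i)%MM.
  - exact: mdeg1.
  - by rewrite mnm1E; case: eqP.
  have -> : x i * biw R w = famS x b (h, w).
    rewrite /famS /marked /= hE -[U_(_)%MM]add0m xpow_add /xpow big1 ?mulr1.
      by rewrite add0m mnm1_widen_last.
    by move=> j _; rewrite mnm0E expr0.
  exact: spanned_gen.
have [||h hE] := @Gamma0_of 1 U_(ord_max)%MM.
- exact: mdeg1.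
- by rewrite mnm1E eqxx.
have -> : b w = famS x b (h, w).
  rewrite /famS /marked /= hE mnm1E eqxx /= /xpow big1 ?mul1r // => j _.
  by rewrite mnm1E -val_eqE /= gtn_eqF //; apply: ltn_ord.
exact: spanned_gen.
Qed.

End Theory.

Section Generation.
Variables (R : comUnitRingType) (x : nat -> {poly {poly R}}).
Variable (b : 'I_m * 'I_n -> {poly {poly R}}).
Hypothesis x_size : forall i, bisize m.+1 n.+1 (x i).
Hypothesis b_size : forall w, bisize (2 * m) (2 * n) (b w).
Hypotheses (m_gt0 : (0 < m)%N) (n_gt0 : (0 < n)%N).

Variables (ND : nat) (eD : 'I_ND -> 'I_3 * ('I_(2 * m) * 'I_n)).
Variables (fD : 'I_ND -> 'I_(3 * m) * 'I_(2 * n)).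
Hypotheses (eD_bij : bijective eD) (fD_bij : bijective fD).
Hypothesis D_unit : volume eD fD (famD x) \is a GRing.unit.

(** Any monomial of larger bidegree is a multiple of one of bidegree [(3m-1, 2n-1)], where [D] being
    a unit solves the problem. *)
Lemma generated_by_forms a c i j : (3 <= a)%N -> (2 <= c)%N ->
  (i < a * m)%N -> (j < c * n)%N ->
  exists p : 'I_3 -> {poly {poly R}},
    (forall r, bisize (a.-1 * m) (c.-1 * n) (p r)) /\
    bipow i j = \sum_(r < 3) x r * p r.
Proof.
move=> a3 c2 ia jc.
(* A large exponent is split with [i2] as big as allowed, [3m - 1]; the excess then fits into the
   degree left to the cofactor. *)
have [i1 [i2 [iE i1a i2m]]] : exists i1 i2, [/\ i = (i1 + i2)%N, (i1 <= (a - 3) * m)%N & (i2 < 3 * m)%N].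
  have [lt|ge] := ltnP i (3 * m); first by exists 0, i.
  by exists (i - (3 * m).-1)%N, (3 * m).-1; split; nia.
have [j1 [j2 [jE j1c j2n]]] : exists j1 j2, [/\ j = (j1 + j2)%N, (j1 <= (c - 2) * n)%N & (j2 < 2 * n)%N].
  have [lt|ge] := ltnP j (2 * n); first by exists 0, j.
  by exists (j - (2 * n).-1)%N, (2 * n).-1; split; nia.
have [q qE] : spanned (famD x) (bipow i2 j2).
  apply: (volume_unit_spanned eD_bij fD_bij) D_unit _; first exact: famD_size.
  exact: bisize_bipow.
exists (fun r => \sum_w (q (r, w))%:P *: bipow (i1 + w.1) (j1 + w.2)); split.
  move=> r; apply: bisize_sum => -[u v] _; apply/bisizeZ/bisize_bipow => /=.
    by have := ltn_ord u; nia.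
  by have := ltn_ord v; nia.
rewrite iE jE -bipowM qE /comb mulr_sumr.
rewrite (eq_bigr (fun r : 'I_3 => \sum_w (q (r, w))%:P *: (x r * bipow (i1 + w.1) (j1 + w.2)))); last first.
  by move=> r _; rewrite mulr_sumr; apply: eq_bigr => w _; rewrite scalerAr.
rewrite pair_bigA /=; apply: eq_bigr => -[r w] _ /=.
by rewrite -scalerAr /famD /= mulrCA bipowM.
Qed.

Variables (kP lP NP : nat) (eP : 'I_NP -> 'I_4 * ('I_m * 'I_n)).
Variables (fP : 'I_NP -> 'I_kP * 'I_lP).
Hypotheses (eP_bij : bijective eP) (fP_bij : bijective fP).
Hypotheses (kPE : kP = (2 * m)%N) (lPE : lP = (2 * n)%N).
Hypothesis P_unit : volume eP fP (famP x b) \is a GRing.unit.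

(** The complement [b] serves only in bidegree [(2m-1, 2n-1)], the case [d = 1]. From [(3m-1, 3n-1)]
    on, [generated_by_forms] reduces to the preceding [d]. *)
Lemma generated_famS d P : (0 < d)%N -> bisize (d.+1 * m) (d.+1 * n) P ->
  spanned (famS (d := d) x b) P.
Proof.
elim: d P => // -[|d] IHd P _ sP.
  have [c ->] : spanned (famP x b) P.
    apply: (volume_unit_spanned eP_bij fP_bij) P_unit _; rewrite ?kPE ?lPE //.
    by move=> j; apply: famP_size.
  by apply: spanned_sum => j _; apply/spannedZ/spanned_famS_famP.
rewrite (bisize_bipow_sum sP); apply: spanned_sum => i _; apply: spanned_sum => j _.
apply: spannedZ; have [|||| p [sp ->]] := @generated_by_forms d.+3 d.+3 i j => //.
by apply: spanned_sum => r _; apply/spanned_famS_mul/IHd.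
Qed.

Variables (d kS lS NS : nat) (eS : 'I_NS -> Gamma0 d * ('I_m * 'I_n)).
Variables (fS : 'I_NS -> 'I_kS * 'I_lS).
Hypotheses (eS_bij : bijective eS) (fS_bij : bijective fS).
Hypotheses (kSE : kS = (d.+1 * m)%N) (lSE : lS = (d.+1 * n)%N) (d_gt0 : (0 < d)%N).

Lemma famS_unit : volume eS fS (famS x b) \is a GRing.unit.
Proof.
apply: (spanned_volume_unit eS_bij fS_bij) => i j; rewrite kSE lSE => ik jl.
by apply: generated_famS => //; apply: bisize_bipow.
Qed.

End Generation.

(** * Dependence of the determinants on the complement *)

Section ChangeOfComplement.
Variables (F : fieldType) (x : nat -> {poly {poly F}}).
Variables (b b' : 'I_m * 'I_n -> {poly {poly F}}).
Hypothesis x_size : forall i, bisize m.+1 n.+1 (x i).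
Hypothesis b_size : forall w, bisize (2 * m) (2 * n) (b w).
Hypothesis b'_size : forall w, bisize (2 * m) (2 * n) (b' w).
Variables (kP lP NP : nat) (eP : 'I_NP -> 'I_4 * ('I_m * 'I_n)).
Variables (fP : 'I_NP -> 'I_kP * 'I_lP).
Hypotheses (eP_bij : bijective eP) (fP_bij : bijective fP).
Hypotheses (kPE : kP = (2 * m)%N) (lPE : lP = (2 * n)%N).
Hypothesis P_neq0 : volume eP fP (famP x b) != 0.
Variables (d kS lS NS : nat) (eS : 'I_NS -> Gamma0 d * ('I_m * 'I_n)).
Variables (fS : 'I_NS -> 'I_kS * 'I_lS).
Hypothesis eS_bij : bijective eS.

(* Writing [b' = X * (x_i w) + P * b], both families change by block triangular
   matrices whose diagonal blocks are identities and copies of [P]. *)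
Lemma volume_famS_famP :
  volume eS fS (famS x b') * volume eP fP (famP x b) ^+ #|@marked d| =
  volume eS fS (famS x b) * volume eP fP (famP x b') ^+ #|@marked d|.
Proof.
have /fin_all_exists[c cE] w : exists c, b' w = comb (famP x b) c.
  apply: (volume_unit_spanned eP_bij fP_bij); rewrite ?unitfE ?kPE ?lPE //.
  by move=> j; apply: famP_size.
(* The component of [b'] along [b], the only part of the change visible in the determinants. *)
pose B (w' w : 'I_m * 'I_n) : F := c w (ord_max, w').
have EP : volume eP fP (famP x b') = volume eP fP (famP x b) * findet B.
  pose T (j' j : 'I_4 * ('I_m * 'I_n)) : F := if (j.1 < 3)%N then (j' == j)%:R else c j.2 j'.
  rewrite (volume_change fP eP_bij (g := famP x b) (T := T)) => [|[i w]]; last first.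
    rewrite /famP /T /=; case: ifP => i3; last exact: cE.
    rewrite /comb (bigD1 (i, w)) //= eqxx i3 scale1r big1 ?addr0 //.
    by move=> j /negPf ->; rewrite scale0r.
  rewrite (findetE _ eP_bij) (findet_marked (A := pred1 ord_max) (B := B)) ?card1 //.
    move=> [i w] [j v] /=; rewrite /T /= => jm; case: ifP => // j3.
    by case/negP: jm; apply/eqP/val_inj => /=; have := ltn_ord j; lia.
  by move=> [i w] [j v] /= /eqP-> /eqP->; rewrite /T eqxx mul1r.
suff -> : volume eS fS (famS x b') = volume eS fS (famS x b) * findet B ^+ #|@marked d|.
  by rewrite EP exprMn -!mulrA (mulrC (findet B ^+ _)).
(* In a marked column only the marked rows are specified; the other entries lie off the diagonal
   blocks. *)
have /fin_all_exists[T TE] (j : Gamma0 d * ('I_m * 'I_n)) : exists T, [/\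
    famS x b' j = comb (famS x b) T,
    (~~ marked j.1 -> forall j', T j' = (j' == j)%:R) &
    (marked j.1 -> forall j', marked j'.1 -> T j' = (j'.1 == j.1)%:R * B j'.2 j.2)].
  case: j => g w /=; have [gm|gm] := boolP (marked g); last first.
    exists (fun j' => (j' == (g, w))%:R); split=> //.
    rewrite /comb (bigD1 (g, w)) //= eqxx scale1r /famS (negPf gm) big1 ?addr0 // => j /negPf->.
    by rewrite scale0r.
  pose nu := (bmnm (val g) - U_(ord_max))%MM.
  have gE : bmnm (val g) = (nu + U_(ord_max))%MM.
    apply/mnmP => i; rewrite mnmDE mnmBE mnm1E; case: eqP => [<-|_]; last by rewrite subn0 addn0.
    by rewrite last_Gamma0 gm.
  have nu_last : nu ord_max = 0%N by rewrite mnmBE mnm1E eqxx last_Gamma0 gm.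
  have xg : xpow x (bmnm (val g)) = xpow x nu.
    apply: eq_bigr => i _; rewrite gE mnmDE mnm1E -val_eqE /= gtn_eqF ?addn0 //; apply: ltn_ord.
  (* Here [x^nu] times a member of the family P is a member of the family S, at the exponent
     [nu + U_(i)], which is marked only when [i] is the last index. *)
  have /fin_all_exists[h hE] (i : 'I_4) : exists g' : Gamma0 d, [/\ marked g' = (i == ord_max),
      i = ord_max -> g' = g & forall w', xpow x (bmnm (val g)) * famP x b (i, w') = famS x b (g', w')].
    have [->|im] := eqVneq i ord_max.
      by exists g; split=> // w'; rewrite /famP /famS /= gm.
    have i3 : (i < 3)%N.
      by rewrite ltn_neqAle -ltnS ltn_ord andbT; apply: contraNneq im => i3; apply/eqP/val_inj.
    pose i' : 'I_3 := Ordinal i3; have xi : x i = x i' by [].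
    have [||g' g'E] := @Gamma0_of d (nu + U_(widen_ord (leqnSn 3) i'))%MM.
    - by rewrite mdegD mdeg1 -(mdeg_Gamma0 g) gE mdegD mdeg1.
    - by rewrite mnmDE nu_last mnm1_widen_last.
    have g'm : marked g' = false by rewrite /marked g'E mnmDE nu_last mnm1_widen_last.
    exists g'; split=> // [e|w']; first by rewrite e eqxx in im.
    by rewrite /famP /famS /= i3 g'm g'E xpow_add xg xi mulrCA mulrA.
  exists (fun j' => \sum_p c w p * (j' == (h p.1, p.2))%:R); split.
  - rewrite {1}/famS /= gm cE /comb mulr_sumr.
    rewrite (eq_bigr (fun p => (c w p)%:P *: famS x b (h p.1, p.2))); last first.
      by move=> -[i w'] _; rewrite -scalerAr; congr (_ *: _); case: (hE i).
    under [RHS]eq_bigr => j' _ do rewrite rmorph_sum /= scaler_suml.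
    rewrite exchange_big /=; apply: eq_bigr => p _.
    rewrite (bigD1 (h p.1, p.2)) //= eqxx mulr1 big1 ?addr0 // => j' /negPf->.
    by rewrite mulr0 polyC0 scale0r.
  - by [].
  move=> _ [g' w'] /= g'm; have [_ hmax _] := hE ord_max.
  rewrite (bigD1 (ord_max, w')) //=.
  rewrite (hmax (erefl _)).
  rewrite xpair_eqE eqxx andbT mulrC -[RHS]addr0; congr (_ + _).
  apply: big1 => -[i v] /= iv; rewrite xpair_eqE.
  have [gh|_] := eqVneq g' (h i); last by rewrite mulr0.
  have [wv|_] := eqVneq w' v; last by rewrite andbF mulr0.
  have [mh _ _] := hE i; move: g'm; rewrite gh mh => /eqP im.
  by rewrite im -wv eqxx in iv.
rewrite (volume_change fS eS_bij (g := famS x b) (T := fun j' j => T j j')) => [|j]; last by case: (TE j).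
congr (_ * _); apply: etrans (findetE (fun j' j => T j j') eS_bij) _.
apply: findet_marked => [j' j|j' j j'm]; have [_ t1 t2] := TE j; first by move/t1.
by move=> jm; rewrite t2.
Qed.

End ChangeOfComplement.

End Families.

(** Marked exponents are the exponents of degree [d - 1] in three variables; two of them determine
    the third, so pairs of bounded sum are counted. *)
Lemma card_marked d : #|@marked d| = (d.+1 * d %/ 2)%N.
Proof.
case: d => [|d].
  apply: eq_card0 => g; rewrite unfold_in; apply/negbTE/negP => mg'; have mg : marked g := mg'.
  by have := mdeg_Gamma0 g; rewrite mdegE (bigD1 ord_max) //= last_Gamma0 mg.
pose o1 : 'I_4 := inord 1; pose o2 : 'I_4 := inord 2.
pose pr (g : Gamma0 d.+1) : 'I_d.+1 * 'I_d.+1 :=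
  (inord (bmnm (val g) ord0), inord (bmnm (val g) o1)).
pose S := [set p : 'I_d.+1 * 'I_d.+1 | (p.1 + p.2 <= d)%N].
have sum4 (mu : 'X_{1..4}) : mdeg mu = (mu ord0 + mu o1 + mu o2 + mu ord_max)%N.
  rewrite mdegE !big_ord_recl big_ord0 addn0 !addnA.
  by congr (_ + mu _ + mu _ + mu _)%N; apply: val_inj; rewrite /= ?inordK.
have sum_g (g : Gamma0 d.+1) : marked g ->
    (bmnm (val g) ord0 + bmnm (val g) o1 + bmnm (val g) o2 = d)%N.
  by move=> mg; have := mdeg_Gamma0 g; rewrite sum4 last_Gamma0 mg; lia.
have -> : #|@marked d.+1| = #|S|.
  rewrite -(card_in_imset (f := pr)).
    apply: eq_card => p; rewrite inE; apply/imsetP/idP.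
      move=> [g mg' ->]; have mg : marked g := mg'; have sg := sum_g g mg.
      rewrite /pr /=; move: sg; move: (bmnm (val g) ord0) (bmnm (val g) o1) (bmnm (val g) o2).
      by move=> a b c sg; rewrite !inordK; lia.
    case: p => i j /= ij.
    pose mu := [multinom [tuple (i : nat); (j : nat); (d - i - j)%N; 1%N]] : 'X_{1..4}.
    have mu0 : mu ord0 = i by [].
    have mu1 : mu o1 = j by rewrite multinomE (tnth_nth 0%N) /= inordK.
    have mu2 : mu o2 = (d - i - j)%N by rewrite multinomE (tnth_nth 0%N) /= inordK.
    have mu3 : mu ord_max = 1%N by [].
    have [||g gE] := @Gamma0_of d.+1 mu.
    - by rewrite sum4 mu0 mu1 mu2 mu3; lia.
    - by rewrite mu3.
    exists g; first by rewrite unfold_in /marked gE mu3.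
    by rewrite /pr gE mu0 mu1 !inord_val.
  move=> g g' h h'; have mg : marked g := h; have mg' : marked g' := h'.
  rewrite /pr => -[/(congr1 val) e0 /(congr1 val) e1].
  have bnd a b c : (a + b + c = d -> a < d.+1 /\ b < d.+1)%N by lia.
  have s := sum_g g mg; have s' := sum_g g' mg'.
  have [l0 l1] := bnd _ _ _ s; have [l0' l1'] := bnd _ _ _ s'.
  rewrite /= !inordK // in e0; rewrite /= !inordK // in e1.
  apply/val_inj/val_inj/mnmP => i.
  have : i \in [:: ord0; o1; o2; ord_max].
    by rewrite !inE -!val_eqE /= !inordK //; case: i => -[|[|[|[|//]]]].
  rewrite !inE => /or4P[] /eqP->; [by []|by []| |]; last by rewrite !last_Gamma0 mg mg'.
  by have := etrans s (esym s'); rewrite e0 e1 => /addnI.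
have cardS : #|S| = (\sum_(i < d.+1) (d.+1 - i))%N.
  rewrite -sum1_card.
  rewrite (eq_bigl (fun p : 'I_d.+1 * 'I_d.+1 => true && (p.1 + p.2 <= d)%N)); last first.
    by move=> p; rewrite inE.
  rewrite -(pair_big_dep xpredT (fun i j : 'I_d.+1 => (i + j <= d)%N) (fun _ _ => 1%N)) /=.
  apply: eq_bigr => i _; transitivity (\sum_(j < d.+1 - i) 1)%N.
    rewrite (big_ord_widen d.+1 (fun=> 1%N) (leq_subr i d.+1)).
    by apply: eq_bigl => j; have := ltn_ord i; lia.
  by rewrite sum_nat_const card_ord muln1.
have sumE e : (2 * \sum_(i < e) (e - i) = e.+1 * e)%N.
  elim: e => [|e IHe]; first by rewrite big_ord0.
  by rewrite big_ord_recl mulnDr IHe /=; lia.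
by rewrite cardS -sumE mulKn.
Qed.

(** * The resultant and the determinant of Dixon type *)

Section Forms.
Variables (m n : nat).

Definition biform (R : comNzRingType) (a : 'I_m.+1 -> 'I_n.+1 -> R) : {poly {poly R}} :=
  \sum_(j < m.+1) \sum_(k < n.+1) (a j k)%:P *: bipow j k.

Section Theory.
Variable R : comNzRingType.
Implicit Types a : 'I_m.+1 -> 'I_n.+1 -> R.

Lemma biform_size a : bisize m.+1 n.+1 (biform a).
Proof.
by apply: bisize_sum => j _; apply: bisize_sum => k _; apply/bisizeZ/bisize_bipow.
Qed.

Lemma map_biform (S : comNzRingType) (phi : {rmorphism R -> S}) a :
  map_poly (map_poly phi) (biform a) = biform (fun j k => phi (a j k)).
Proof.
rewrite rmorph_sum; apply: eq_bigr => j _; rewrite rmorph_sum; apply: eq_bigr => k _.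
by rewrite /bipow /= !map_polyZ /= !map_polyXn map_polyC.
Qed.

Lemma eval_biform a x y : (eval_s x (biform a)).[y] =
  \sum_(j < m.+1) \sum_(k < n.+1) a j k * x ^+ j * y ^+ k.
Proof.
rewrite /eval_s /biform rmorph_sum horner_sum; apply: eq_bigr => j _.
rewrite rmorph_sum horner_sum; apply: eq_bigr => k _.
by rewrite /bipow /= !map_polyZ /= map_polyXn !hornerZ hornerXn /horner_eval hornerC hornerXn mulrA.
Qed.

Lemma bipoly_eval a (s u t v : R) : (bipoly a).@[sutv s u t v] =
  \sum_(j < m.+1) \sum_(k < n.+1) a j k * (s ^+ j * u ^+ (m - j) * t ^+ k * v ^+ (n - k)).
Proof.
rewrite /bipoly rmorph_sum; apply: eq_bigr => j _; rewrite rmorph_sum; apply: eq_bigr => k _.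
rewrite /= mevalZ mevalX; congr (_ * _).
by rewrite !big_ord_recl big_ord0 mulr1 !mulrA.
Qed.

Lemma coef_biform a (j : 'I_m.+1) (k : 'I_n.+1) : (biform a)`_k`_j = a j k.
Proof.
have E i l : ((a i l)%:P *: bipow i l)`_k`_j = a i l * ((j == i) && (k == l))%:R.
  by rewrite coefZ mul_polyC coefZ coef_bipow.
rewrite !coef_sum (bigD1 j) //= !coef_sum (bigD1 k) //= E !eqxx mulr1.
rewrite big1 ?addr0 => [|l lk]; last by rewrite E eq_sym (negPf lk) andbF mulr0.
rewrite big1 ?addr0 // => i ij; rewrite !coef_sum big1 // => l _.
by rewrite E eq_sym (negPf ij) mulr0.
Qed.

Lemma bipoly_eval_affine a x y :
  (bipoly a).@[sutv x 1 y 1] = (eval_s x (biform a)).[y].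
Proof.
rewrite bipoly_eval eval_biform; apply: eq_bigr => j _; apply: eq_bigr => k _.
by rewrite !expr1n !mulr1 mulrA.
Qed.

Lemma bipoly_eval_s a y : (bipoly a).@[sutv 1 0 y 1] = (lead_s m (biform a)).[y].
Proof.
rewrite bipoly_eval (bigD1 ord_max) //= [X in _ + X]big1 ?addr0; last first.
  move=> j jm; apply: big1 => k _; rewrite [0 ^+ _]expr0n subn_eq0 leqNgt.
  by rewrite ltn_neqAle -ltnS ltn_ord andbT -val_eqE /= in jm *; rewrite jm mulr0 !mul0r mulr0.
rewrite (@horner_coef_wide _ n.+1); last by apply: leq_trans (size_poly _ _) _; case: (biform_size a).
apply: eq_bigr => k _.
by rewrite coef_lead_s (coef_biform a ord_max) subnn expr0 !expr1n !mulr1 mul1r.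
Qed.

Lemma bipoly_eval_t a x : (bipoly a).@[sutv x 1 1 0] = ((biform a)`_n).[x].
Proof.
rewrite bipoly_eval (@horner_coef_wide _ m.+1); last by case: (biform_size a) => _; apply.
apply: eq_bigr => j _; rewrite (bigD1 ord_max) //= [X in _ + X]big1 ?addr0; last first.
  move=> k jm; rewrite [0 ^+ _]expr0n subn_eq0 leqNgt.
  by rewrite ltn_neqAle -ltnS ltn_ord andbT -val_eqE /= in jm *; rewrite jm !mulr0.
by rewrite (coef_biform a j ord_max) subnn expr0 !expr1n !mulr1.
Qed.

Lemma bipoly_eval_st a : (bipoly a).@[sutv 1 0 1 0] = (biform a)`_n`_m.
Proof.
rewrite bipoly_eval (bigD1 ord_max) //= [X in _ + X]big1 ?addr0; last first.
  move=> j jm; apply: big1 => k _; rewrite [0 ^+ (m - _)]expr0n subn_eq0 leqNgt.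
  by rewrite ltn_neqAle -ltnS ltn_ord andbT -val_eqE /= in jm *; rewrite jm mulr0 !mul0r mulr0.
rewrite (bigD1 ord_max) //= [X in _ + X]big1 ?addr0; last first.
  move=> k jm; rewrite [0 ^+ (n - _)]expr0n subn_eq0 leqNgt.
  by rewrite ltn_neqAle -ltnS ltn_ord andbT -val_eqE /= in jm *; rewrite jm !mulr0.
by rewrite (coef_biform a ord_max ord_max) !subnn !expr0 !expr1n !mulr1.
Qed.

End Theory.

Lemma exists_ord3 (Q : nat -> bool) : (exists i : 'I_3, Q i) -> [|| Q 0, Q 1 | Q 2].
Proof. by case=> -[[|[|[|//]]] i] /= ->; rewrite ?orbT. Qed.

Section Dixon.
Variables (ND : nat) (eD : 'I_ND -> 'I_3 * ('I_(2 * m) * 'I_n)).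
Variables (fD : 'I_ND -> 'I_(3 * m) * 'I_(2 * n)).
Hypotheses (eD_bij : bijective eD) (fD_bij : bijective fD).
Hypotheses (m_gt0 : (0 < m)%N) (n_gt0 : (0 < n)%N).

Definition dixon (R : comNzRingType) (x : nat -> {poly {poly R}}) : R :=
  volume eD fD (famD (m := m) (n := n) x).

(** A linear relation between the columns is a syzygy of the three forms with cofactors in
    [S_{2m-1,n-1}], trivial by [syzygy_eq0]. *)
Lemma dixon_neq0_eval (L : closedFieldType) (x : nat -> {poly {poly L}}) :
  (forall i, bisize m.+1 n.+1 (x i)) ->
  (forall a b, exists i : 'I_3, (eval_s a (x i)).[b] != 0) ->
  (forall b, exists i : 'I_3, (lead_s m (x i)).[b] != 0) ->
  (forall a, exists i : 'I_3, ((x i)`_n).[a] != 0) ->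
  (exists i : 'I_3, (x i)`_n`_m != 0) ->
  dixon x != 0.
Proof.
move=> sx zaf zs zt zst; apply: (indep_volume_neq0 eD_bij fD_bij).
  exact: famD_size.
move=> c c0; pose p r := \sum_w (c (r, w))%:P *: bipow w.1 w.2 : {poly {poly L}}.
have sp r : bisize (2 * m) n (p r).
  by apply: bisize_sum => w _; apply/bisizeZ/bisize_bipow.
have coef_p r (u : 'I_(2 * m)) (v : 'I_n) : (p r)`_v`_u = c (r, (u, v)).
  rewrite !coef_sum (bigD1 (u, v)) //= coefZ mul_polyC coefZ coef_bipow !eqxx mulr1.
  rewrite big1 ?addr0 // => -[u' v'] uv; rewrite coefZ mul_polyC coefZ coef_bipow /=.
  by rewrite -[(_ == _) && _]/((u, v) == (u', v')) eq_sym (negPf uv) mulr0.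
pose r1 : 'I_3 := lift ord0 ord0; pose r2 : 'I_3 := lift ord0 (lift ord0 ord0).
have syz : p ord0 * x 0 + p r1 * x 1 + p r2 * x 2 = 0.
  rewrite -[RHS]c0 /comb.
  rewrite (eq_bigr (fun j => (c (j.1, j.2))%:P *: famD x (j.1, j.2))); last by case.
  rewrite -(pair_bigA _ (fun r w => (c (r, w))%:P *: famD x (r, w))) /=.
  have E r : p r * x r = \sum_w (c (r, w))%:P *: famD x (r, w).
    rewrite mulr_suml; apply: eq_bigr => w _.
    by rewrite -scalerAl /famD /= mulrC.
  by rewrite !big_ord_recl big_ord0 addr0 -!E addrA.
have [||||p0 p1 p2] := syzygy_eq0 m_gt0 n_gt0 (sx 0) (sx 1) (sx 2) _ _ _ _ (sp ord0) (sp r1) (sp r2) syz.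
- by move=> a b; apply: (exists_ord3 (Q := fun i => (eval_s a (x i)).[b] != 0)).
- by move=> b; apply: (exists_ord3 (Q := fun i => (lead_s m (x i)).[b] != 0)).
- by move=> a; apply: (exists_ord3 (Q := fun i => ((x i)`_n).[a] != 0)).
- by apply: (exists_ord3 (Q := fun i => (x i)`_n`_m != 0)).
move=> [r [u v]]; rewrite -coef_p.
suff -> : p r = 0 by rewrite !coef0.
case: r => -[|[|[|//]]] i.
- by rewrite (_ : Ordinal i = ord0) //; apply: val_inj.
- by rewrite (_ : Ordinal i = r1) //; apply: val_inj.
- by rewrite (_ : Ordinal i = r2) //; apply: val_inj.
Qed.

End Dixon.
End Forms.

Section DixonResultant.
Variables (m n : nat).
Hypotheses (m_gt0 : (0 < m)%N) (n_gt0 : (0 < n)%N).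
Variables (ND : nat) (eD : 'I_ND -> 'I_3 * ('I_(2 * m) * 'I_n)).
Variables (fD : 'I_ND -> 'I_(3 * m) * 'I_(2 * n)).
Hypotheses (eD_bij : bijective eD) (fD_bij : bijective fD).

(** Indexing by [nat] serves ['I_3] and ['I_4] alike; [inord] sends indices beyond 2 to 0, so the
    size bounds hold for every [i]. *)
Definition forms3 (R : comNzRingType) (a : 'I_3 -> 'I_m.+1 -> 'I_n.+1 -> R) (i : nat) :=
  biform (a (inord i)).

Lemma forms3_size (R : comNzRingType) (a : 'I_3 -> 'I_m.+1 -> 'I_n.+1 -> R) i :
  bisize m.+1 n.+1 (forms3 a i).
Proof. exact: biform_size. Qed.

Lemma map_forms3 (R S : comNzRingType) (phi : {rmorphism R -> S})
    (a : 'I_3 -> 'I_m.+1 -> 'I_n.+1 -> R) i :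
  map_poly (map_poly phi) (forms3 a i) = forms3 (fun i j k => phi (a i j k)) i.
Proof. exact: map_biform. Qed.

Lemma dixon_map (R S : comNzRingType) (phi : {rmorphism R -> S}) a :
  phi (dixon eD fD (forms3 a)) = dixon eD fD (forms3 (fun i j k => phi (a i j k))).
Proof.
rewrite /dixon volume_map; apply: eq_volume => j; rewrite rmorphM /= map_forms3.
by rewrite /bipow map_polyZ /= !map_polyXn.
Qed.

Lemma dixon_eq0_common_zero (L : closedFieldType) (a : 'I_3 -> 'I_m.+1 -> 'I_n.+1 -> L) :
  dixon eD fD (forms3 a) = 0 -> hasCommonZero a.
Proof.
move=> D0; apply: NNPP => ncz.
have nz (s u t v : L) : (s, u) != (0, 0) -> (t, v) != (0, 0) ->
    exists i : 'I_3, (bipoly (a (inord i))).@[sutv s u t v] != 0.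
  move=> su tv; apply: NNPP => nex; apply: ncz; exists s, u, t, v; split=> // i.
  apply/eqP/negPn/negP => h; apply: nex; exists i.
  by rewrite (_ : inord i = i) //; apply/val_inj/inordK.
have x1 (x : L) : (x, 1 : L) != (0, 0) by rewrite xpair_eqE oner_eq0 andbF.
have x0 : (1 : L, 0 : L) != (0, 0) by rewrite xpair_eqE oner_eq0.
suff /eqP : dixon eD fD (forms3 a) != 0 by rewrite D0.
apply: dixon_neq0_eval => //.
- exact: forms3_size.
- by move=> x y; have [i] := nz x 1 y 1 (x1 _) (x1 _); rewrite bipoly_eval_affine; exists i.
- by move=> y; have [i] := nz 1 0 y 1 x0 (x1 _); rewrite bipoly_eval_s; exists i.
- by move=> x; have [i] := nz x 1 1 0 (x1 _) x0; rewrite bipoly_eval_t; exists i.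
- by have [i] := nz 1 0 1 0 x0 x0; rewrite bipoly_eval_st; exists i.
Qed.

Definition generic_coef (i : 'I_3) (j : 'I_m.+1) (k : 'I_n.+1) :
    {mpoly int[#|coefIdx 3 m n|]} := 'X_(enum_rank ((i, j, k) : coefIdx 3 m n)).

Definition specialize (R : comNzRingType) (a : 'I_3 -> 'I_m.+1 -> 'I_n.+1 -> R) :
    {rmorphism {mpoly int[#|coefIdx 3 m n|]} -> R} :=
  mmap intr (fun x => let: (i, j, k) := enum_val x in a i j k).

Lemma specializeE (R : comNzRingType) a P : @specialize R a P = evalCoef P a.
Proof. by []. Qed.

Lemma specialize_generic (R : comNzRingType) a i j k :
  @specialize R a (generic_coef i j k) = a i j k.
Proof. by rewrite /specialize /= mmapX mmap1U enum_rankK. Qed.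

Lemma eq_rmorph_generic (R : comNzRingType)
    (phi psi : {rmorphism {mpoly int[#|coefIdx 3 m n|]} -> R}) :
  (forall i j k, phi (generic_coef i j k) = psi (generic_coef i j k)) -> phi =1 psi.
Proof.
move=> E P; rewrite [P]mpolyE !rmorph_sum.
apply: eq_bigr => mu _; rewrite -mul_mpolyC !rmorphM; congr (_ * _).
  have -> (c : int) : c%:MP = c%:~R :> {mpoly int[#|coefIdx 3 m n|]}.
    by rewrite -{1}[c]intz; apply: (rmorph_int (@mpolyC #|coefIdx 3 m n| int)).
  by rewrite !rmorph_int.
rewrite mpolyXE_id !rmorph_prod; apply: eq_bigr => i _; rewrite !rmorphXn; congr (_ ^+ _).
by rewrite -[i]enum_valK; case: (enum_val i) => [[i1 j] k]; apply: E.
Qed.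

Lemma rmorph_evalCoef (R : comNzRingType)
    (phi : {rmorphism {mpoly int[#|coefIdx 3 m n|]} -> R}) P a :
  (forall i j k, phi (generic_coef i j k) = a i j k) -> phi P = evalCoef P a.
Proof.
move=> E; rewrite -specializeE; apply: eq_rmorph_generic => i j k.
by rewrite specialize_generic E.
Qed.

Definition generic_dixon := dixon eD fD (forms3 generic_coef).

Lemma specialize_dixon (R : comNzRingType) a :
  @specialize R a generic_dixon = dixon eD fD (forms3 a).
Proof.
rewrite dixon_map /dixon; apply: eq_volume => -[i w]; congr (_ * _).
by apply: eq_bigr => j _; apply: eq_bigr => k _; rewrite specialize_generic.
Qed.

(** * A pencil of forms bounding the multiplicity of the resultant *)

Section SimpleFactor.

Let A1 : {poly algC} := \prod_(i < m) ('X - (i : nat)%:R%:P).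
Let A2 : {poly algC} := \prod_(i < m) ('X - (m + i)%:R%:P).
Let B1 : {poly algC} := \prod_(j < n) ('X - (n + j)%:R%:P).
Let B2 : {poly algC} := \prod_(j < n) ('X - (j : nat)%:R%:P).

(* f1 = A1(s) B1(t), f2 = A2(s) B2(t), f3 = z + s + 2 m t: the first two meet in
   2mn points with integer coordinates, on which f3 vanishes for 2mn distinct z *)
Let base (i : 'I_3) (j : 'I_m.+1) (k : 'I_n.+1) : algC :=
  match nat_of_ord i with
  | 0 => A1`_j * B1`_k
  | 1 => A2`_j * B2`_k
  | _ => ((j == 1%N :> nat) && (k == 0 :> nat))%:R
         + (2 * m)%:R * ((j == 0 :> nat) && (k == 1%N :> nat))%:R
  end.

Let moving (i : 'I_3) (j : 'I_m.+1) (k : 'I_n.+1) : bool :=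
  [&& i == 2%N :> nat, j == 0 :> nat & k == 0 :> nat].

Let pencil (z : algC) i j k := base i j k + z *+ moving i j k.

Let size_prod_lin r (c : 'I_r -> algC) : size (\prod_(i < r) ('X - (c i)%:P)) = r.+1.
Proof. by rewrite size_prod_XsubC /index_enum -enumT size_enum_ord. Qed.

Let monic_prod_lin r (c : 'I_r -> algC) : (\prod_(i < r) ('X - (c i)%:P))`_r = 1.
Proof.
have /monicP := monic_prod_XsubC (index_enum _) predT c.
by rewrite /lead_coef size_prod_lin.
Qed.

Let root_prod_lin r (c : 'I_r -> algC) x :
  (\prod_(i < r) ('X - (c i)%:P)).[x] = 0 -> exists i, x = c i.
Proof.
rewrite horner_prod => /eqP/prodf_eq0[i _]; rewrite hornerXsubC subr_eq0 => /eqP ->.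
by exists i.
Qed.

Let horner_prod_lin r (c : 'I_r -> algC) i : (\prod_(i < r) ('X - (c i)%:P)).[c i] = 0.
Proof. by rewrite (bigD1 i) //= hornerM hornerXsubC subrr mul0r. Qed.

Let sum_single (c x y : algC) a b : (a <= m)%N -> (b <= n)%N ->
  \sum_(j < m.+1) \sum_(k < n.+1)
    (c * ((j == a :> nat) && (k == b :> nat))%:R) * x ^+ j * y ^+ k = c * x ^+ a * y ^+ b.
Proof.
move=> am bn; have am' : (a < m.+1)%N by []; have bn' : (b < n.+1)%N by [].
rewrite (bigD1 (Ordinal am')) //= (bigD1 (Ordinal bn')) //= !eqxx mulr1.
rewrite [X in _ + X + _]big1 ?addr0 => [|k kb]; last first.
  by rewrite (negPf kb : (k == b :> nat) = false) mulr0 !mul0r.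
rewrite big1 ?addr0 // => j ja; apply: big1 => k _.
by rewrite (negPf ja : (j == a :> nat) = false) mulr0 !mul0r.
Qed.

Let eval_product (P Q : {poly algC}) x y : (size P <= m.+1)%N -> (size Q <= n.+1)%N ->
  (\sum_(j < m.+1) \sum_(k < n.+1) P`_j * Q`_k * x ^+ j * y ^+ k) = P.[x] * Q.[y].
Proof.
move=> sP sQ; rewrite (horner_coef_wide _ sP) (horner_coef_wide _ sQ) mulr_suml.
by apply: eq_bigr => j _; rewrite mulr_sumr; apply: eq_bigr => k _; ring.
Qed.

Let eval_pencil z (i : 'I_3) x y : (eval_s x (biform (pencil z i))).[y] =
  match nat_of_ord i with 0 => A1.[x] * B1.[y] | 1 => A2.[x] * B2.[y]
  | _ => x + (2 * m)%:R * y + z end.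
Proof.
rewrite eval_biform /pencil /base /moving; case: i => -[|[|[|//]]] /= _.
- under eq_bigr => j _ do under eq_bigr => k _ do rewrite addr0.
  by rewrite eval_product ?size_prod_lin.
- under eq_bigr => j _ do under eq_bigr => k _ do rewrite addr0.
  by rewrite eval_product ?size_prod_lin.
have := sum_single 1 x y m_gt0 (leq0n n); have := sum_single (2 * m)%:R x y (leq0n m) n_gt0.
have := sum_single z x y (leq0n m) (leq0n n).
rewrite !expr0 !expr1 !mulr1 mul1r => Ez Ey Ex.
rewrite -[in RHS]Ex -[in RHS]Ey -[in RHS]Ez.
rewrite -!big_split /=; apply: eq_bigr => j _; rewrite -!big_split /=; apply: eq_bigr => k _.
by rewrite -mulr_natr; ring.
Qed.

Let A12 x : A1.[x] = 0 -> A2.[x] = 0 -> False.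
Proof.
move=> /root_prod_lin[i ->] /root_prod_lin[j] /eqP; rewrite eqr_nat => /eqP E.
by have := ltn_ord i; lia.
Qed.

Let B12 x : B1.[x] = 0 -> B2.[x] = 0 -> False.
Proof.
move=> /root_prod_lin[i ->] /root_prod_lin[j] /eqP; rewrite eqr_nat => /eqP E.
by have := ltn_ord j; lia.
Qed.

(** The meeting points have natural coordinates, so [s + 2 m t + 1] is nonzero there. At [s] =
    infinity the first two forms become [B1] and [B2], at [t] = infinity [A1] and [A2], without
    common roots; at the corner [f1] is 1. *)
Let dixon_pencil1 : dixon eD fD (forms3 (pencil 1)) != 0.
Proof.
have i0 : (inord 0 : 'I_3) = 0 :> nat by rewrite inordK.
have i1 : (inord 1 : 'I_3) = 1%N :> nat by rewrite inordK.
have or01 (Q : nat -> Prop) : ~ (~ Q 0 /\ ~ Q 1%N) -> exists i : 'I_3, Q i.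
  move=> h; have [q|nq] := classic (Q 0); first by exists ord0.
  have [q|nq1] := classic (Q 1%N); first by exists (inord 1); rewrite i1.
  by case: h.
apply: dixon_neq0_eval => //.
- exact: forms3_size.
- move=> x y; apply: NNPP => nex.
  have E (i : 'I_3) : (eval_s x (forms3 (pencil 1) i)).[y] = 0.
    by apply/eqP/negPn/negP => h; apply: nex; exists i.
  move: (E (inord 0)) (E (inord 1)) (E (inord 2)); rewrite /forms3 !inord_val !eval_pencil.
  rewrite !inordK // => /eqP; rewrite mulf_eq0 => /orP[]/eqP xE /eqP; rewrite mulf_eq0 => /orP[]/eqP yE.
  + by case: (A12 xE yE).
  + case/root_prod_lin: xE => i ->; case/root_prod_lin: yE => j -> /eqP.
    by rewrite -natrM -!natrD natr1 pnatr_eq0.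
  + case/root_prod_lin: xE => i ->; case/root_prod_lin: yE => j -> /eqP.
    by rewrite -natrM -!natrD natr1 pnatr_eq0.
  + by case: (B12 xE yE).
- have lead (a : 'I_m.+1 -> 'I_n.+1 -> algC) y : (lead_s m (biform a)).[y] = \sum_(k < n.+1) a ord_max k * y ^+ k :> algC.
    rewrite (@horner_coef_wide _ n.+1); last first.
      by apply: leq_trans (size_poly _ _) _; case: (biform_size a).
    by apply: eq_bigr => k _; rewrite coef_lead_s -(coef_biform a ord_max k).
  move=> y; apply: (or01 (fun i => is_true ((lead_s m (forms3 (pencil 1) i)).[y] != 0))).
  case=> /negP/negPn/eqP e0 /negP/negPn/eqP e1.
  apply: (@B12 y).
    rewrite -e0 lead (@horner_coef_wide _ n.+1) ?size_prod_lin //; apply: eq_bigr => k _.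
    by rewrite /pencil /base /moving i0 /= monic_prod_lin mul1r addr0.
  rewrite -e1 lead (@horner_coef_wide _ n.+1) ?size_prod_lin //; apply: eq_bigr => k _.
  by rewrite /pencil /base /moving i1 /= monic_prod_lin mul1r addr0.
- have lead (a : 'I_m.+1 -> 'I_n.+1 -> algC) x : ((biform a)`_n).[x] = \sum_(j < m.+1) a j ord_max * x ^+ j :> algC.
    rewrite (@horner_coef_wide _ m.+1); last by case: (biform_size a).
    by apply: eq_bigr => j _; rewrite -(coef_biform a j ord_max).
  move=> x; apply: (or01 (fun i => is_true (((forms3 (pencil 1) i)`_n).[x] != 0))).
  case=> /negP/negPn/eqP e0 /negP/negPn/eqP e1.
  apply: (@A12 x).
    rewrite -e0 lead (@horner_coef_wide _ m.+1) ?size_prod_lin //; apply: eq_bigr => k _.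
    by rewrite /pencil /base /moving i0 /= monic_prod_lin mulr1 addr0.
  rewrite -e1 lead (@horner_coef_wide _ m.+1) ?size_prod_lin //; apply: eq_bigr => k _.
  by rewrite /pencil /base /moving i1 /= monic_prod_lin mulr1 addr0.
exists ord0; rewrite /forms3 (coef_biform _ ord_max ord_max).
by rewrite /pencil /base /moving i0 /= !monic_prod_lin mulr1 addr0 oner_eq0.
Qed.

Let pencilP i j k : {poly algC} := (base i j k)%:P + 'X *+ moving i j k.

Let theta := specialize pencilP.

Let horner_theta P z : (theta P).[z] = evalCoef P (pencil z).
Proof.
have -> : (theta P).[z] = (horner_eval z \o theta) P by [].
apply: rmorph_evalCoef => i j k /=.
by rewrite /theta specialize_generic /horner_eval /pencilP hornerD hornerC hornerMn hornerX.
Qed.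

Let coef_biform_bipow (a : 'I_m.+1 -> 'I_n.+1 -> {poly algC}) d u v p q :
  (forall j k, size (a j k) <= d)%N -> (size ((biform a * bipow u v)`_q`_p)%R <= d)%N.
Proof.
move=> sa; rewrite mulr_suml !coef_sum (leq_trans (size_sum _ _ _)) //; apply/bigmax_leqP => j _.
rewrite mulr_suml !coef_sum (leq_trans (size_sum _ _ _)) //; apply/bigmax_leqP => k _.
rewrite -scalerAl bipowM coefZ mul_polyC coefZ coef_bipow.
by case: (_ && _); rewrite ?mulr1 ?mulr0 ?size_poly0.
Qed.

(** Only the [2mn] columns of the third form involve the parameter, each of them linearly. *)
Let size_theta_dixon : (size (theta generic_dixon) <= (2 * m * n).+1)%N.
Proof.
rewrite /theta specialize_dixon /dixon /volume /determinant.
apply: (leq_trans (size_sum _ _ _)); apply/bigmax_leqP => s _.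
set M := bimatrix _ _ _.
have -> : size ((-1) ^+ s * \prod_i M i (s i)) = size (\prod_i M i (s i)).
  by rewrite mulr_sign; case: (odd_perm s); rewrite ?size_polyN.
apply: (leq_trans (size_poly_prod_leq _ _)); rewrite leq_subLR card_ord addnS ltnS.
pose moved (j : 'I_3 * ('I_(2 * m) * 'I_n)) : nat := (j.1 == 2%N :> nat).
have le1 i : (size (M i (s i)) <= 1 + moved (eD (s i)))%N.
  rewrite mxE; apply: coef_biform_bipow => j k; rewrite /pencilP /moving inordK ?ltn_ord //.
  rewrite (leq_trans (size_polyD _ _)) // geq_max (leq_trans (size_polyC_leq1 _)) //=.
  rewrite /moved; case: (_ == 2%N :> nat) => /=; last by rewrite mulr0n size_poly0.
  by case: (_ && _); rewrite ?mulr0n ?size_poly0 // mulr1n size_polyX.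
apply: (leq_trans (leq_sum _ (fun i _ => le1 i))).
rewrite big_split /= sum1_card card_ord leq_add2l.
have -> : (\sum_i moved (eD (s i)) = \sum_j moved j)%N.
  rewrite [RHS](reindex (fun i => eD (s i))) //=.
  by apply: onW_bij; apply: bij_comp eD_bij (injF_bij (@perm_inj _ s)).
rewrite (eq_bigr (fun j => moved (j.1, j.2))); last by case.
rewrite -(pair_bigA _ (fun r w => moved (r, w))) /= !big_ord_recl big_ord0 /moved /=.
by rewrite !big1_eq !add0n addn0 sum1_card card_prod !card_ord.
Qed.

Let meeting_value (i j : nat) := (i + 2 * m * j)%N.

Let pencil_common_zero x y : A1.[x] * B1.[y] = 0 -> A2.[x] * B2.[y] = 0 ->
  hasCommonZero (pencil (- (x + (2 * m)%:R * y))).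
Proof.
move=> e0 e1; exists x, 1, y, 1; split; rewrite ?xpair_eqE ?oner_eq0 ?andbF // => i.
rewrite bipoly_eval_affine eval_pencil; case: i => -[|[|[|//]]] /= _; rewrite ?e0 ?e1 //.
by rewrite subrr.
Qed.

Let theta_dixon_neq0 : theta generic_dixon != 0.
Proof.
apply: contraNneq dixon_pencil1 => D0.
have := horner_theta generic_dixon 1; rewrite D0 horner0 -specializeE => E.
by rewrite -specialize_dixon -E.
Qed.

Lemma generic_dixon_neq0 : generic_dixon != 0.
Proof. by apply: contraNneq theta_dixon_neq0 => ->; rewrite rmorph0. Qed.

(** Along the pencil [Res] has [2mn] distinct roots, while the determinant has degree at most [2mn]:
    there is room for one factor [Res] only. *)
Lemma dixon_exponent_le1 (Res u : {mpoly int[#|coefIdx 3 m n|]}) e :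
  isBihomResultant Res -> u \is a GRing.unit -> generic_dixon = u * Res ^+ e -> (e <= 1)%N.
Proof.
move=> [_ ResP] Uu DE.
have D0 := theta_dixon_neq0.
have thE : theta generic_dixon = theta u * theta Res ^+ e by rewrite DE rmorphM rmorphXn.
have alg : isAlgClosure (idfun : {rmorphism algC -> algC}).
  move=> z; exists ('X - z%:P); first by rewrite polyXsubC_eq0.
  by rewrite map_poly_id // root_XsubC.
case: e => // e in DE thE *.
have R0 : theta Res != 0.
  by apply: contraNneq D0 => R0; rewrite thE R0 exprS mul0r mulr0.
(* The values of [-z], first at roots of [A1] and [B2], then at roots of [A2] and [B1]. The first
   coordinate being below [2m], each value determines its point. *)
pose vs := [seq meeting_value i j | i <- iota 0 m, j <- iota 0 n] ++
           [seq meeting_value i j | i <- iota m m, j <- iota n n].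
have lt2m i j i' j' : (i < 2 * m)%N -> (i' < 2 * m)%N ->
    meeting_value i j = meeting_value i' j' -> i = i' /\ j = j'.
  rewrite /meeting_value => im im' E.
  have modE a b : (a < 2 * m)%N -> ((a + 2 * m * b) %% (2 * m) = a)%N.
    by move=> lt; rewrite addnC mulnC modnMDl modn_small.
  have ii : i = i' by rewrite -(modE i j im) E modE.
  split=> //.
  by apply/eqP; rewrite -(eqn_pmul2l (m := 2 * m)) ?muln_gt0 //; apply/eqP; lia.
have vs_uniq : uniq vs.
  rewrite cat_uniq; apply/and3P; split.
  - apply: allpairs_uniq; rewrite ?iota_uniq // => -[i j] [i' j'].
    move=> /allpairsP[[a b] /= [ai _ [-> ->]]] /allpairsP[[a' b'] /= [ai' _ [-> ->]]] E.
    rewrite !mem_iota in ai ai'; have [||-> ->] := lt2m _ _ _ _ _ _ E => //; lia.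
  - apply/hasPn => v /allpairsP[[i j] /= [ii jj ->]]; apply/negP => /allpairsP[[i' j'] /= [ii' jj' E]].
    rewrite !mem_iota in ii jj ii' jj'; have [||_ jE] := lt2m _ _ _ _ _ _ E; lia.
  apply: allpairs_uniq; rewrite ?iota_uniq // => -[i j] [i' j'].
  move=> /allpairsP[[a b] /= [ai _ [-> ->]]] /allpairsP[[a' b'] /= [ai' _ [-> ->]]] E.
  rewrite !mem_iota in ai ai'; have [||-> ->] := lt2m _ _ _ _ _ _ E => //; lia.
pose rs := [seq - (v%:R : algC) | v <- vs].
have rs_uniq : uniq rs.
  by rewrite map_inj_uniq // => v v' /oppr_inj/eqP; rewrite eqr_nat => /eqP.
have rs_root : all (root (theta Res)) rs.
  apply/allP => _ /mapP[v vin ->]; rewrite rootE horner_theta; apply/eqP.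
  apply/(ResP _ _ _ alg); move: vin; rewrite mem_cat => /orP[] /allpairsP[[i j] /= [ii jj ->]].
    rewrite !mem_iota in ii jj; rewrite natrD natrM; apply: pencil_common_zero.
      by rewrite (horner_prod_lin (fun i : 'I_m => (i : nat)%:R) (Ordinal ii)) mul0r.
    by rewrite mulrC (horner_prod_lin (fun i : 'I_n => (i : nat)%:R) (Ordinal jj)) mul0r.
  have [i' iE] : exists i' : 'I_m, i = (m + i')%N.
    by rewrite mem_iota in ii; have lt : (i - m < m)%N by [lia]; exists (Ordinal lt) => /=; lia.
  have [j' jE] : exists j' : 'I_n, j = (n + j')%N.
    by rewrite mem_iota in jj; have lt : (j - n < n)%N by [lia]; exists (Ordinal lt) => /=; lia.
  rewrite iE jE natrD natrM; apply: pencil_common_zero.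
    by rewrite mulrC (horner_prod_lin (fun i : 'I_n => (n + i)%:R) j') mul0r.
  by rewrite (horner_prod_lin (fun i : 'I_m => (m + i)%:R) i') mul0r.
have sR := max_poly_roots R0 rs_root rs_uniq.
have /size_poly1P[c c0 uE] : size (theta u) == 1%N.
  by have := rmorph_unit theta Uu; rewrite poly_unitE => /andP[].
have := size_theta_dixon; rewrite thE uE mul_polyC size_scale // => sD.
have := size_exp (theta Res) e.+1; move: sR sD.
rewrite /rs size_map size_cat !size_allpairs !size_iota.
have : (0 < m * n)%N by rewrite muln_gt0 m_gt0.
move: (size (theta Res)) (size (theta Res ^+ e.+1)%R) => x y; nia.
Qed.

End SimpleFactor.

(* Every prime factor of the Dixon determinant vanishes only where the three
   forms meet, hence divides the resultant. *)
Lemma generic_dixon_resultant (Res : {mpoly int[#|coefIdx 3 m n|]}) :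
  isBihomResultant Res -> exists2 u, u \is a GRing.unit & generic_dixon = u * Res.
Proof.
move=> RR; have [Rirr ResP] := RR.
have fac : factorial_ring {mpoly int[#|coefIdx 3 m n|]}.
  exact/factorial_mpoly/factorial_int.
have Rprime := irreducible_prime fac Rirr.
have [u [s [Uu sP DE]]] := fac _ generic_dixon_neq0.
have dvdR p : p \in s -> dvdr p Res.
  move=> ps; have pp := sP _ ps.
  (* [p] may be an integer prime; its residue field is then of positive characteristic, which
     [isBihomResultant] covers. *)
  have [code code_inj] := mpoly_int_code #|coefIdx 3 m n|.
  have [k [phi phiP]] := residue_field code_inj pp.
  have [L [iota int]] := countable_algebraic_closure k.
  apply/phiP; rewrite (rmorph_evalCoef _ (fun i j l => erefl)).
  apply/(ResP k L iota); first by move=> z; apply/integral_algebraic/int.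
  apply: dixon_eq0_common_zero; rewrite -dixon_map.
  rewrite -(specialize_dixon (fun i j l => phi (generic_coef i j l))) specializeE.
  rewrite -(rmorph_evalCoef (phi := phi)) //.
  have -> : phi generic_dixon = 0.
    apply/phiP; rewrite DE (big_rem _ ps) /=.
    by exists (u * \prod_(q <- rem p s) q); rewrite mulrCA mulrC.
  exact: rmorph0.
have [|e [w [Uw wE]]] := @prod_divisors_of_prime _ Res s Rprime.
  by move=> p ps; split; [apply: sP | apply: dvdR].
have vE : generic_dixon = (u * w) * Res ^+ e by rewrite DE wE mulrA.
have Uv : u * w \is a GRing.unit by rewrite unitrM Uu.
have e1 := dixon_exponent_le1 RR Uv vE.
(* Exponent 0 would make the determinant a unit, but it vanishes when all coefficients are set to
   0. *)
case: e e1 vE {wE} => [|[|//]] _ vE; last by exists (u * w); rewrite // vE expr1.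
have := rmorph_unit (specialize (fun _ _ _ => 0 : int)) Uv.
have <- : generic_dixon = u * w by rewrite vE expr0 mulr1.
have ND_gt0 : (0 < ND)%N.
  by rewrite -[ND]card_ord (bij_eq_card eD_bij) !card_prod !card_ord !muln_gt0 m_gt0.
rewrite specialize_dixon /dixon /volume.
rewrite (expand_det_row _ (Ordinal ND_gt0)) big1 ?unitr0 // => c _.
have z i : forms3 (fun _ _ _ => 0 : int) i = 0.
  by apply: big1 => j _; apply: big1 => k _; rewrite scale0r.
by rewrite mxE /famD z mul0r !coef0 mul0r.
Qed.

End DixonResultant.

(** * Monomial complements *)

Section Complement.
Variables (m n : nat) (F : fieldType) (x : nat -> {poly {poly F}}).
Hypothesis x_size : forall i, bisize m.+1 n.+1 (x i).
Variables (ND : nat) (eD : 'I_ND -> 'I_3 * ('I_(2 * m) * 'I_n)).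
Variables (fD : 'I_ND -> 'I_(3 * m) * 'I_(2 * n)).
Hypothesis eD_bij : bijective eD.
Variables (kP lP NP : nat) (eP : 'I_NP -> 'I_4 * ('I_m * 'I_n)).
Variables (fP : 'I_NP -> 'I_kP * 'I_lP).
Hypotheses (eP_bij : bijective eP) (fP_bij : bijective fP).
Hypotheses (kPE : kP = (2 * m)%N) (lPE : lP = (2 * n)%N).
Hypothesis D_neq0 : dixon eD fD x != 0.

Definition monomials (R : comNzRingType) (h : 'I_m * 'I_n -> 'I_(2 * m) * 'I_(2 * n)) w :
  {poly {poly R}} := bipow (h w).1 (h w).2.

Lemma monomials_size (R : comNzRingType) h w :
  bisize (2 * m) (2 * n) (@monomials R h w).
Proof. exact: bisize_bipow. Qed.

(* Exchange argument: if no monomial extended an independent subfamily, that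
   subfamily would span everything. *)
Lemma complement_by_monomials :
  exists h, volume eP fP (famP x (monomials F h)) != 0.
Proof.
(* Induction on the list of indices already filled: only relations with zero coefficient at the
   other [b w] are tested. *)
suff [h hP] : exists h, forall c : 'I_4 * ('I_m * 'I_n) -> F,
    (forall w, w \notin enum {: 'I_m * 'I_n} -> c (ord_max, w) = 0) ->
    comb (famP x (monomials F h)) c = 0 -> forall j, c j = 0.
  exists h; apply: (indep_volume_neq0 eP_bij fP_bij).
    by rewrite kPE lPE; apply: famP_size => // w; apply: monomials_size.
  by move=> c; apply: hP => w; rewrite mem_enum.
elim: (enum _) => [|w0 S [h hP]].
  have lt2 k (i : 'I_k) : (i < 2 * k)%N by have := ltn_ord i; lia.
  pose h0 (w : 'I_m * 'I_n) := (Ordinal (lt2 m w.1), Ordinal (lt2 n w.2)).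
  exists h0 => c c_max; set b := monomials F h0 => c0.
  (* No [b w] occurs yet, and after dehomogenization [S_{m-1,n-1}] lies in [S_{2m-1,n-1}]: the
     relation is one between the columns of [D]. *)
  pose p (r : 'I_3) : {poly {poly F}} := \sum_w (c (widen_ord (leqnSn 3) r, w))%:P *: biw F w.
  have sp r : bisize m n (p r) by apply: bisize_sum => w _; apply/bisizeZ/bisize_biw.
  have sp2 r : bisize (2 * m) n (p r) by apply: bisize_widen (sp r); rewrite // leq_pmull.
  have coef_p r (w : 'I_m * 'I_n) : (p r)`_(w.2)`_(w.1) = c (widen_ord (leqnSn 3) r, w).
    rewrite !coef_sum (bigD1 w) //= coefZ mul_polyC coefZ coef_bipow !eqxx mulr1.
    rewrite big1 ?addr0 // => w' ww'; rewrite coefZ mul_polyC coefZ coef_bipow.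
    rewrite (_ : _ && _ = false) ?mulr0 //; apply: contraNF ww' => /andP[/eqP e1 /eqP e2].
    by apply/eqP; case: w w' e1 e2 => [i j] [i' j'] /= /val_inj-> /val_inj->.
  have xp : \sum_(r < 3) x r * p r = 0.
    rewrite -[RHS]c0 /comb (eq_bigr (fun j => (c (j.1, j.2))%:P *: famP x b (j.1, j.2))); last by case.
    rewrite -(pair_bigA _ (fun r w => (c (r, w))%:P *: famP x b (r, w))) /= [in RHS]big_ord_recr /=.
    rewrite [X in _ = _ + X]big1 ?addr0; last by move=> w _; rewrite c_max // scale0r.
    apply: eq_bigr => r _; rewrite mulr_sumr; apply: eq_bigr => w _.
    by rewrite /famP /= ltn_ord scalerAr.
  pose cD (j : 'I_3 * ('I_(2 * m) * 'I_n)) := (p j.1)`_(j.2.2)`_(j.2.1).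
  have cD0 : comb (famD x) cD = 0.
    rewrite -[RHS]xp /comb (eq_bigr (fun j => (cD (j.1, j.2))%:P *: famD x (j.1, j.2))); last by case.
    rewrite -(pair_bigA _ (fun r w => (cD (r, w))%:P *: famD x (r, w))) /=.
    apply: eq_bigr => r _; rewrite [in RHS](bisize_bipow_sum (sp2 r)) pair_bigA mulr_sumr /=.
    by apply: eq_bigr => -[u v] _; rewrite /famD /cD /= scalerAr.
  have cD_eq0 := volume_neq0_indep eD_bij D_neq0 cD0.
  case=> i w; have [lt|ge] := ltnP i 3; last first.
    by rewrite (_ : i = ord_max) ?c_max //; apply/val_inj/eqP; rewrite eqn_leq ge -ltnS ltn_ord.
  have -> : i = widen_ord (leqnSn 3) (Ordinal lt) by apply: val_inj.
  have lt2w : (w.1 < 2 * m)%N by have := ltn_ord w.1; lia.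
  by rewrite -coef_p; apply: (cD_eq0 (Ordinal lt, (Ordinal lt2w, w.2))).
have [w0S|w0S] := boolP (w0 \in S).
  by exists h => c cS; apply: hP => w wS; apply: cS; rewrite inE negb_or wS andbT; apply: contraNneq wS => ->.
apply: NNPP => nex.
pose b0 w := if w \in S then monomials F h w else 0.
have b0_size w : bisize (2 * m) (2 * n) (b0 w).
  by rewrite /b0; case: ifP => _; [apply: monomials_size | apply: bisize0].
(* Absurd if true, because the column of [b0] at [w0] is zero. *)
suff U : volume eP fP (famP x b0) \is a GRing.unit.
  have D : comb (famP x b0) (fun j => (j == (ord_max, w0))%:R) = 0.
    rewrite /comb big1 // => j _; case: eqP => [->|_]; last by rewrite scale0r.
    by rewrite /famP /= /b0 (negPf w0S) scaler0.
  rewrite unitfE in U; have := volume_neq0_indep eP_bij U D (ord_max, w0).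
  by rewrite eqxx => /eqP; rewrite oner_eq0.
apply: (spanned_volume_unit eP_bij fP_bij) => i j; rewrite kPE lPE => im jn.
(* An arbitrary monomial is tried at [w0]. It must create a relation, which involves it by the
   induction hypothesis, so it is in the span of the others. *)
pose h' w := if w == w0 then (Ordinal im, Ordinal jn) else h w.
have [c [cS [c0 [j0 cj0]]]] : exists c : 'I_4 * ('I_m * 'I_n) -> F,
    (forall w, w \notin w0 :: S -> c (ord_max, w) = 0) /\
    comb (famP x (monomials F h')) c = 0 /\ exists j, c j <> 0.
  apply: NNPP => nc; apply: nex; exists h' => c cS c0 l; apply: NNPP => cl.
  by apply: nc; exists c; split=> //; split=> //; exists l.
have same (c' : 'I_4 * ('I_m * 'I_n) -> F) :
    (forall w, w \notin S -> c' (ord_max, w) = 0) ->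
    comb (famP x (monomials F h')) c' = comb (famP x b0) c' /\
    comb (famP x (monomials F h)) c' = comb (famP x b0) c'.
  move=> c'S; split; apply: eq_bigr => -[l w] _; rewrite /famP /=; case: ifP => // l3;
  (have -> : l = ord_max by apply/val_inj/eqP; rewrite eqn_leq -ltnS ltn_ord leqNgt l3);
  rewrite /b0; case: ifP => [wS|/negbT/c'S->]; rewrite ?scale0r //.
  by rewrite /monomials /h' (negPf (_ : w != w0)) //; apply: contraNneq w0S => <-.
have cw0 : c (ord_max, w0) != 0.
  apply/eqP => cw0; apply: cj0; apply: (hP c).
    by move=> w wS; have [->//|ww0] := eqVneq w w0; apply: cS; rewrite inE negb_or ww0.
  have cS' w : w \notin S -> c (ord_max, w) = 0.
    by move=> wS; have [->//|ww0] := eqVneq w w0; apply: cS; rewrite inE negb_or ww0.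
  by have [e1 e2] := same c cS'; rewrite e2 -e1.
pose c1 l := if l == (ord_max, w0) then 0 else c l.
have c1S w : w \notin S -> c1 (ord_max, w) = 0.
  move=> wS; rewrite /c1 xpair_eqE eqxx /=; case: eqVneq => // ww0.
  by apply: cS; rewrite inE negb_or ww0.
have bE : bipow i j = (- (c (ord_max, w0))^-1)%:P *: comb (famP x b0) c1.
  have [<- _] := same c1 c1S.
  have -> : comb (famP x (monomials F h')) c1 = - ((c (ord_max, w0))%:P *: bipow i j).
    move: c0; rewrite /comb (bigD1 (ord_max, w0)) //= {1}/famP /= /monomials {1 2}/h' eqxx /=.
    move/eqP; rewrite addrC addr_eq0 => /eqP <-.
    rewrite (bigD1 (ord_max, w0)) //= {1}/c1 eqxx scale0r add0r.
    by apply: eq_bigr => l /negPf nl; rewrite /c1 nl.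
  by rewrite scalerN -scaleNr -polyCN opprK scalerA -polyCM mulVf // scale1r.
by rewrite bE; apply/spannedZ; exists c1.
Qed.

End Complement.

(** * The comparison for generic coefficients *)

Section Transport.
Variables (m n d : nat).

Lemma map_xpow (R S : comNzRingType) (phi : {rmorphism R -> S}) x x' mu :
  (forall i, map_poly (map_poly phi) (x i) = x' i) ->
  map_poly (map_poly phi) (xpow x mu) = xpow x' mu.
Proof. by move=> E; rewrite rmorph_prod; apply: eq_bigr => i _; rewrite rmorphXn /= E. Qed.

Lemma xpow_scale (R : comNzRingType) (c : {poly R}) x mu :
  xpow (fun i => c *: x i) mu = c ^+ (mdeg mu - mu ord_max) *: xpow x mu.
Proof.
rewrite mdegE big_ord_recr /= addnK /xpow.
elim: (index_enum _) => [|i r IHr]; first by rewrite !big_nil expr0 scale1r.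
by rewrite !big_cons IHr exprZn exprD -scalerAr -scalerAl !scalerA mulrC.
Qed.

Variables (R S : comNzRingType) (phi : {rmorphism R -> S}).
Variables (x : nat -> {poly {poly R}}) (x' : nat -> {poly {poly S}}).
Variables (b : 'I_m * 'I_n -> {poly {poly R}}) (b' : 'I_m * 'I_n -> {poly {poly S}}).
Hypothesis xE : forall i, map_poly (map_poly phi) (x i) = x' i.
Hypothesis bE : forall w, map_poly (map_poly phi) (b w) = b' w.

Lemma volume_famP_map kP lP NP (eP : 'I_NP -> 'I_4 * ('I_m * 'I_n))
    (fP : 'I_NP -> 'I_kP * 'I_lP) :
  phi (volume eP fP (famP x b)) = volume eP fP (famP x' b').
Proof.
rewrite volume_map; apply: eq_volume => -[i w]; rewrite /famP /=; case: ifP => // _.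
by rewrite rmorphM /= xE map_bipow.
Qed.

Lemma volume_famS_map kS lS NS (eS : 'I_NS -> Gamma0 d * ('I_m * 'I_n))
    (fS : 'I_NS -> 'I_kS * 'I_lS) :
  phi (volume eS fS (famS x b)) = volume eS fS (famS x' b').
Proof.
rewrite volume_map; apply: eq_volume => -[i w]; rewrite /famS /= rmorphM /=.
by rewrite (map_xpow _ xE); case: ifP => _; rewrite ?bE ?map_bipow.
Qed.

End Transport.

Section Sparse.
Variables (m n : nat) (R : comNzRingType).

(** The forms [s^m t^n], [s^m v^n], [u^m t^n]. Together with the monomials of [S_{m-1,n-1}] as
    complement, their multiples run once through all monomials of bidegree [(2m-1, 2n-1)], so this
    complement is generically admissible. *)
Definition sparse_coef (i : 'I_3) (j : 'I_m.+1) (k : 'I_n.+1) : R :=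
  match nat_of_ord i with
  | 0 => (j == m :> nat) && (k == n :> nat)
  | 1 => (j == m :> nat) && (k == 0 :> nat)
  | _ => (j == 0 :> nat) && (k == n :> nat)
  end%:R.

Lemma biform_single a b : (a <= m)%N -> (b <= n)%N ->
  biform (fun (j : 'I_m.+1) (k : 'I_n.+1) => ((j == a :> nat) && (k == b :> nat))%:R) =
  bipow a b :> {poly {poly R}}.
Proof.
move=> am bn; have am' : (a < m.+1)%N by []; have bn' : (b < n.+1)%N by [].
rewrite /biform (bigD1 (Ordinal am')) //= (bigD1 (Ordinal bn')) //= !eqxx scale1r.
rewrite [X in _ + X + _]big1 ?addr0 => [|k kb]; last first.
  by rewrite (negPf kb : (k == b :> nat) = false) scale0r.
rewrite big1 ?addr0 // => j ja; apply: big1 => k _.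
by rewrite (negPf ja : (j == a :> nat) = false) scale0r.
Qed.

Lemma sparse_forms i : (i < 3)%N -> forms3 sparse_coef i =
  match i with 0 => bipow m n | 1 => bipow m 0 | _ => bipow 0 n end.
Proof.
by move=> i3; rewrite /forms3 /sparse_coef inordK //; case: i i3 => [|[|[|//]]] _;
  apply: biform_single.
Qed.

End Sparse.

Lemma sparse_volume_unit m n (R : comUnitRingType) kP lP NP
    (eP : 'I_NP -> 'I_4 * ('I_m * 'I_n)) (fP : 'I_NP -> 'I_kP * 'I_lP) :
  bijective eP -> bijective fP -> kP = (2 * m)%N -> lP = (2 * n)%N ->
  volume eP fP (famP (forms3 (@sparse_coef m n R)) (biw R)) \is a GRing.unit.
Proof.
move=> eP_bij fP_bij kPE lPE; apply: (spanned_volume_unit eP_bij fP_bij) => i j; rewrite kPE lPE => im jn.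
pose g : 'I_4 * ('I_m * 'I_n) -> _ := famP (forms3 (@sparse_coef m n R)) (biw R).
have gen (r : 'I_4) (w : 'I_m * 'I_n) P : P = g (r, w) -> spanned g P.
  by move=> ->; apply: spanned_gen.
have [lm|gm] := ltnP i m; have [ln|gn] := ltnP j n.
- by apply: (gen ord_max (Ordinal lm, Ordinal ln)); rewrite /g /famP /=.
- have ln' : (j - n < n)%N by lia.
  apply: (gen (inord 2) (Ordinal lm, Ordinal ln')); rewrite /g /famP /= inordK //.
  by rewrite sparse_forms // /biw bipowM /= add0n subnKC.
- have lm' : (i - m < m)%N by lia.
  apply: (gen (inord 1) (Ordinal lm', Ordinal ln)); rewrite /g /famP /= inordK //.
  by rewrite sparse_forms // /biw bipowM /= add0n subnKC.
have ln' : (j - n < n)%N by lia.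
have lm' : (i - m < m)%N by lia.
apply: (gen (inord 0) (Ordinal lm', Ordinal ln')); rewrite /g /famP /= inordK //.
by rewrite sparse_forms // /biw bipowM /= !subnKC.
Qed.

(** With [d = e.+1] and [2a = (d+1)d], this is the identity [d(d+1)^2 - 4a = (d+1)d(d-1)]. *)
Lemma exponent_comparison (e i j a : nat) :
  (6 * i + (e.+1 * e.+2 ^ 2 - a) = 6 * j + 3 * a)%N -> (2 * a = e.+2 * e.+1)%N ->
  (e.+2 * e.+1 * e = 6 * (j - i) /\ i <= j)%N.
Proof.
move=> E a2; have T : (e.+1 * e.+2 ^ 2 = 2 * (a * e) + 4 * a)%N.
  by rewrite expnS expn1 mulnA (mulnC e.+1) -a2; lia.
have P : (e.+2 * e.+1 * e = 2 * (a * e))%N by rewrite -a2; lia.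
by rewrite P; move: E; rewrite T; move: (a * e)%N => b; lia.
Qed.

Section Comparison.
Variables (m n d : nat).
Hypotheses (m_gt0 : (0 < m)%N) (n_gt0 : (0 < n)%N) (d_gt0 : (0 < d)%N).
Variables (ND : nat) (eD : 'I_ND -> 'I_3 * ('I_(2 * m) * 'I_n)).
Variables (fD : 'I_ND -> 'I_(3 * m) * 'I_(2 * n)).
Hypotheses (eD_bij : bijective eD) (fD_bij : bijective fD).
Variables (kP lP NP : nat) (eP : 'I_NP -> 'I_4 * ('I_m * 'I_n)).
Variables (fP : 'I_NP -> 'I_kP * 'I_lP).
Hypotheses (eP_bij : bijective eP) (fP_bij : bijective fP).
Hypotheses (kPE : kP = (2 * m)%N) (lPE : lP = (2 * n)%N).
Variables (kS lS NS : nat) (eS : 'I_NS -> Gamma0 d * ('I_m * 'I_n)).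
Variables (fS : 'I_NS -> 'I_kS * 'I_lS).
Hypotheses (eS_bij : bijective eS) (fS_bij : bijective fS).
Hypotheses (kSE : kS = (d.+1 * m)%N) (lSE : lS = (d.+1 * n)%N).

Local Notation A3 := {mpoly int[#|coefIdx 3 m n|]}.
Local Notation gforms := (forms3 (@generic_coef m n)).

Definition MPgen : A3 := volume eP fP (famP gforms (biw A3)).
Definition MSgen : A3 := volume eS fS (famS gforms (biw A3)).

Lemma map_gforms (R : comNzRingType) (phi : {rmorphism A3 -> R}) a i :
  (forall i j k, phi (generic_coef i j k) = a i j k) ->
  map_poly (map_poly phi) (gforms i) = forms3 a i.
Proof.
move=> E; rewrite map_forms3; apply: eq_bigr => j _; apply: eq_bigr => k _.
by rewrite E.
Qed.

Lemma MPgen_neq0 : MPgen != 0.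
Proof.
have U := sparse_volume_unit int eP_bij fP_bij kPE lPE.
apply: contraTneq U => E.
have <- : specialize (@sparse_coef m n int) MPgen = volume eP fP (famP (forms3 (@sparse_coef m n int)) (biw int)).
  apply: volume_famP_map => [i|w]; last exact: map_bipow.
  by apply: map_gforms => *; apply: specialize_generic.
by rewrite E rmorph0 unitr0.
Qed.

Let KA : fieldType := {fraction A3}.
Let toK : {rmorphism A3 -> KA} := @tofrac A3.
Let Kforms := forms3 (fun i j k => toK (generic_coef i j k)).

Let Kforms_size i : bisize m.+1 n.+1 (Kforms i).
Proof. exact: forms3_size. Qed.

Let toK_forms i : map_poly (map_poly toK) (gforms i) = Kforms i.
Proof. exact: map_gforms. Qed.

Let toK_biw (w : 'I_m * 'I_n) : map_poly (map_poly toK) (biw A3 w) = biw KA w :> {poly {poly KA}}.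
Proof. exact: map_bipow. Qed.

Lemma MSgen_neq0 : MSgen != 0.
Proof.
rewrite -tofrac_eq0 -[tofrac _]/(toK MSgen).
rewrite (volume_famS_map toK_forms toK_biw) -unitfE.
apply: (famS_unit (b := biw KA) Kforms_size _ m_gt0 n_gt0 eD_bij fD_bij _ eP_bij fP_bij) => //.
- by move=> w; apply: bisize_widen (bisize_biw _ w); rewrite leq_pmull.
- rewrite unitfE -[volume _ _ _]/(dixon eD fD Kforms) -dixon_map tofrac_eq0.
  exact: generic_dixon_neq0.
by rewrite unitfE -(volume_famP_map toK_forms toK_biw) tofrac_eq0 MPgen_neq0.
Qed.

Lemma generic_change_complement h :
  let b := @monomials m n A3 h in
  MSgen * volume eP fP (famP gforms b) ^+ #|@marked d| =
  volume eS fS (famS gforms b) * MPgen ^+ #|@marked d|.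
Proof.
move=> b; apply/eqP; rewrite -tofrac_eq; apply/eqP.
have mw (w : 'I_m * 'I_n) : map_poly (map_poly toK) (b w) = monomials KA h w by apply: map_bipow.
have P0 : volume eP fP (famP Kforms (biw KA)) != 0.
  by rewrite -(volume_famP_map toK_forms toK_biw) tofrac_eq0 MPgen_neq0.
have biw_size w : bisize (2 * m) (2 * n) (biw KA (m := m) (n := n) w).
  by apply: bisize_widen (bisize_biw _ w); rewrite leq_pmull.
have := volume_famS_famP Kforms_size biw_size (monomials_size KA h) eP_bij fP_bij kPE lPE P0 fS eS_bij.
rewrite -(volume_famP_map toK_forms toK_biw eP fP) -(volume_famP_map toK_forms mw eP fP).
rewrite -(volume_famS_map toK_forms toK_biw eS fS) -(volume_famS_map toK_forms mw eS fS).
have mor (a c : A3) k : toK (a * c ^+ k) = toK a * toK c ^+ k.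
  by rewrite rmorphM rmorphXn.
by move=> E; apply: etrans (mor _ _ _) (etrans (esym E) (esym (mor _ _ _))).
Qed.

Variable Res : A3.
Hypothesis Res_res : isBihomResultant Res.

Lemma MSgen_up_to_powers : exists i j u, u \is a GRing.unit /\
  Res ^+ i * MSgen = u * Res ^+ j * MPgen ^+ #|@marked d|.
Proof.
have fac : factorial_ring A3 by apply/factorial_mpoly/factorial_int.
have [Rirr ResP] := Res_res.
have Rprime := irreducible_prime fac Rirr.
have [u Uu DE] := generic_dixon_resultant m_gt0 n_gt0 eD_bij fD_bij Res_res.
apply: same_valuations => //; first exact: MSgen_neq0.
  by rewrite expf_neq0 // MPgen_neq0.
move=> p pp npR; have [code code_inj] := mpoly_int_code #|coefIdx 3 m n|.
have [k [phi phiP]] := residue_field code_inj pp.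
pose x := forms3 (fun i j l => phi (generic_coef i j l)).
have x_size i : bisize m.+1 n.+1 (x i) by apply: forms3_size.
have phi_forms i : map_poly (map_poly phi) (gforms i) = x i by apply: map_gforms.
have D0 : dixon eD fD x != 0.
  rewrite -dixon_map -/(generic_dixon eD fD) DE rmorphM mulf_neq0 //.
    by rewrite -unitfE rmorph_unit.
  by apply/eqP => /phiP.
have [h hP] := complement_by_monomials x_size eD_bij eP_bij fP_bij kPE lPE D0.
pose b := @monomials m n A3 h.
have phi_b w : map_poly (map_poly phi) (b w) = monomials k h w by apply: map_bipow.
(* The cofactors come from the change to the monomials [h], picked for this [p] so that both
   determinants survive in its residue field. *)
exists (volume eP fP (famP gforms b) ^+ #|@marked d|), (volume eS fS (famS gforms b)).
split; last by rewrite generic_change_complement mulrC.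
  by move=> /(prime_elt_dvd_exp pp)/phiP/eqP; rewrite (volume_famP_map phi_forms phi_b) (negPf hP).
move=> /phiP/eqP; rewrite (volume_famS_map phi_forms phi_b); apply/negP; rewrite -unitfE.
apply: (famS_unit x_size _ m_gt0 n_gt0 eD_bij fD_bij _ eP_bij fP_bij kPE lPE); rewrite ?unitfE //.
by move=> w; apply: monomials_size.
Qed.

(** Doubling the three forms multiplies each determinant by a power of 2, which reveals its
    degree. *)
Let double : {rmorphism A3 -> A3} := specialize (fun i j k => 2%:R * generic_coef i j k).

Let double_forms i : map_poly (map_poly double) (gforms i) = (2%:R%:P : {poly A3}) *: gforms i.
Proof.
rewrite (@map_gforms _ _ (fun i j k => 2%:R * generic_coef i j k)); last first.
  by move=> *; apply: specialize_generic.
rewrite /forms3 /biform scaler_sumr; apply: eq_bigr => j _; rewrite scaler_sumr.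
by apply: eq_bigr => k _; rewrite polyCM -scalerA.
Qed.

Let double_const (c : A3) : c = 1 \/ c = -1 -> double c = c.
Proof. by case=> ->; rewrite ?rmorphN rmorph1. Qed.

Lemma double_dixon : double (generic_dixon eD fD) = 2%:R ^+ (6 * m * n) * generic_dixon eD fD.
Proof.
rewrite /generic_dixon /dixon volume_map.
rewrite (eq_volume eD fD (g' := fun j => (2%:R : A3)%:P *: famD gforms j)).
  rewrite (volume_scale fD (fun=> 2%:R) (famD gforms) eD_bij) prodr_const; congr (_ ^+ _ * _).
  by rewrite !card_prod !card_ord; lia.
by move=> [i w]; rewrite /famD rmorphM /= double_forms map_bipow scalerAl.
Qed.

(** The homogeneity and the degree of [Res] are read off the determinant [D], to which it is equal
    up to sign. *)
Lemma double_Res : double Res = 2%:R ^+ (6 * m * n) * Res.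
Proof.
have [u Uu DE] := generic_dixon_resultant m_gt0 n_gt0 eD_bij fD_bij Res_res.
have := double_dixon; rewrite DE rmorphM (double_const (mpoly_int_unit Uu)) mulrCA.
by move/(mulrI Uu).
Qed.

Lemma double_MPgen : double MPgen = 2%:R ^+ (3 * m * n) * MPgen.
Proof.
rewrite /MPgen volume_map.
pose c (j : 'I_4 * ('I_m * 'I_n)) : A3 := if (j.1 < 3)%N then 2%:R else 1.
rewrite (eq_volume eP fP (g' := fun j => (c j)%:P *: famP gforms (biw A3) j)).
  rewrite (volume_scale fP c (famP gforms (biw A3)) eP_bij); congr (_ * _); rewrite /c.
  rewrite -(pair_bigA _ (fun (i : 'I_4) (_ : 'I_m * 'I_n) =>
    if (i < 3)%N then 2%:R else 1 : A3)) /=.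
  rewrite !big_ord_recl big_ord0 /= !prodr_const expr1n !mulr1 -!exprD; congr (_ ^+ _).
  by rewrite card_prod !card_ord; lia.
move=> [i w]; rewrite /c /famP /=; case: ifP => _; last by rewrite map_bipow scale1r.
by rewrite rmorphM /= double_forms map_bipow scalerAl.
Qed.

(** A column of exponent [gamma] contains [d - gamma_4] factors among the first three forms. *)
Lemma double_MSgen :
  double MSgen = 2%:R ^+ ((d * #|{: Gamma0 d}| - #|@marked d|) * (m * n)) * MSgen.
Proof.
rewrite /MSgen volume_map.
pose c (j : Gamma0 d * ('I_m * 'I_n)) : A3 := 2%:R ^+ (d - marked j.1).
rewrite (eq_volume eS fS (g' := fun j => (c j)%:P *: famS gforms (biw A3) j)).
  rewrite (volume_scale fS c (famS gforms (biw A3)) eS_bij); congr (_ * _).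
  rewrite -expr_sum; congr (_ ^+ _).
  rewrite -(pair_bigA _ (fun (i : Gamma0 d) (w : 'I_m * 'I_n) => (d - marked i)%N)) /=.
  under eq_bigr => i _ do rewrite sum_nat_const card_prod !card_ord mulnC.
  rewrite -big_distrl /= sumnB; last by move=> g _; case: (marked g).
  rewrite sum_nat_const (mulnC _ d); congr ((_ - _) * _)%N.
  rewrite -sum1_card [in RHS]big_mkcond; apply: eq_bigr => g _.
  by rewrite unfold_in -/(marked g); case: (marked g).
move=> [g w]; rewrite /famS /= rmorphM /= (map_xpow _ double_forms) xpow_scale.
rewrite mdeg_Gamma0 last_Gamma0 polyC_exp -scalerAl.
by case: ifP => _; rewrite map_bipow.
Qed.

Lemma MSgen_eq (card_Gamma0 : #|{: Gamma0 d}| = (d.+1 ^ 2)%N) :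
  exists2 u, u = 1 \/ u = -1 &
    MSgen = u * Res ^+ (d.+1 * d * d.-1 %/ 6) * MPgen ^+ #|@marked d|.
Proof.
have [i [j [u [Uu E]]]] := MSgen_up_to_powers.
have u1 := mpoly_int_unit Uu.
have [Rirr _] := Res_res; have R0 : Res != 0 by case: Rirr.
have := congr1 double E; rewrite !rmorphM !rmorphXn /= double_Res double_MPgen double_MSgen.
rewrite (double_const u1) !exprMn -!exprM => E2.
set X := (6 * m * n * i + (d * #|{: Gamma0 d}| - #|@marked d|) * (m * n))%N.
set Y := (6 * m * n * j + 3 * m * n * #|@marked d|)%N.
have E3 : (2%:R : A3) ^+ X * (Res ^+ i * MSgen) = 2%:R ^+ Y * (Res ^+ i * MSgen).
  have aux (p q r t R1 R2 M P v : A3) : q * R1 * (p * M) = v * (r * R2) * (t * P) ->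
      R1 * M = v * R2 * P -> q * p * (R1 * M) = r * t * (R1 * M).
    by move=> e1 e2; transitivity (q * R1 * (p * M)); [ring | rewrite e1 e2; ring].
  by rewrite !exprD; apply: aux E2 E.
have RM0 : Res ^+ i * MSgen != 0 by rewrite mulf_neq0 ?expf_neq0 // MSgen_neq0.
(* Specializing the coefficients to 0 turns the equality of the two powers of 2 into one between
   integers. *)
have XY : X = Y.
  have := congr1 (specialize (fun _ _ _ => 0 : int)) (mulIf RM0 E3).
  rewrite !rmorphXn !rmorph_nat -!natrX => /eqP.
  by rewrite eqr_nat eqn_exp2l // => /eqP.
have ji : j = (i + d.+1 * d * d.-1 %/ 6)%N.
  have a2 : (2 * #|@marked d| = d.+1 * d)%N.
    by rewrite card_marked mulnC divnK // dvdn2 oddM /= andNb.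
  have mn : (0 < m * n)%N by rewrite muln_gt0 m_gt0.
  have {}XY : (6 * i + (d * d.+1 ^ 2 - #|@marked d|) = 6 * j + 3 * #|@marked d|)%N.
    by apply/eqP; rewrite -(eqn_pmul2r mn) !mulnDl; apply/eqP; move: XY; rewrite /X /Y card_Gamma0; lia.
  have [e de] : exists e, d = e.+1 by exists d.-1; rewrite prednK.
  rewrite de in XY a2 *; have [prod ij] := exponent_comparison XY a2.
  by rewrite prod mulKn // subnKC.
exists u => //; apply: (mulfI (x := Res ^+ i)); first exact: expf_neq0.
rewrite E ji exprD; move: (Res ^+ i) (Res ^+ _) (MPgen ^+ _) => x y z.
by ring.
Qed.

End Comparison.

(** * From bihomogeneous to bivariate polynomials *)

Section Dehomogenization.
Variable R : comNzRingType.
Implicit Types P Q : {mpoly R[4]}.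

Let o1 : 'I_4 := inord 1.
Let o2 : 'I_4 := inord 2.

Definition dehom : {rmorphism {mpoly R[4]} -> {poly {poly R}}} :=
  mmap (polyC \o polyC : R -> {poly {poly R}})
    (tnth [tuple 'X%:P; 1; 'X; 1] : 'I_4 -> {poly {poly R}}).

Definition bihom k l P := forall mu : 'X_{1..4}, P@_mu != 0 ->
  (mu ord0 + mu o1 = k)%N /\ (mu o2 + mu ord_max = l)%N.

Lemma bihomM k l k' l' P Q : bihom k l P -> bihom k' l' Q ->
  bihom (k + k') (l + l') (P * Q).
Proof.
move=> hP hQ mu; rewrite -mcoeff_msupp => /msuppM_le/allpairsP[[m1 m2] /=].
rewrite !mcoeff_msupp => -[/hP[e1 e2] /hQ[e3 e4] ->].
by rewrite !mnmDE -e1 -e2 -e3 -e4; split; lia.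
Qed.

Lemma bihomX k l P e : bihom k l P -> bihom (e * k) (e * l) (P ^+ e).
Proof.
move=> hP; elim: e => [|e IHe]; last by rewrite exprS !mulSn; apply: bihomM.
move=> mu; rewrite expr0 mcoeff1; have [->|_] := eqVneq mu 0%MM; last by rewrite eqxx.
by rewrite !mnm0E.
Qed.

Lemma bimonE k l (ab : 'I_k.+1 * 'I_l.+1) :
  [/\ bimon ab ord0 = ab.1, bimon ab o1 = (k - ab.1)%N,
      bimon ab o2 = ab.2 & bimon ab ord_max = (l - ab.2)%N].
Proof.
by split; rewrite multinomE (tnth_nth 0%N) /= ?inordK.
Qed.

Lemma bihom_bimon k l (ab : 'I_k.+1 * 'I_l.+1) : bihom k l 'X_[R, bimon ab].
Proof.
move=> mu; rewrite mcoeffX; have [<-|_] := eqVneq (bimon ab) mu; last by rewrite eqxx.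
have [-> -> -> ->] := bimonE ab; have := ltn_ord ab.1; have := ltn_ord ab.2.
by split; lia.
Qed.

Lemma bihom_bipoly k l (a : 'I_k.+1 -> 'I_l.+1 -> R) : bihom k l (bipoly a).
Proof.
move=> mu nz; apply: NNPP => nb; case/negP: nz; apply/eqP.
rewrite raddf_sum /=; apply: big1 => i _; rewrite raddf_sum /=; apply: big1 => j _.
rewrite mcoeffZ; have [->|nz] := eqVneq ('X_[R, bimon (i, j)])@_mu 0; first by rewrite mulr0.
by case: nb; apply: bihom_bimon nz.
Qed.

Lemma dehom_X mu : dehom 'X_[mu] = bipow (mu ord0) (mu o2).
Proof.
rewrite /dehom /= mmapX /mmap1 !big_ord_recl big_ord0 /= !expr1n !mul1r !mulr1.
rewrite /bipow -mul_polyC rmorphXn; congr (_ * 'X^(mu _)); apply: val_inj.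
by rewrite /= inordK.
Qed.

Lemma dehom_C (c : R) : dehom c%:MP = c%:P%:P.
Proof. exact: mmapC. Qed.

(** In a fixed bidegree the exponents of [s] and [t] determine those of [u] and [v], so setting
    [u = v = 1] merges no monomials. *)
Lemma coef_dehom k l (ab : 'I_k.+1 * 'I_l.+1) P : bihom k l P ->
  P@_(bimon ab) = (dehom P)`_(ab.2)`_(ab.1).
Proof.
move=> hP; rewrite {2}[P]mpolyE rmorph_sum /= !coef_sum.
have E mu : P@_mu != 0 -> ((dehom (P@_mu *: 'X_[mu]))`_(ab.2)`_(ab.1)) = P@_mu * (mu == bimon ab)%:R.
  move=> nz; rewrite -mul_mpolyC rmorphM dehom_C dehom_X coefCM coefCM coef_bipow.
  congr (_ * (nat_of_bool _)%:R); have [e1 e2] := hP _ nz; have [b0 b1 b2 b3] := bimonE ab.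
  apply/andP/eqP => [[/eqP i /eqP j]|->]; last by rewrite b0 b2 !eqxx.
  apply/mnmP => r; have : r \in [:: ord0; o1; o2; ord_max].
    by rewrite !inE -!val_eqE /= !inordK //; case: r => -[|[|[|[|//]]]].
  have := ltn_ord ab.1; have := ltn_ord ab.2.
  rewrite !inE => la lb /or4P[] /eqP->; rewrite ?b0 ?b1 ?b2 ?b3 //; lia.
rewrite big_seq (eq_bigr (fun mu => P@_mu * (mu == bimon ab)%:R)); last first.
  by move=> mu; rewrite mcoeff_msupp; apply: E.
rewrite -big_seq; have [supp|nsupp] := boolP (bimon ab \in msupp P).
  rewrite (bigD1_seq (bimon ab)) ?msupp_uniq //= eqxx mulr1 big1 ?addr0 // => mu /negPf ->.
  by rewrite mulr0.
rewrite memN_msupp_eq0 // big1_seq // => mu /andP[_ mus].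
by case: eqVneq => [e|_]; [rewrite -e mus in nsupp | rewrite mulr0].
Qed.

Lemma dehom_bipoly k l (a : 'I_k.+1 -> 'I_l.+1 -> R) : dehom (bipoly a) = biform a.
Proof.
rewrite rmorph_sum; apply: eq_bigr => i _; rewrite rmorph_sum; apply: eq_bigr => j _ /=.
rewrite -mul_mpolyC rmorphM dehom_C dehom_X mul_polyC.
by have [-> _ -> _] := bimonE (i, j).
Qed.

Lemma combMap_familyBasis (I : finType) k l (y : I -> {mpoly R[4]}) (e : I * ('I_k.+1 * 'I_l.+1)) :
  combMap y (familyBasis R e) = 'X_[bimon e.2] * y e.1.
Proof.
rewrite /combMap (bigD1 e.1) //= /familyBasis eqxx big1 ?addr0 // => i /negPf ->.
by rewrite mul0r.
Qed.

End Dehomogenization.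

Section Bridge.
Variables (m n d : nat) (R : comNzRingType) (c : 'I_4 -> 'I_m.+1 -> 'I_n.+1 -> R).
Hypotheses (m_gt0 : (0 < m)%N) (n_gt0 : (0 < n)%N).

Definition first_forms := forms3 (fun i : 'I_3 => c (widen_ord (leqnSn 3) i)).

Definition last_family (w : 'I_m * 'I_n) : {poly {poly R}} := biform (c ord_max) * biw _ w.

Lemma MP_entry (j : 'I_4 * ('I_m * 'I_n)) (w : 'I_m.-1.+1 * 'I_n.-1.+1)
   (ab : 'I_(2 * m).-1.+1 * 'I_(2 * n).-1.+1) :
  w.1 = j.2.1 :> nat -> w.2 = j.2.2 :> nat ->
  (combMap (fun i => bipoly (c i)) (familyBasis R (j.1, w)))@_(bimon ab) =
  (famP first_forms last_family j)`_(ab.2)`_(ab.1).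
Proof.
move=> w1 w2; rewrite combMap_familyBasis.
rewrite (coef_dehom (k := (2 * m).-1) (l := (2 * n).-1)); last first.
  have -> : ((2 * m).-1 = m.-1 + m)%N by lia.
  have -> : ((2 * n).-1 = n.-1 + n)%N by lia.
  by apply: bihomM; [apply: bihom_bimon | apply: bihom_bipoly].
rewrite rmorphM /= dehom_bipoly dehom_X; have [-> _ -> _] := bimonE w.
rewrite w1 w2 mulrC; case: j w1 w2 => i u /= _ _; rewrite /famP /=; case: ifP => i3.
  rewrite /first_forms /forms3 (_ : widen_ord _ _ = i) //.
  by apply: val_inj; rewrite /= inordK.
by rewrite (_ : i = ord_max) //; apply/val_inj/eqP; rewrite eqn_leq -ltnS ltn_ord leqNgt i3.
Qed.

Lemma bihom_monomial (mu : 'X_{1..4}) :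
  bihom (mdeg mu * m) (mdeg mu * n) (\prod_(i < 4) bipoly (c i) ^+ mu i).
Proof.
rewrite mdegE; elim: (index_enum _) => [|i r IHr].
  by rewrite !big_nil -(expr0 (bipoly (c ord0))); apply/bihomX/bihom_bipoly.
by rewrite !big_cons !mulnDl; apply: bihomM IHr; apply/bihomX/bihom_bipoly.
Qed.

Lemma dehom_monomial (mu : 'X_{1..4}) :
  dehom R (\prod_(i < 4) bipoly (c i) ^+ mu i) =
  xpow first_forms mu * biform (c ord_max) ^+ mu ord_max.
Proof.
rewrite rmorph_prod big_ord_recr /= rmorphXn /= dehom_bipoly; congr (_ * _).
apply: eq_bigr => i _; rewrite rmorphXn /= dehom_bipoly; congr (_ ^+ _).
by rewrite /first_forms /forms3 inord_val.
Qed.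

Lemma MS_entry (j : Gamma0 d * ('I_m * 'I_n)) (w : 'I_m.-1.+1 * 'I_n.-1.+1)
   (ab : 'I_(d.+1 * m).-1.+1 * 'I_(d.+1 * n).-1.+1) :
  w.1 = j.2.1 :> nat -> w.2 = j.2.2 :> nat ->
  (combMap (fun g : Gamma0 d => \prod_(i < 4) bipoly (c i) ^+ bmnm (val g) i)
     (familyBasis R (j.1, w)))@_(bimon ab) =
  (famS first_forms last_family j)`_(ab.2)`_(ab.1).
Proof.
move=> w1 w2; rewrite combMap_familyBasis.
rewrite (coef_dehom (k := (d.+1 * m).-1) (l := (d.+1 * n).-1)); last first.
  have -> : ((d.+1 * m).-1 = m.-1 + d * m)%N by rewrite mulSn; lia.
  have -> : ((d.+1 * n).-1 = n.-1 + d * n)%N by rewrite mulSn; lia.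
  apply: bihomM; first exact: bihom_bimon.
  by rewrite -{1 2}(mdeg_Gamma0 j.1); apply: bihom_monomial.
rewrite rmorphM dehom_monomial /= dehom_X; have [-> _ -> _] := bimonE w.
rewrite w1 w2 /famS mulrC -mulrA last_Gamma0.
by case: (marked _); rewrite ?expr1 ?expr0 ?mul1r.
Qed.

End Bridge.

(** * Return to four generic forms *)

Lemma genCoef_sparse_neq0 m n kP lP NP (eP : 'I_NP -> 'I_4 * ('I_m * 'I_n))
    (fP : 'I_NP -> 'I_kP * 'I_lP) :
  bijective eP -> bijective fP -> kP = (2 * m)%N -> lP = (2 * n)%N ->
  volume eP fP (famP (forms3 (@genCoef123 m n)) (biw (coefField m n))) != 0.
Proof.
move=> be bf kE lE.
pose A4 := {mpoly rat[#|coefIdx 4 m n|]}.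
pose a (i : 'I_3) (j : 'I_m.+1) (k : 'I_n.+1) : A4 :=
  'X_(enum_rank ((widen_ord (leqnSn 3) i, j, k) : coefIdx 4 m n)).
have toK i : map_poly (map_poly (@tofrac A4)) (forms3 a i) = forms3 (@genCoef123 m n) i.
  by rewrite map_forms3.
have toKb (w : 'I_m * 'I_n) : map_poly (map_poly (@tofrac A4)) (biw A4 w) = biw _ w.
  exact: map_bipow.
rewrite -(volume_famP_map toK toKb) tofrac_eq0.
(* For the coefficients of [x_4], [inord] yields the default index 0; the polynomials [a] contain
   only those of the first three forms. *)
pose v (x : 'I_#|coefIdx 4 m n|) : rat :=
  let: (i, j, k) := enum_val x in @sparse_coef m n rat (inord i) j k.
have spec i : map_poly (map_poly (meval v)) (forms3 a i) = forms3 (@sparse_coef m n rat) i.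
  rewrite map_forms3; apply: eq_bigr => j _; apply: eq_bigr => k _.
  rewrite /a /= mevalXU /v enum_rankK /= (_ : inord _ = inord i) //.
  by apply: val_inj; rewrite /= inordK.
have specb (w : 'I_m * 'I_n) : map_poly (map_poly (meval v)) (biw A4 w) = biw _ w.
  exact: map_bipow.
have := sparse_volume_unit rat be bf kE lE.
rewrite -(volume_famP_map spec specb) unitfE; apply: contra_neq => ->.
exact: meval0.
Qed.

(** The identity for the monomial complement is specialized to [x_1, x_2, x_3]; [volume_famS_famP]
    then passes to the complement [x_4 w], and the power of the first [P] cancels because it is
    nonzero. *)
Lemma volume_identity (F : fieldType) m n d (c : 'I_4 -> 'I_m.+1 -> 'I_n.+1 -> F)
    kP lP NP (eP : 'I_NP -> 'I_4 * ('I_m * 'I_n)) (fP : 'I_NP -> 'I_kP * 'I_lP)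
    kS lS NS (eS : 'I_NS -> Gamma0 d * ('I_m * 'I_n)) (fS : 'I_NS -> 'I_kS * 'I_lS)
    (Res : {mpoly int[#|coefIdx 3 m n|]}) :
  (0 < m)%N -> (0 < n)%N -> (0 < d)%N ->
  bijective eP -> bijective fP -> kP = (2 * m)%N -> lP = (2 * n)%N ->
  bijective eS -> bijective fS -> kS = (d.+1 * m)%N -> lS = (d.+1 * n)%N ->
  #|{: Gamma0 d}| = (d.+1 ^ 2)%N -> isBihomResultant Res ->
  volume eP fP (famP (first_forms c) (biw F)) != 0 ->
  exists eps : bool,
    (-1) ^+ eps * volume eS fS (famS (first_forms c) (last_family c)) =
    volume eP fP (famP (first_forms c) (last_family c)) ^+ (d.+1 * d %/ 2)
      * evalCoef Res (fun i : 'I_3 => c (widen_ord (leqnSn 3) i)) ^+ (d.+1 * d * d.-1 %/ 6).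
Proof.
move=> m_gt0 n_gt0 d_gt0 eP_bij fP_bij kPE lPE eS_bij fS_bij kSE lSE card_G Res_res P0.
(* Bases for [D] do not appear in the statement; any will do, both index types having [6mn]
   elements. *)
have [ND [eD [fD [eD_bij fD_bij]]]] : exists ND (eD : 'I_ND -> 'I_3 * ('I_(2 * m) * 'I_n))
    (fD : 'I_ND -> 'I_(3 * m) * 'I_(2 * n)), bijective eD /\ bijective fD.
  have eqc : #|{: 'I_3 * ('I_(2 * m) * 'I_n)}| = #|{: 'I_(3 * m) * 'I_(2 * n)}|.
    by rewrite !card_prod !card_ord; lia.
  exists #|{: 'I_3 * ('I_(2 * m) * 'I_n)}|, enum_val, (fun r => enum_val (cast_ord eqc r)).
  split; first exact: enum_val_bij.
  apply: bij_comp (enum_val_bij _) _.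
  by exists (cast_ord (esym eqc)) => r; [exact: cast_ordK | exact: cast_ordKV].
pose theta := specialize (fun i : 'I_3 => c (widen_ord (leqnSn 3) i)).
have xE i : map_poly (map_poly theta) (forms3 (@generic_coef m n) i) = first_forms c i.
  by apply: map_gforms => *; apply: specialize_generic.
have bE (w : 'I_m * 'I_n) : map_poly (map_poly theta) (biw _ w) = biw F w.
  exact: map_bipow.
have [u u1 SE] := MSgen_eq m_gt0 n_gt0 d_gt0 eD_bij fD_bij eP_bij fP_bij kPE lPE
  eS_bij fS_bij kSE lSE Res_res card_G.
have x_size i : bisize m.+1 n.+1 (first_forms c i) by apply: forms3_size.
have biw_size w : bisize (2 * m) (2 * n) (biw F (m := m) (n := n) w).
  by apply: bisize_widen (bisize_biw _ w); rewrite leq_pmull.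
have b0_size w : bisize (2 * m) (2 * n) (last_family c w).
  by apply: bisize_widen (bisizeM (biform_size _) (bisize_biw _ w)) => /=; lia.
have E0 := volume_famS_famP x_size biw_size b0_size eP_bij fP_bij kPE lPE P0 fS eS_bij.
have : theta (MSgen eS fS) = theta u * theta Res ^+ (d.+1 * d * d.-1 %/ 6) *
    theta (MPgen eP fP) ^+ #|@marked d|.
  by rewrite SE !rmorphM !rmorphXn.
rewrite (volume_famS_map xE bE) (volume_famP_map xE bE) card_marked => E1.
have sign : exists eps : bool, theta u = (-1) ^+ eps.
  by case: u1 => ->; [exists false | exists true]; rewrite ?rmorphN rmorph1.
have [eps uE] := sign; exists eps.
rewrite card_marked in E0; rewrite -specializeE -/theta.
apply: (mulIf (expf_neq0 (d.+1 * d %/ 2) P0)).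
move: E0 E1; rewrite uE => E0 E1; rewrite -[LHS]mulrA E0 E1 -!mulrA signrMK.
by rewrite [RHS]mulrCA; congr (_ * _); rewrite mulrC.
Qed.

Theorem theorem3p9 (m n d : nat) (m_gt0 : (0 < m)%N) (n_gt0 : (0 < n)%N)
    (d_gt0 : (0 < d)%N)
    (eP : 'I_(4 * m * n) -> 'I_4 * ('I_m.-1.+1 * 'I_n.-1.+1))
    (fP : 'I_(4 * m * n) -> 'I_(2 * m).-1.+1 * 'I_(2 * n).-1.+1)
    (eS : 'I_(d.+1 ^ 2 * m * n) -> Gamma0 d * ('I_m.-1.+1 * 'I_n.-1.+1))
    (fS : 'I_(d.+1 ^ 2 * m * n) -> 'I_(d.+1 * m).-1.+1 * 'I_(d.+1 * n).-1.+1)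
    (eP_bij : bijective eP) (fP_bij : bijective fP)
    (eS_bij : bijective eS) (fS_bij : bijective fS)
    (Res : {mpoly int[#|coefIdx 3 m n|]}) (Res_res : isBihomResultant Res) :
  exists eps : bool,
    (-1) ^+ eps * \det (MS eS fS) =
    \det (MP eP fP) ^+ ((d + 1) * d %/ 2)
      * evalCoef Res (@genCoef123 m n) ^+ ((d + 1) * d * (d - 1) %/ 6).
Proof.
case: m m_gt0 eP fP eS fS eP_bij fP_bij eS_bij fS_bij Res Res_res => [//|m] m_gt0.
case: n n_gt0 => [//|n] n_gt0 eP fP eS fS eP_bij fP_bij eS_bij fS_bij Res Res_res.
(* For successors the predecessors in the index types compute away, which matches the two ways of
   writing the bases. *)
have kPE : (2 * m.+1).-1.+1 = (2 * m.+1)%N by [].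
have lPE : (2 * n.+1).-1.+1 = (2 * n.+1)%N by [].
have kSE : (d.+1 * m.+1).-1.+1 = (d.+1 * m.+1)%N by [].
have lSE : (d.+1 * n.+1).-1.+1 = (d.+1 * n.+1)%N by [].
(* The cardinality of [Gamma0] is read off the bijection [eS]. *)
have card_G : #|{: Gamma0 d}| = (d.+1 ^ 2)%N.
  have := bij_eq_card eS_bij; rewrite card_ord !card_prod !card_ord -mulnA => /eqP.
  by rewrite eqn_pmul2r // => /eqP.
have MPE : \det (MP eP fP) = volume eP fP
    (famP (first_forms (@genCoef m.+1 n.+1)) (last_family (@genCoef m.+1 n.+1))).
  congr (\det _); apply/matrixP => r c; rewrite !mxE.
  exact: (@MP_entry m.+1 n.+1 _ (@genCoef m.+1 n.+1) m_gt0 n_gt0 (eP c) (eP c).2 (fP r)).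
have MSE : \det (MS eS fS) = volume eS fS
    (famS (first_forms (@genCoef m.+1 n.+1)) (last_family (@genCoef m.+1 n.+1))).
  congr (\det _); apply/matrixP => r c; rewrite !mxE.
  exact: (@MS_entry m.+1 n.+1 d _ (@genCoef m.+1 n.+1) m_gt0 n_gt0 (eS c) (eS c).2 (fS r)).
have P0 := genCoef_sparse_neq0 eP_bij fP_bij kPE lPE.
have [eps E] := volume_identity m_gt0 n_gt0 d_gt0 eP_bij fP_bij kPE lPE
  eS_bij fS_bij kSE lSE card_G Res_res P0.
by exists eps; rewrite MSE MPE addn1 subn1.
Qed.
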